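(* Let $d \ge 1$, $p \ge 1$, $s \in (0,1)$ and let $k \in \mathbb{N}$ with $1 \le k \le d$. Let $\alpha,\beta\in\mathbb{R}$ satisfy $\alpha,\ \beta,\ \alpha+\beta \in (-k, sp)$. Then, for all $u \in C^1_c(\mathbb{R}^d)$ when $sp < k+\alpha+\beta$, and for all $u \in C^1_c(\mathbb{R}^d\setminus K)$ when $sp > k+\alpha+\beta$, the following inequality holds: $$\int_{\mathbb{R}^d}\int_{\mathbb{R}^d} \frac{|u(x)-u(y)|^p}{|x-y|^{d+sp}}\,|x_k|^\alpha |y_k|^\beta\,dx\,dy \ \ge\ \mathcal{C}\int_{\mathbb{R}^d}\frac{|u(x)|^p}{|x_k|^{sp-\alpha-\beta}}\,dx,$$ where $\mathcal{C}=\mathcal{C}(d,s,p,k,\alpha,\beta)>0$ is the explicit constant defined in the context. Moreover this constant is optimal: in each of the two cases, the inequality fails for the indicated class of functions if $\mathcal{C}$ is replaced by any larger constant.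
   Context: Functions are real-valued. For $x\in\mathbb{R}^d$ write $x=(x_k,x_{d-k})$ with $x_k\in\mathbb{R}^k$, $x_{d-k}\in\mathbb{R}^{d-k}$ (for $k=d$, $x_k=x$). $K=\{x=(x_k,x_{d-k})\in\mathbb{R}^k\times\mathbb{R}^{d-k}: x_k=0\}$ for $k<d$, and $K=\{0\}$ for $k=d$. $C^1_c(\Omega)$ denotes the $C^1$ functions with compact support in the open set $\Omega$. For an integer $n\ge 1$ and $r\in(0,1)$ define $$\Phi_{n,s,p}(r)=|\mathbb{S}^{n-2}|\int_{-1}^1\frac{(1-t^2)^{\frac{n-3}{2}}}{(1-2tr+r^2)^{\frac{n+sp}{2}}}\,dt\quad (n\ge2),\qquad \Phi_{1,s,p}(r)=(1-r)^{-1-sp}+(1+r)^{-1-sp},$$ where $|\mathbb{S}^{n-2}|$ is the surface measure of the unit sphere in $\mathbb{R}^{n-1}$ ($|\mathbb{S}^0|=2$), and $$\mathcal{C}_1(n,s,p,\alpha,\beta)=\int_0^1 r^{sp-1}\left(r^{-\alpha}+r^{-\beta}\right)\left|1-r^{(n+\alpha+\beta-sp)/p}\right|^p\Phi_{n,s,p}(r)\,dr.$$ With $\Gamma$ the Gamma function, set $$\mathcal{C}(d,s,p,k,\alpha,\beta)=\frac{\pi^{(d-k)/2}\,\Gamma\!\left(\frac{k+sp}{2}\right)}{\Gamma\!\left(\frac{d+sp}{2}\right)}\,\mathcal{C}_1(k,s,p,\alpha,\beta).$$ *)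

(* Defs.v *)
From HB Require Import structures.
From mathcomp Require Import all_boot all_order all_algebra.
From mathcomp Require Import all_classical all_reals all_analysis.

Set Implicit Arguments.
Unset Strict Implicit.
Unset Printing Implicit Defensive.

Import Order.TTheory GRing.Theory Num.Theory.
Import numFieldNormedType.Exports.

Local Open Scope classical_set_scope.
Local Open Scope ring_scope.

(* Borel sigma-algebra of R^n, generated by the coordinate functions. *)
Definition rV_display : measure_display -> measure_display.
Proof. exact. Qed.

Section measurable_rV.
Variables (R : realType) (n : nat).

Let coor : 'I_n -> 'rV[R]_n -> R := fun i x => x ord0 i.

Let rV_set0 : g_sigma_preimage coor set0.
Proof. exact: sigma_algebra0. Qed.

Let rV_setC A : g_sigma_preimage coor A -> g_sigma_preimage coor (~` A).
Proof. exact: sigma_algebraC. Qed.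

Let rV_bigcup (F : _^nat) : (forall i, g_sigma_preimage coor (F i)) ->
  g_sigma_preimage coor (\bigcup_i (F i)).
Proof. exact: sigma_algebra_bigcup. Qed.

HB.instance Definition _ := @isMeasurable.Build (rV_display default_measure_display)
  'rV[R]_n (g_sigma_preimage coor) rV_set0 rV_setC rV_bigcup.

End measurable_rV.

Lemma measurable_coord (R : realType) n (i : 'I_n) :
  measurable_fun [set: 'rV[R]_n] (fun x => x ord0 i).
Proof.
move=> _ Y mY; rewrite setTI; apply: sub_sigma_algebra => /=.
rewrite -bigcup_seq/=; exists i => /=; first by rewrite mem_index_enum.
by exists Y => //; rewrite setTI.
Qed.

Lemma measurable_fun_rV d (T : measurableType d) (R : realType) n
    (f : T -> 'rV[R]_n) :
  (forall i, measurable_fun [set: T] (fun x => f x ord0 i)) ->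
  measurable_fun [set: T] f.
Proof.
move=> mf.
suff : g_sigma_preimage (fun i => (fun x : 'rV[R]_n => x ord0 i) \o f)
    `<=` measurable.
  rewrite g_sigma_preimage_comp => prefS _ A mA; apply: prefS.
  by exists A.
apply: smallest_sub; first exact: sigma_algebra_measurable.
case: n => [|n] in f mf *; first by rewrite big_ord0.
rewrite -bigcup_mkord_ord; apply: bigcup_sub => i Ii.
by move=> A [B mB <-]; exact: mf.
Qed.

Section lebesgue_rV.
Variable R : realType.

Definition rV_cons n (p : R * 'rV[R]_n) : 'rV[R]_n.+1 :=
  \row_i oapp (fun j => p.2 ord0 j) p.1 (unlift ord0 i).

Lemma rV_cons0 n p : @rV_cons n p ord0 ord0 = p.1.
Proof. by rewrite mxE unlift_none. Qed.

Lemma rV_consS n p j : @rV_cons n p ord0 (lift ord0 j) = p.2 ord0 j.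
Proof. by rewrite mxE liftK. Qed.

Lemma measurable_rV_cons n : measurable_fun [set: R * 'rV[R]_n] (@rV_cons n).
Proof.
apply: measurable_fun_rV => i; case: (unliftP ord0 i) => [j ->|->].
- under eq_fun do rewrite rV_consS.
  exact: (measurableT_comp (@measurable_coord R n j) measurable_snd).
- under eq_fun do rewrite rV_cons0.
  exact: measurable_fst.
Qed.

Lemma measurable_rV_cons_preimage n (A : set 'rV[R]_n.+1) :
  measurable A -> measurable (@rV_cons n @^-1` A).
Proof.
by move=> mA; rewrite -[X in measurable X]setTI; exact: measurable_rV_cons.
Qed.

Section lebesgue_cons.
Local Open Scope ereal_scope.
Variables (n : nat) (mu : {sigma_finite_measure set 'rV[R]_n -> \bar R}).

Definition lebesgue_cons : set 'rV[R]_n.+1 -> \bar R :=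
  pushforward (@lebesgue_measure R \x mu) (@rV_cons n).

Let lebesgue_cons0 : lebesgue_cons set0 = 0.
Proof. by rewrite /lebesgue_cons /pushforward preimage_set0 measure0. Qed.

Let lebesgue_cons_ge0 A : 0 <= lebesgue_cons A.
Proof. by rewrite /lebesgue_cons /pushforward; exact: measure_ge0. Qed.

Let lebesgue_cons_sigma_additive : semi_sigma_additive lebesgue_cons.
Proof.
move=> F mF tF mUF; rewrite /lebesgue_cons /pushforward preimage_bigcup.
apply: measure_semi_sigma_additive.
- by move=> i; exact: measurable_rV_cons_preimage.
- apply/trivIsetP => /= i j _ _ ij; rewrite -preimage_setI.
  by move/trivIsetP : tF => /(_ _ _ _ _ ij) ->//; rewrite preimage_set0.
- by rewrite -preimage_bigcup; exact: measurable_rV_cons_preimage.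
Qed.

HB.instance Definition _ := isMeasure.Build _ _ _ lebesgue_cons
  lebesgue_cons0 lebesgue_cons_ge0 lebesgue_cons_sigma_additive.

Let lebesgue_cons_sigma_finite : sigma_finite setT lebesgue_cons.
Proof.
have /sigma_finiteP[F [TF ndF Foo]] := sigma_finiteT (@lebesgue_measure R).
have /sigma_finiteP[G [TG ndG Goo]] := sigma_finiteT mu.
pose g (v : 'rV[R]_n.+1) : R * 'rV[R]_n :=
  (v ord0 ord0, \row_j v ord0 (lift ord0 j)).
have mg : measurable_fun setT g.
  apply/measurable_fun_pairP; split => /=; first exact: measurable_coord.
  apply: measurable_fun_rV => i /=; under eq_fun do rewrite mxE.
  exact: measurable_coord.
have gK : cancel (@rV_cons n) g.
  move=> [x v]; rewrite /g rV_cons0; congr pair.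
  by apply/rowP => j; rewrite mxE rV_consS.
exists (fun i => g @^-1` (F i `*` G i)).
  rewrite -preimage_bigcup (_ : \bigcup_i _ = setT) ?preimage_setT//.
  apply/seteqP; split => // -[x v] _.
  have [i _ Fix] : (\bigcup_i F i) x by rewrite -TF.
  have [j _ Gjv] : (\bigcup_i G i) v by rewrite -TG.
  exists (maxn i j) => //; split => /=.
  - by move: x Fix; exact/subsetPset/ndF/leq_maxl.
  - by move: v Gjv; exact/subsetPset/ndG/leq_maxr.
move=> i; have [mF Fioo] := Foo i; have [mG Gioo] := Goo i; split.
  by rewrite -[X in measurable X]setTI; apply: mg => //; exact: measurableX.
rewrite /lebesgue_cons /pushforward (_ : _ @^-1` _ = F i `*` G i); last first.
  by rewrite -comp_preimage (_ : g \o _ = id)//; apply/funext => z /=; exact: gK.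
by rewrite product_measure1E// lte_mul_pinfty// ge0_fin_numE.
Qed.

HB.instance Definition _ := @Measure_isSigmaFinite.Build _ _ _ lebesgue_cons
  lebesgue_cons_sigma_finite.

End lebesgue_cons.

(* Lebesgue measure on R^n, as the n-fold product of lebesgue_measure. *)
Fixpoint lebesgue_rV n : {sigma_finite_measure set 'rV[R]_n -> \bar R} :=
  match n with
  | 0 => \d_(0 : 'rV[R]_0)
  | n'.+1 => lebesgue_cons (lebesgue_rV n')
  end.

Lemma lebesgue_rV_box n (A : 'I_n -> set R) : (forall i, measurable (A i)) ->
  lebesgue_rV n [set v | forall i, A i (v ord0 i)] =
  (\prod_(i < n) lebesgue_measure (A i))%E.
Proof.
elim: n A => [|n IHn] A mA.
  rewrite big_ord0 /= diracE mem_set//.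
  by move=> [].
have mB : measurable [set v : 'rV[R]_n | forall i, A (lift ord0 i) (v ord0 i)].
  rewrite (_ : [set v | _] = \bigcap_(i in [set: 'I_n])
     ((fun v : 'rV[R]_n => v ord0 i) @^-1` A (lift ord0 i))); last first.
    by apply/seteqP; split => [v + i _|v + i]; apply.
  apply: fin_bigcap_measurable => // i _.
  by rewrite -[X in measurable X]setTI; exact: measurable_coord.
rewrite big_ord_recl -(IHn (fun i => A (lift ord0 i)))//.
rewrite -product_measure1E//; last exact: (mA ord0).
rewrite /= /lebesgue_cons /pushforward.
congr product_measure1; apply/seteqP; split => [[x v]/= vA|[x v]/= [xA vA] i].
  by split=> [|i]; [move: (vA ord0); rewrite rV_cons0|
    move: (vA (lift ord0 i)); rewrite rV_consS].
by case: (unliftP ord0 i) => [j ->|->]; rewrite ?rV_consS ?rV_cons0.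
Qed.

End lebesgue_rV.

Section hardy.
Variable R : realType.

Definition Gamma_fun (a : R) : R :=
  (\int[lebesgue_measure]_(t in `]0%R, +oo[) (t `^ (a - 1) * expR (- t)))%R.

(* Euclidean norm (the library norm on 'rV[R]_n is the max norm). *)
Definition enorm n (x : 'rV[R]_n) : R := Num.sqrt (\sum_i x ord0 i ^+ 2).

(* |x_k|, where x_k consists of the first k coordinates of x. *)
Definition enormk k n (x : 'rV[R]_n) : R :=
  Num.sqrt (\sum_(i < n | (i < k)%N) x ord0 i ^+ 2).

Definition Kset k n : set 'rV[R]_n :=
  [set x | forall i : 'I_n, (i < k)%N -> x ord0 i = 0].

Definition unit_sphere n : set 'rV[R]_n := [set x | enorm x = 1].

(* Surface measure on the unit sphere of R^n, normalised by polar coordinates: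
   sigma(E) = n * vol {r w | 0 < r <= 1, w \in E}. *)
Definition surface_measure n (E : set 'rV[R]_n) : \bar R :=
  (n%:R%:E * lebesgue_rV R n
     [set x | (0 < enorm x <= 1)%R /\ E ((enorm x)^-1 *: x)])%E.

(* |S^{n-1}|, the area of the unit sphere of R^n. *)
Definition sphere_area n : R := fine (surface_measure (@unit_sphere n)).

Definition Phi (n : nat) (s p r : R) : R :=
  if (n == 1)%N then
    (1 - r) `^ (- 1 - s * p) + (1 + r) `^ (- 1 - s * p)
  else
    sphere_area n.-1 *
    (\int[lebesgue_measure]_(t in `](-1)%R, 1%R[)
       ((1 - t ^+ 2) `^ ((n%:R - 3) / 2) /
        (1 - 2 * t * r + r ^+ 2) `^ ((n%:R + s * p) / 2)))%R.

Definition hardy_C1 (n : nat) (s p alpha beta : R) : R :=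
  (\int[lebesgue_measure]_(r in `]0%R, 1%R[)
     (r `^ (s * p - 1) * (r `^ (- alpha) + r `^ (- beta)) *
      `|1 - r `^ ((n%:R + alpha + beta - s * p) / p)| `^ p *
      Phi n s p r))%R.

Definition hardy_const (d : nat) (s p : R) (k : nat) (alpha beta : R) : R :=
  pi `^ ((d%:R - k%:R) / 2) * Gamma_fun ((k%:R + s * p) / 2) /
  Gamma_fun ((d%:R + s * p) / 2) * hardy_C1 k s p alpha beta.

Definition continuously_differentiable n (u : 'rV[R]_n -> R) : Prop :=
  (forall x, differentiable u x) /\
  (forall v, continuous (fun x => 'D_v u x)).

Definition tsupport n (u : 'rV[R]_n -> R) : set 'rV[R]_n :=
  closure [set x | u x != 0].

(* C^1_c(Omega), whose elements are extended by 0 to the whole space. *)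
Definition C1c n (Omega : set 'rV[R]_n) : set ('rV[R]_n -> R) :=
  [set u | [/\ continuously_differentiable u, compact (tsupport u)
             & tsupport u `<=` Omega]].

Definition hardy_lhs d (s p : R) k (alpha beta : R) (u : 'rV[R]_d -> R) :
    \bar R :=
  (\int[lebesgue_rV R d]_y \int[lebesgue_rV R d]_x
     (`|u x - u y| `^ p / enorm (x - y) `^ (d%:R + s * p) *
      enormk k x `^ alpha * enormk k y `^ beta)%:E)%E.

Definition hardy_rhs d (s p : R) k (alpha beta : R) (u : 'rV[R]_d -> R) :
    \bar R :=
  (\int[lebesgue_rV R d]_x
     (`|u x| `^ p / enormk k x `^ (s * p - alpha - beta))%:E)%E.

Definition hardy_inequality d (s p : R) k (alpha beta : R)
    (Omega : set 'rV[R]_d) (c : R) : Prop :=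
  forall u, C1c Omega u ->
    (c%:E * hardy_rhs s p k alpha beta u <= hardy_lhs s p k alpha beta u)%E.

End hardy.

(* Main.v *)
From HB Require Import structures.
Require Import Defs.
From mathcomp Require Import all_boot all_order all_algebra.
From mathcomp Require Import all_classical all_reals all_analysis.
From mathcomp Require Import measurable_realfun.
From mathcomp Require Import ring lra.

Set Implicit Arguments.
Unset Strict Implicit.
Unset Printing Implicit Defensive.

Import Order.TTheory GRing.Theory Num.Theory.
Import numFieldNormedType.Exports.

Local Open Scope classical_set_scope.
Local Open Scope ring_scope.

(** The power |x_k|^(-g) with g = (k + alpha + beta - sp)/p acts as a virtual ground state. Put l =
    (|y_k|/|x_k|)^(-g). Convexity of t^p gives a discrete Picone inequality: |A - B|^p is at least
    sgn(1-l) |1-l|^(p-1) |A|^p plus the same expression in 1/l and B, with equality for A = 1, B = l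
    ([ground_state_pointwise], [php_phm]). It is applied to A = u(x), B = u(y), multiplied by the
    kernel and the weights, and integrated.

    For fixed x, the integral in y of a function of |y_k|/|x_k| against the kernel is computed
    exactly ([integral_kernel]): the last d - k coordinates are integrated out, which produces the
    Gamma quotient ([integral_bessel]), then x_k is rotated onto the first axis and its length
    scaled away. What remains is a number [Jint], the integral over R^k of h(|z|) |e - z|^(-k-sp).
    Polar coordinates and the folding r -> 1/r identify it with C_1 when h is [hgt]
    ([hardy_C1_Jint]).

    The signed terms may fail to be absolutely integrable near l = 1. They are therefore kept on the
    two sides of the inequality as [php] and [phm], and [chi] restricts them to ratios away from 1.
    There the negative parts have finite integrals and can be cancelled ([ereal_cancel]), which
    leaves the inequality with a truncated constant ([hardy_truncated]); monotone convergence
    removes the truncation ([hardy_lower]). The cancellation requires a finite right-hand side, and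
    this is where the class of u enters: either the weight is locally integrable near K, or u
    vanishes near K ([hardy_rhs_fin]).

    For optimality, [testfun] is |x_k|^(-g) times a cutoff in ln |x_k| at scale N and a cutoff in
    the last coordinates at scale M = N e^N. It is C^1 with compact support off K, so it belongs to
    both classes. Its increment is split into the cutoff times the increment of the ground state,
    and the ground state times the increment of the cutoff; convexity separates the two at the price
    of factors (1-th)^(1-p) and th^(1-p). The first piece integrates exactly to the sharp constant
    times the right-hand side, the second is O(N^(-sg)) times a mass comparable to the right-hand
    side ([testfun_lhs_bound], [supp_mass_le_rhs]). Taking th small and then N large excludes any
    larger constant ([hardy_const_optimal]).

    Throughout, the number of singular coordinates is written k.+1 and the dimension k.+1 + m. *)

(** * Measurability of elementary functions *)

Section real_measurability.
Context d (T : measurableType d) (R : realType).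
Implicit Types (f g : T -> R).

Lemma mfun_powR f a : measurable_fun setT f ->
  measurable_fun setT (fun x => f x `^ a).
Proof. exact: (measurableT_comp (@measurable_powR R a)). Qed.

Lemma mfun_inv f : measurable_fun setT f -> measurable_fun setT (fun x => (f x)^-1).
Proof.
(* A power with exponent -1 is the inverse only on nonnegative bases, hence the detour through f^2;
   where f is 0 both sides are 0. *)
move=> mf; rewrite (_ : (fun x => _) = fun x => f x * (f x * f x) `^ (-1)).
  by apply: measurable_funM => //; apply: mfun_powR; exact: measurable_funM.
apply/funext => x; rewrite -expr2 powR_inv1 ?sqr_ge0//.
have [->|f0] := eqVneq (f x) 0; first by rewrite invr0 mul0r.
by rewrite expr2 invfM mulrA divff// mul1r.
Qed.

Lemma mfun_sqrt f : measurable_fun setT f ->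
  measurable_fun setT (fun x => Num.sqrt (f x)).
Proof.
apply: measurableT_comp; apply: continuous_measurable_fun.
exact: sqrt_continuous.
Qed.

Lemma mfun_norm f : measurable_fun setT f -> measurable_fun setT (fun x => `|f x|).
Proof. exact: measurableT_comp. Qed.

Lemma mfun_ln f : measurable_fun setT f -> measurable_fun setT (fun x => ln (f x)).
Proof. exact: (measurableT_comp (@measurable_ln R)). Qed.

Lemma mfun_expR f : measurable_fun setT f -> measurable_fun setT (fun x => expR (f x)).
Proof. exact: (measurableT_comp (@measurable_expR R)). Qed.

Lemma mfun_sum (I : Type) (s : seq I) (P : pred I) (F : I -> T -> R) :
  (forall i, measurable_fun setT (F i)) ->
  measurable_fun setT (fun x => \sum_(i <- s | P i) F i x).
Proof.
move=> mF; elim: s => [|i s IH].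
  by under eq_fun do rewrite big_nil; exact: measurable_cst.
under eq_fun do rewrite big_cons; case: (P i) => //.
exact: measurable_funD.
Qed.

Lemma mfun_if (b : T -> bool) f g : measurable_fun setT b ->
  measurable_fun setT f -> measurable_fun setT g ->
  measurable_fun setT (fun x => if b x then f x else g x).
Proof. by move=> mb mf mg; exact: measurable_fun_ifT. Qed.

Lemma mfun_EFin f : measurable_fun setT f -> measurable_fun setT (fun x => (f x)%:E).
Proof. by move=> mf; exact/measurable_EFinP. Qed.

Lemma mfun_natb (b : T -> bool) : measurable_fun setT b ->
  measurable_fun setT (fun x => (b x)%:R : R).
Proof.
move=> mb; rewrite (_ : (fun x => _) = fun x => if b x then 1 else 0).
  by apply: mfun_if.
by apply/funext => x; case: (b x).
Qed.

End real_measurability.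

Lemma mfun_coord d (T : measurableType d) (R : realType) n (f : T -> 'rV[R]_n) i j :
  measurable_fun setT f -> measurable_fun setT (fun x => f x i j).
Proof.
move=> mf; rewrite ord1; exact: (measurableT_comp (@measurable_coord R n j)).
Qed.

(** One step of a syntax-directed measurability proof; [mf] iterates it and leaves the goals that it
    cannot decompose. *)
Ltac mf1 :=
  first [ assumption
  | exact: measurable_id | exact: measurable_fst | exact: measurable_snd
  | exact: measurable_cst
  | apply: mfun_EFin
  | apply: mfun_powR | apply: mfun_sqrt | apply: mfun_norm | apply: mfun_inv
  | apply: mfun_ln | apply: mfun_expR | apply: mfun_natb
  | apply: measurable_funX | apply: measurable_funN
  | apply: measurable_funD | apply: measurable_funM
  | apply: emeasurable_funM
  | apply: measurable_minr | apply: measurable_maxr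
  | apply: measurable_and | apply: measurable_or
  | apply: measurable_fun_ltr | apply: measurable_fun_ler | apply: measurable_fun_eqr
  | apply: measurable_neg
  | apply: mfun_coord
  | apply: mfun_sum => ?
  | apply: mfun_if
  | apply/measurable_fun_pairP; split => /=
  | apply: measurable_fun_rV => ? /=; under eq_fun do rewrite !mxE ].
Ltac mf := repeat mf1.

(* [lebesgue_measure] lives on [measurableTypeR R], whose display differs from
   the one canonically inferred for [R]; [lebR] is its copy on [R]. *)
Definition lebR (R : realType) : set R -> \bar R :=
  pushforward (@lebesgue_measure R) (fun x : measurableTypeR R => x : R).

Section lebR_measure.
Context (R : realType).
Local Open Scope ereal_scope.

Let mid : @measurable_fun _ _ (measurableTypeR R) R setT (fun x => x).
Proof. by move=> _ A mA; rewrite setTI. Qed.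

HB.instance Definition _ := Measure.copy (@lebR R)
  (measure_function_pushforward__canonical__measure_function_Measure
     (@lebesgue_measure R) mid).

Let lebR_sigma_finite : sigma_finite setT (@lebR R).
Proof. exact: (sigma_finiteT (@lebesgue_measure R)). Qed.

HB.instance Definition _ := @Measure_isSigmaFinite.Build _ _ _ (@lebR R)
  lebR_sigma_finite.

Lemma lebRE (D : set R) (f : R -> \bar R) : measurable D ->
  measurable_fun D f -> (forall x, D x -> 0 <= f x) ->
  \int[@lebesgue_measure R]_(x in D) f x = \int[@lebR R]_(x in D) f x.
Proof.
move=> mD mf f0; rewrite (ge0_integral_pushforward mid)//.
by move=> x /set_mem; exact: f0.
Qed.

Lemma lebR_itv (i : interval R) : lebR [set` i] = @lebesgue_measure R [set` i].
Proof. by []. Qed.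

End lebR_measure.

(** * Iterated integrals over R^n *)

Section rV_integration.
Context (R : realType).
Local Open Scope ereal_scope.
Notation leb := (@lebR R).
Notation L := (lebesgue_rV R).

Lemma mfun_rV_cons d (T : measurableType d) n (f : T -> R) (g : T -> 'rV[R]_n) :
  measurable_fun setT f -> measurable_fun setT g ->
  measurable_fun setT (fun x => rV_cons (f x, g x)).
Proof.
move=> mf mg; apply: (measurableT_comp (@measurable_rV_cons R n)).
exact/measurable_fun_pairP.
Qed.

Lemma integral_rV0 (f : 'rV[R]_0 -> \bar R) : (forall x, 0 <= f x) ->
  \int[L 0]_x f x = f 0%R.
Proof.
move=> f0; rewrite (_ : f = cst (f 0%R)); last first.
  by apply/funext => x /=; congr f; apply/rowP => -[].
rewrite integral_cst//= diracE mem_set// mule1//.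
Qed.

(** [lebesgue_rV n.+1] is by construction the image of a product measure under [rV_cons], so this is
    Tonelli after a change of variable. *)
Lemma integral_rVS n (f : 'rV[R]_n.+1 -> \bar R) :
  measurable_fun setT f -> (forall x, 0 <= f x) ->
  \int[L n.+1]_x f x = \int[leb]_t \int[L n]_v f (rV_cons (t, v)).
Proof.
move=> mf f0.
have mc : @measurable_fun _ _ (measurableTypeR R * 'rV[R]_n)%type _ setT (@rV_cons R n).
  exact: measurable_rV_cons.
transitivity (\int[pushforward (@lebesgue_measure R \x L n)%E (@rV_cons R n)]_x f x) => //.
rewrite (ge0_integral_pushforward mc)//= preimage_setT fubini_tonelli1//; last first.
  exact: (measurableT_comp mf mc).
rewrite lebRE//; last first.
  by move=> x _; apply: integral_ge0.
apply: (@measurable_fun_fubini_tonelli_F _ _ R _ R (L n) (fun p => f (rV_cons p))) => //.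
exact: (measurableT_comp mf (@measurable_rV_cons R n)).
Qed.

Opaque lebesgue_rV lebR.

Lemma integral_rVS' n (f : 'rV[R]_n.+1 -> \bar R) :
  measurable_fun setT f -> (forall x, 0 <= f x) ->
  \int[L n.+1]_x f x = \int[L n]_v \int[leb]_t f (rV_cons (t, v)).
Proof.
move=> mf f0; rewrite integral_rVS//.
apply: (@fubini_tonelli _ _ _ _ R leb (L n) (fun p => f (rV_cons p))) => //.
exact: (measurableT_comp mf (@measurable_rV_cons R n)).
Qed.

Lemma tonelli d1 d2 (T1 : measurableType d1) (T2 : measurableType d2)
    (m1 : {sigma_finite_measure set T1 -> \bar R})
    (m2 : {sigma_finite_measure set T2 -> \bar R}) (f : T1 -> T2 -> \bar R) :
  measurable_fun setT (fun p => f p.1 p.2) -> (forall x y, 0 <= f x y) ->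
  \int[m1]_x \int[m2]_y f x y = \int[m2]_y \int[m1]_x f x y.
Proof. by move=> mf f0; exact: (@fubini_tonelli _ _ _ _ R m1 m2 (fun p => f p.1 p.2)). Qed.

Lemma mfun_int d1 d2 (T1 : measurableType d1) (T2 : measurableType d2)
    (m2 : {sigma_finite_measure set T2 -> \bar R}) (f : T1 -> T2 -> \bar R) :
  measurable_fun setT (fun p => f p.1 p.2) -> (forall x y, 0 <= f x y) ->
  measurable_fun setT (fun x => \int[m2]_y f x y).
Proof. by move=> mf f0; exact: (@measurable_fun_fubini_tonelli_F _ _ _ _ R m2 (fun p => f p.1 p.2)). Qed.

Lemma mfun_pair1 d1 d2 d3 (T1 : measurableType d1) (T2 : measurableType d2)
   (T3 : measurableType d3) (f : T1 * T2 -> T3) x :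
  measurable_fun setT f -> measurable_fun setT (fun y => f (x, y)).
Proof. exact: measurable_fun_pair2. Qed.

Lemma mfun_pair2 d1 d2 d3 (T1 : measurableType d1) (T2 : measurableType d2)
   (T3 : measurableType d3) (f : T1 * T2 -> T3) y :
  measurable_fun setT f -> measurable_fun setT (fun x => f (x, y)).
Proof. exact: measurable_fun_pair1. Qed.

End rV_integration.

(** * Measures with density and their images *)

Section density.
Context d (T : measurableType d) (R : realType) (mu : {measure set T -> \bar R}).
Variable g : T -> R.
Local Open Scope ereal_scope.

(** The proofs of measurability and positivity are arguments so that the term [dens mg g0] by itself
    determines its measure structure. *)
Definition dens (_ : measurable_fun setT g) (_ : forall x, (0 <= g x)%R)
  (A : set T) : \bar R := \int[mu]_(x in A) (g x)%:E.

Variables (mg : measurable_fun setT g) (g0 : forall x, (0 <= g x)%R).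
Local Notation nu := (dens mg g0).

Let dens0 : nu set0 = 0. Proof. exact: integral_set0. Qed.

Let dens_ge0 A : 0 <= nu A.
Proof. by apply: integral_ge0 => x _; rewrite lee_fin. Qed.

Let dens_sigma_additive : semi_sigma_additive nu.
Proof.
move=> F mF tF mUF; rewrite /dens ge0_integral_bigcup//.
- apply: is_cvg_ereal_nneg_natsum => k _; exact: dens_ge0.
- by apply/measurable_funTS/measurable_EFinP.
- by move=> x _; rewrite lee_fin.
Qed.

HB.instance Definition _ := isMeasure.Build _ _ _ nu
  dens0 dens_ge0 dens_sigma_additive.

Let integral_dens_indic E : measurable E ->
  \int[nu]_x (\1_E x)%:E = \int[mu]_x (\1_E x * g x)%:E.
Proof.
move=> mE; rewrite integral_indic// setIT.
rewrite [LHS](integral_mkcond E (fun x => (g x)%:E)).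
apply: eq_integral => x _; rewrite patchE indicE.
by case: ifPn => _; rewrite ?mul1r ?mul0r.
Qed.

Import HBNNSimple.

Let integral_dens_nnsfun (h : {nnsfun T >-> R}) :
  \int[nu]_x (h x)%:E = \int[mu]_x (h x * g x)%:E.
Proof.
under [LHS]eq_integral do rewrite fimfunE -fsumEFin//.
rewrite [LHS]ge0_integral_fsum//; last 2 first.
  - by move=> r; exact/measurable_EFinP/measurableT_comp.
  - by move=> n x _; rewrite EFinM nnfun_muleindic_ge0.
under [RHS]eq_integral.
  move=> x xD; rewrite fimfunE EFinM -fsumEFin// ge0_mule_fsuml; last first.
    by move=> r; rewrite EFinM nnfun_muleindic_ge0.
  over.
rewrite [RHS]ge0_integral_fsum//; last 2 first.
  - move=> r; rewrite /=; under eq_fun do rewrite -EFinM.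
    by apply/measurable_EFinP; do 2 apply/measurable_funM => //.
  - move=> n x _; rewrite mule_ge0//; last by rewrite lee_fin.
    by rewrite EFinM nnfun_muleindic_ge0.
apply: eq_fsbigr => r /set_mem[t _ <-].
under eq_integral do rewrite EFinM.
under [RHS]eq_integral do rewrite -EFinM -mulrA EFinM.
rewrite !ge0_integralZl// ?lee_fin//.
- by rewrite integral_dens_indic//.
- by apply/measurable_EFinP/measurable_funM.
- by move=> x _; rewrite lee_fin mulr_ge0.
- exact/measurable_EFinP.
Qed.

(** True for indicators, hence for simple functions by linearity, hence for nonnegative measurable
    functions by monotone convergence. *)
Lemma integral_dens (f : T -> \bar R) : measurable_fun setT f ->
  (forall x, 0 <= f x) -> \int[nu]_x f x = \int[mu]_x (f x * (g x)%:E).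
Proof.
move=> mf f0; pose f_ := nnsfun_approx measurableT mf.
have fcvg x : (f_ n x)%:E @[n --> \oo] --> f x by apply: cvg_nnsfun_approx.
transitivity (limn (fun n => \int[nu]_x (f_ n x)%:E)).
  rewrite -monotone_convergence//=.
  - by apply: eq_integral => x _; apply/esym/cvg_lim.
  - by move=> n; exact/measurable_EFinP.
  - by move=> n x _; rewrite lee_fin.
  - by move=> x _ a b ab; rewrite lee_fin//; exact/lefP/nd_nnsfun_approx.
transitivity (limn (fun n => \int[mu]_x (f_ n x * g x)%:E)).
  by congr (limn _); apply/funext => n /=; rewrite integral_dens_nnsfun.
rewrite -monotone_convergence//=.
- apply: eq_integral => x _; apply/cvg_lim => //.
  under eq_fun do rewrite EFinM.
  by apply: cvgeMr.
- by move=> n; exact/measurable_EFinP/measurable_funM.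
- by move=> n x _; rewrite lee_fin mulr_ge0.
- move=> x _ a b ab; rewrite lee_fin//; apply: ler_wpM2r => //.
  exact/lefP/nd_nnsfun_approx.
Qed.

End density.

Section weighted_push.
Context (R : realType).
Local Open Scope ereal_scope.

(** Half-open intervals form a pi-system that exhausts the line with finite mass, so two image
    measures that agree on them are equal. The one-dimensional substitutions and the radial
    integration formula rest on this. *)
Lemma integral_push_unique d1 d2 (T1 : measurableType d1) (T2 : measurableType d2)
    (m1 : {measure set T1 -> \bar R}) (m2 : {measure set T2 -> \bar R})
    (phi1 : T1 -> R) (phi2 : T2 -> R) (g1 : T1 -> R) (g2 : T2 -> R)
    (f : R -> \bar R) :
  measurable_fun setT phi1 -> measurable_fun setT phi2 ->
  measurable_fun setT g1 -> measurable_fun setT g2 ->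
  (forall x, (0 <= g1 x)%R) -> (forall x, (0 <= g2 x)%R) ->
  (forall a b : R, (a < b)%R -> \int[m1]_(x in phi1 @^-1` `]a, b]) (g1 x)%:E < +oo) ->
  (forall a b : R, (a < b)%R ->
    \int[m1]_(x in phi1 @^-1` `]a, b]) (g1 x)%:E =
    \int[m2]_(x in phi2 @^-1` `]a, b]) (g2 x)%:E) ->
  measurable_fun setT f -> (forall x, 0 <= f x) ->
  \int[m1]_x (f (phi1 x) * (g1 x)%:E) = \int[m2]_x (f (phi2 x) * (g2 x)%:E).
Proof.
move=> mp1 mp2 mg1 mg2 g10 g20 foo e12 mf f0.
have mc1 : @measurable_fun _ _ T1 (measurableTypeR R) setT phi1 by [].
have mc2 : @measurable_fun _ _ T2 (measurableTypeR R) setT phi2 by [].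
pose D1 := dens m1 mg1 g10; pose D2 := dens m2 mg2 g20.
pose P1 : {measure set (measurableTypeR R) -> \bar R} :=
  measure_function_pushforward__canonical__measure_function_Measure D1 mc1.
pose P2 : {measure set (measurableTypeR R) -> \bar R} :=
  measure_function_pushforward__canonical__measure_function_Measure D2 mc2.
rewrite -!integral_dens//; try by apply: (measurableT_comp mf).
transitivity (\int[P1]_x f x).
  by rewrite (ge0_integral_pushforward mc1).
transitivity (\int[P2]_x f x); last first.
  by rewrite (ge0_integral_pushforward mc2).
apply: eq_measure_integral => A mA _.
apply: (@measure_unique _ R (measurableTypeR R) (@ocitv R)
  (fun n => `](- n%:R)%R, n%:R]%classic)) => //.
- exact: (@ocitvI R).
- by move=> n; exact: is_ocitv.
- apply/seteqP; split => // x _; exists (Num.truncn `|x|%R).+1 => //=.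
  have := truncnS_gt `|x|%R; rewrite in_itv/= ltr_norml => /andP[-> /ltW ->] //.
- move=> B /ocitvP[->|[[a b] /= ab ->]]; first by rewrite !measure0.
  exact: e12.
(* For k = 0 the exhausting interval is empty. *)
- move=> k; have [kk|kk] := ltP (- k%:R : R)%R k%:R; first exact: foo.
  by rewrite set_itv_ge ?measure0// bnd_simp -leNgt.
Qed.
End weighted_push.
Transparent lebR.

(** * Translations and dilations *)

Section affine_R.
Context (R : realType).
Local Open Scope ereal_scope.
Notation leb := (@lebR R).

Lemma leb_itvoc (a b : R) : (a < b)%R -> leb `]a, b]%classic = (b - a)%:E.
Proof. by move=> ab; rewrite lebR_itv lebesgue_measure_itv/= lte_fin ab EFinB. Qed.

Lemma int_leb_cst (A : set R) (c : R) : measurable A ->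
  \int[leb]_(x in A) c%:E = c%:E * leb A.
Proof. by move=> mA; rewrite -(integral_cst leb mA). Qed.

(** The form in which changes of variable are checked: the preimage of an interval must have
    weighted mass equal to the length of the interval. *)
Lemma integral_push_leb d (T : measurableType d) (m : {measure set T -> \bar R})
    (phi : T -> R) (g : T -> R) (f : R -> \bar R) :
  measurable_fun setT phi -> measurable_fun setT g -> (forall x, (0 <= g x)%R) ->
  (forall a b : R, (a < b)%R ->
    \int[m]_(x in phi @^-1` `]a, b]) (g x)%:E = (b - a)%:E) ->
  measurable_fun setT f -> (forall x, 0 <= f x) ->
  \int[leb]_x f x = \int[m]_x (f (phi x) * (g x)%:E).
Proof.
move=> mphi mg g0 H mf f0.
rewrite -(@integral_push_unique R _ _ R T leb m id phi (cst 1%R) g)//.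
- by apply: eq_integral => x _; rewrite mule1.
- by move=> a b ab; rewrite preimage_id /= int_leb_cst// mul1e leb_itvoc// ltry.
- by move=> a b ab; rewrite preimage_id /= int_leb_cst// mul1e leb_itvoc// H.
Qed.

Opaque lebR.
Lemma integral_scaleR (c : R) (f : R -> \bar R) : c != 0%R ->
  measurable_fun setT f -> (forall x, 0 <= f x) ->
  \int[leb]_x f (c * x)%R = `|c|^-1%:E * \int[leb]_x f x.
Proof.
move=> c0 mf f0.
rewrite (@integral_push_leb _ R leb (fun x => c * x)%R (cst `|c|%R) f)//.
- rewrite /= ge0_integralZr//; last by apply: (measurableT_comp mf); mf.
  by rewrite muleC -muleA -EFinM divff ?normr_eq0// mule1.
- by mf.
- move=> a b ab.
  rewrite (_ : _ @^-1` _ = [set` if (0 < c)%R then `]a / c, b / c]%R else `[b / c, a / c[%R]).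
    rewrite /= int_leb_cst//.
    case: ltrP => c1; rewrite lebR_itv lebesgue_measure_itv/= lte_fin.
      rewrite ltr_pM2r ?invr_gt0// ab -EFinB -EFinM; congr (_%:E).
      by rewrite gtr0_norm//; field.
    have {}c1 : (c < 0)%R by rewrite lt_neqAle c0.
    rewrite ltr_nM2r ?invr_lt0// ab -EFinB -EFinM; congr (_%:E).
    by rewrite ltr0_norm//; field.
  apply/seteqP; split => x /=; case: ltrP => c1; rewrite !in_itv/=.
  + by rewrite ltr_pdivrMr// ler_pdivlMr// ![(_ * x)%R]mulrC.
  + have {}c1 : (c < 0)%R by rewrite lt_neqAle c0.
    by rewrite ltr_ndivlMr// ler_ndivrMr// ![(_ * x)%R]mulrC andbC.
  + by rewrite ltr_pdivrMr// ler_pdivlMr// ![(_ * x)%R]mulrC.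
  + have {}c1 : (c < 0)%R by rewrite lt_neqAle c0.
    by rewrite ltr_ndivlMr// ler_ndivrMr// ![(_ * x)%R]mulrC andbC.
Qed.

Lemma integral_shiftR (a : R) (f : R -> \bar R) :
  measurable_fun setT f -> (forall x, 0 <= f x) ->
  \int[leb]_x f (x + a)%R = \int[leb]_x f x.
Proof.
move=> mf f0.
rewrite [RHS](@integral_push_leb _ R leb (fun x => x + a)%R (cst 1%R) f)//.
- by apply: eq_integral => x _; rewrite mule1.
- by mf.
- move=> b c bc.
  rewrite (_ : _ @^-1` _ = `](b - a)%R, (c - a)%R]%classic).
    by rewrite /= int_leb_cst// mul1e leb_itvoc ?ltrD2r//; congr (_%:E); ring.
  by apply/seteqP; split => x /=; rewrite !in_itv/= ltrBlDr lerBrDr.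
Qed.

End affine_R.

Section affine_rV.
Context (R : realType).
Local Open Scope ereal_scope.
Notation leb := (@lebR R).
Notation L := (lebesgue_rV R).

Lemma rV_consD n (p q : R * 'rV[R]_n) : (rV_cons p + rV_cons q = rV_cons (p.1 + q.1, p.2 + q.2))%R.
Proof.
apply/rowP => i; rewrite mxE; case: (unliftP ord0 i) => [j ->|->].
  by rewrite !rV_consS mxE.
by rewrite !rV_cons0.
Qed.

Lemma rV_consZ n c (p : R * 'rV[R]_n) : (c *: rV_cons p = rV_cons (c * p.1, c *: p.2))%R.
Proof.
apply/rowP => i; rewrite mxE; case: (unliftP ord0 i) => [j ->|->].
  by rewrite !rV_consS mxE.
by rewrite !rV_cons0.
Qed.

Lemma rV_consE n (v : 'rV[R]_n.+1) :
  v = rV_cons (v ord0 ord0, \row_j v ord0 (lift ord0 j)).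
Proof.
apply/rowP => i; case: (unliftP ord0 i) => [j ->|->].
  by rewrite rV_consS mxE.
by rewrite rV_cons0.
Qed.

Lemma integral_shift_rV n (a : 'rV[R]_n) (f : 'rV[R]_n -> \bar R) :
  measurable_fun setT f -> (forall x, 0 <= f x) ->
  \int[L n]_x f (x + a)%R = \int[L n]_x f x.
Proof.
elim: n a f => [|n IH] a f mf f0.
  by rewrite !integral_rV0//; congr f; apply/rowP => -[].
rewrite (integral_rVS mf f0) (@integral_rVS R n (fun x => f (x + a)%R)); last 2 first.
- by apply: (measurableT_comp mf); mf.
- by move=> x; exact: f0.
rewrite (rV_consE a); set a0 := a _ _; set a' := \row_j _.
have mf' : measurable_fun setT (fun p : R * 'rV[R]_n => f (rV_cons p)).
  exact: (measurableT_comp mf (@measurable_rV_cons R n)).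
rewrite -[RHS](integral_shiftR a0).
- apply: eq_integral => t _; rewrite -[RHS](IH a')//.
  + by apply: eq_integral => v _; rewrite rV_consD.
  + exact: (mfun_pair1 _ mf').
- by apply: (@mfun_int R _ _ _ _ (L n) (fun t v => f (rV_cons (t, v)))) => //.
- by move=> x; apply: integral_ge0.
Qed.

Lemma integral_scale_rV n (c : R) (f : 'rV[R]_n -> \bar R) : c != 0%R ->
  measurable_fun setT f -> (forall x, 0 <= f x) ->
  \int[L n]_x f (c *: x)%R = (`|c| ^- n)%:E * \int[L n]_x f x.
Proof.
move=> c0.
elim: n f => [|n IH] f mf f0.
  by rewrite !integral_rV0// expr0 invr1 mul1e; congr f; apply/rowP => -[].
rewrite (integral_rVS mf f0) (@integral_rVS R n (fun x => f (c *: x)%R)); last 2 first.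
- by apply: (measurableT_comp mf); mf.
- by move=> x; exact: f0.
have mf' : measurable_fun setT (fun p : R * 'rV[R]_n => f (rV_cons p)).
  exact: (measurableT_comp mf (@measurable_rV_cons R n)).
have mi : measurable_fun setT (fun t => \int[L n]_v f (rV_cons (t, v))).
  by apply: (@mfun_int R _ _ _ _ (L n) (fun t v => f (rV_cons (t, v)))).
have i0 t : 0 <= \int[L n]_v f (rV_cons (t, v)) by exact: integral_ge0.
transitivity (\int[leb]_t ((`|c| ^- n)%:E * \int[L n]_v f (rV_cons (c * t, v)%R))).
  apply: eq_integral => t _; rewrite -IH//.
  + by apply: eq_integral => v _; rewrite rV_consZ.
  + exact: (mfun_pair1 _ mf').
rewrite (ge0_integralZl leb measurableT); last 3 first.
- by apply: (measurableT_comp mi); mf.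
- by move=> t _; exact: i0.
- by rewrite lee_fin invr_ge0 exprn_ge0.
by rewrite (integral_scaleR c0 mi)// muleA -EFinM -exprVn -exprSr exprVn.
Qed.

End affine_rV.

(** * Rotations as products of shears *)

Section rotation.
Context (R : realType).
Local Open Scope ereal_scope.
Notation leb := (@lebR R).
Notation L := (lebesgue_rV R).

Definition dotv n (x y : 'rV[R]_n) : R := (\sum_i x ord0 i * y ord0 i)%R.

Lemma dotvC n (x y : 'rV[R]_n) : dotv x y = dotv y x.
Proof. by apply: eq_bigr => i _; rewrite mulrC. Qed.

Lemma dotvD n (x y z : 'rV[R]_n) : dotv x (y + z)%R = (dotv x y + dotv x z)%R.
Proof. by rewrite -big_split; apply: eq_bigr => i _; rewrite mxE mulrDr. Qed.

Lemma dotvZ n c (x y : 'rV[R]_n) : dotv x (c *: y)%R = (c * dotv x y)%R.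
Proof. by rewrite mulr_sumr; apply: eq_bigr => i _; rewrite mxE mulrCA. Qed.

Lemma dotvN n (x y : 'rV[R]_n) : dotv x (- y)%R = (- dotv x y)%R.
Proof. by rewrite -scaleN1r dotvZ mulN1r. Qed.

Lemma dotvv_ge0 n (x : 'rV[R]_n) : (0 <= dotv x x)%R.
Proof. by apply: sumr_ge0 => i _; rewrite -expr2 sqr_ge0. Qed.

Lemma dotv_cons n (p q : R * 'rV[R]_n) :
  dotv (rV_cons p) (rV_cons q) = (p.1 * q.1 + dotv p.2 q.2)%R.
Proof.
rewrite /dotv big_ord_recl !rV_cons0; congr (_ + _)%R.
by apply: eq_bigr => i _; rewrite !rV_consS.
Qed.

Lemma enormE n (x : 'rV[R]_n) : enorm x = Num.sqrt (dotv x x).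
Proof. by congr Num.sqrt; apply: eq_bigr => i _; rewrite expr2. Qed.

Lemma enorm_ge0 n (x : 'rV[R]_n) : (0 <= enorm x)%R.
Proof. exact: sqrtr_ge0. Qed.

Lemma sqr_enorm n (x : 'rV[R]_n) : (enorm x ^+ 2)%R = dotv x x.
Proof. by rewrite enormE sqr_sqrtr// dotvv_ge0. Qed.

Lemma enorm_cons n (p : R * 'rV[R]_n) :
  enorm (rV_cons p) = Num.sqrt (p.1 ^+ 2 + enorm p.2 ^+ 2)%R.
Proof. by rewrite enormE dotv_cons sqr_enorm expr2. Qed.

Lemma enormZ n c (x : 'rV[R]_n) : enorm (c *: x)%R = (`|c| * enorm x)%R.
Proof.
rewrite !enormE dotvZ dotvC dotvZ mulrA -expr2 sqrtrM ?sqr_ge0//.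
by rewrite sqrtr_sqr.
Qed.

Lemma enormN n (x : 'rV[R]_n) : enorm (- x)%R = enorm x.
Proof. by rewrite -scaleN1r enormZ normrN normr1 mul1r. Qed.

Lemma enorm0 n : enorm (0 : 'rV[R]_n)%R = 0%R.
Proof. by rewrite -(scale0r 0%R) enormZ normr0 mul0r. Qed.

Lemma enormB n (x y : 'rV[R]_n) : enorm (x - y)%R = enorm (y - x)%R.
Proof. by rewrite -enormN opprB. Qed.

Lemma dotvBB n (x y : 'rV[R]_n) :
  (dotv (x - y) (x - y) = dotv x x - 2 * dotv x y + dotv y y)%R.
Proof.
rewrite dotvD dotvN ![dotv (x - y)%R _]dotvC !dotvD !dotvN [dotv y x]dotvC; ring.
Qed.

Lemma coord_le_enorm n (x : 'rV[R]_n) i : (`|x ord0 i| <= enorm x)%R.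
Proof.
rewrite -sqrtr_sqr ler_wsqrtr// (bigD1 i)//= lerDl.
by apply: sumr_ge0 => j _; rewrite sqr_ge0.
Qed.

Lemma enorm_eq0 n (x : 'rV[R]_n) : (enorm x == 0)%R = (x == 0)%R.
Proof.
apply/eqP/eqP => [x0|->]; last exact: enorm0.
apply/rowP => i; rewrite mxE; apply/eqP; rewrite -normr_le0 -x0.
exact: coord_le_enorm.
Qed.

Lemma enorm_gt0 n (x : 'rV[R]_n) : (0 < enorm x)%R = (x != 0)%R.
Proof. by rewrite lt_neqAle enorm_ge0 andbT eq_sym enorm_eq0. Qed.

Lemma mfun_enorm d (T : measurableType d) n (f : T -> 'rV[R]_n) :
  measurable_fun setT f -> measurable_fun setT (fun x => enorm (f x)).
Proof. by move=> ?; rewrite /enorm; mf. Qed.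

Lemma integral_shear1 n (l : 'rV[R]_n -> R) (f : 'rV[R]_n.+1 -> \bar R) :
  measurable_fun setT l -> measurable_fun setT f -> (forall x, 0 <= f x) ->
  \int[L n]_v \int[leb]_t f (rV_cons (t + l v, v))%R = \int[L n.+1]_x f x.
Proof.
move=> ml mf f0; rewrite (integral_rVS' mf f0); apply: eq_integral => v _.
apply: (integral_shiftR (l v) (f := fun t => f (rV_cons (t, v)))) => [|t].
  by apply: (measurableT_comp mf); apply: mfun_rV_cons; mf.
exact: f0.
Qed.

Lemma integral_shear2 n (b : 'rV[R]_n) (f : 'rV[R]_n.+1 -> \bar R) :
  measurable_fun setT f -> (forall x, 0 <= f x) ->
  \int[leb]_t \int[L n]_v f (rV_cons (t, v + t *: b))%R = \int[L n.+1]_x f x.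
Proof.
move=> mf f0; rewrite (integral_rVS mf f0); apply: eq_integral => t _.
apply: (integral_shift_rV (t *: b)%R (f := fun v => f (rV_cons (t, v)))) => [|v].
  by apply: (measurableT_comp mf); apply: mfun_rV_cons; mf.
exact: f0.
Qed.

(** The two kinds of shear from which rotations are assembled. Each changes one block of coordinates
    by a function of the other, so Tonelli and translation invariance show that it preserves
    Lebesgue measure. *)
Definition shearA n (k : R) (b : 'rV[R]_n) (x : 'rV[R]_n.+1) : 'rV[R]_n.+1 :=
  let v := (\row_j x ord0 (lift ord0 j))%R in
  rV_cons (x ord0 ord0 - k * dotv b v, v)%R.

Definition shearB n (b : 'rV[R]_n) (x : 'rV[R]_n.+1) : 'rV[R]_n.+1 :=
  let v := (\row_j x ord0 (lift ord0 j))%R in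
  rV_cons (x ord0 ord0, v + x ord0 ord0 *: b)%R.

Lemma rV_tail n (p : R * 'rV[R]_n) :
  (\row_j rV_cons p ord0 (lift ord0 j))%R = p.2.
Proof. by apply/rowP => j; rewrite mxE rV_consS. Qed.

Lemma shearA_cons n k (b : 'rV[R]_n) p :
  shearA k b (rV_cons p) = rV_cons (p.1 - k * dotv b p.2, p.2)%R.
Proof. by rewrite /shearA rV_tail rV_cons0. Qed.

Lemma shearB_cons n (b : 'rV[R]_n) p :
  shearB b (rV_cons p) = rV_cons (p.1, p.2 + p.1 *: b)%R.
Proof. by rewrite /shearB rV_tail rV_cons0. Qed.

Lemma measurable_shearA n k (b : 'rV[R]_n) : measurable_fun setT (shearA k b).
Proof. by apply: mfun_rV_cons; rewrite /dotv; mf. Qed.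

Lemma measurable_shearB n (b : 'rV[R]_n) : measurable_fun setT (shearB b).
Proof. by apply: mfun_rV_cons; mf. Qed.

Lemma integral_shearA n k (b : 'rV[R]_n) (f : 'rV[R]_n.+1 -> \bar R) :
  measurable_fun setT f -> (forall x, 0 <= f x) ->
  \int[L n.+1]_x f (shearA k b x) = \int[L n.+1]_x f x.
Proof.
move=> mf f0.
have ml : measurable_fun setT (fun v => - (k * dotv b v))%R.
  by rewrite /dotv; mf.
rewrite -(integral_shear1 ml mf f0).
rewrite (@integral_rVS' R n (fun x => f (shearA k b x)) _ _); last 2 first.
- exact: (measurableT_comp mf (measurable_shearA _ _)).
- by move=> x; exact: f0.
by apply: eq_integral => v _; apply: eq_integral => t _; rewrite shearA_cons.
Qed.

Lemma integral_shearB n (b : 'rV[R]_n) (f : 'rV[R]_n.+1 -> \bar R) :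
  measurable_fun setT f -> (forall x, 0 <= f x) ->
  \int[L n.+1]_x f (shearB b x) = \int[L n.+1]_x f x.
Proof.
move=> mf f0.
rewrite -(integral_shear2 b mf f0).
rewrite (@integral_rVS R n (fun x => f (shearB b x)) _ _); last 2 first.
- exact: (measurableT_comp mf (measurable_shearB _)).
- by move=> x; exact: f0.
by apply: eq_integral => v _; apply: eq_integral => t _; rewrite shearB_cons.
Qed.

Definition e0 n : 'rV[R]_n.+1 := rV_cons (1, 0)%R.

Lemma dotv0 n (x : 'rV[R]_n) : dotv x 0 = 0%R.
Proof. by rewrite -(scale0r 0%R) dotvZ mul0r. Qed.

(** A plane rotation is a product of three shears with parameters tan(theta/2), sin(theta),
    tan(theta/2). With e = (c, b), c = cos(theta) and |b| = sin(theta), the vector b/(1+c) plays the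
    role of tan(theta/2). The product sends the first basis vector to e; c >= 0 keeps 1 + c away
    from 0. *)
Lemma rotation_ge0 n (e : 'rV[R]_n.+1) : enorm e = 1%R -> (0 <= e ord0 ord0)%R ->
  exists T : 'rV[R]_n.+1 -> 'rV[R]_n.+1,
  [/\ measurable_fun setT T,
      forall f : 'rV[R]_n.+1 -> \bar R, measurable_fun setT f ->
        (forall x, 0 <= f x) -> \int[L n.+1]_x f (T x) = \int[L n.+1]_x f x,
      forall y, enorm (T y) = enorm y &
      forall y, dotv e (T y) = y ord0 ord0].
Proof.
move=> e1; rewrite (rV_consE e); set c := e _ _; set b := \row_j _.
rewrite rV_cons0 => c0.
have b1 : dotv b b = (1 - c ^+ 2)%R.
  have := sqr_enorm e; rewrite e1 expr1n (rV_consE e) dotv_cons /= -/c -/b => ->.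
  by ring.
have c1 : (1 + c != 0)%R by rewrite gt_eqF// ltr_wpDr.
pose k := (1 + c)^-1%R.
exists (fun x => shearA k b (shearB b (shearA k b x))); split.
- apply: (measurableT_comp (measurable_shearA _ _)).
  apply: (measurableT_comp (measurable_shearB _)).
  exact: measurable_shearA.
- move=> f mf f0.
  have mfA : measurable_fun setT (fun x => f (shearA k b x)).
    exact: (measurableT_comp mf (measurable_shearA _ _)).
  have mfAB : measurable_fun setT (fun x => f (shearA k b (shearB b x))).
    exact: (measurableT_comp mfA (measurable_shearB _)).
  rewrite (integral_shearA k b mfAB); last by move=> x; exact: f0.
  rewrite (integral_shearB b mfA); last by move=> x; exact: f0.
  exact: integral_shearA.
- move=> y; rewrite (rV_consE y); set y0 := y _ _; set v := \row_j _.
  rewrite !(shearA_cons, shearB_cons) /= !enormE; congr Num.sqrt.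
  rewrite !dotv_cons/= !dotvD !dotvZ !(dotvC (v + _)%R) !dotvD !dotvZ b1.
  rewrite ![dotv v b]dotvC /k; set B := dotv b v; set V := dotv v v.
  by field.
- move=> y; rewrite (rV_consE y); set y0 := y _ _; set v := \row_j _.
  rewrite !(shearA_cons, shearB_cons) /= dotv_cons/= dotvD dotvZ b1 rV_cons0.
  by rewrite /k /=; set B := dotv b v; field.
Qed.

Lemma rotation n (x : 'rV[R]_n.+1) : x != 0%R ->
  exists T : 'rV[R]_n.+1 -> 'rV[R]_n.+1,
  [/\ measurable_fun setT T,
      forall f : 'rV[R]_n.+1 -> \bar R, measurable_fun setT f ->
        (forall x, 0 <= f x) -> \int[L n.+1]_x f (T x) = \int[L n.+1]_x f x,
      forall y, enorm (T y) = enorm y &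
      forall y, enorm (x - T y)%R = enorm (enorm x *: e0 n - y)%R].
Proof.
(* The sign makes the first coordinate of s x/|x| nonnegative, as [rotation_ge0] asks;
   multiplication by s is again an isometry that preserves the measure. *)
move=> x0; pose s : R := if (0 <= x ord0 ord0)%R then 1%R else (-1)%R.
have s2 : (s * s = 1)%R by rewrite /s; case: ifP => _; rewrite ?mulr1// mulrNN mulr1.
have sn : `|s|%R = 1%R by rewrite /s; case: ifP => _; rewrite ?normrN normr1.
have s0 : s != 0%R by rewrite -normr_eq0 sn oner_eq0.
have nx0 : enorm x != 0%R by rewrite enorm_eq0.
have e1 : enorm ((s / enorm x) *: x)%R = 1%R.
  by rewrite enormZ normrM normfV sn mul1r (ger0_norm (enorm_ge0 _)) mulVf.
have ege0 : (0 <= ((s / enorm x) *: x)%R ord0 ord0)%R.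
  rewrite mxE mulrAC divr_ge0 ?enorm_ge0// /s; case: ifPn; first by rewrite mul1r.
  by rewrite -ltNge mulN1r oppr_ge0 => /ltW.
have [T [mT iT nT dT]] := rotation_ge0 e1 ege0.
exists (fun y => s *: T y)%R; split.
- by mf.
- move=> f mf f0.
  have mfs : measurable_fun setT (fun x : 'rV[R]_n.+1 => f (s *: x)%R).
    by apply: (measurableT_comp mf); mf.
  rewrite (iT _ mfs) => [|z]; last exact: f0.
  rewrite (integral_scale_rV s0 mf f0) sn.
  by rewrite expr1n invr1 mul1e.
- by move=> y; rewrite enormZ sn mul1r.
- move=> y; rewrite [LHS]enormE [RHS]enormE; congr Num.sqrt; rewrite !dotvBB.
  rewrite -!sqr_enorm !enormZ sn mul1r nT.
  have -> : enorm (e0 n) = 1%R.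
    by rewrite /e0 enorm_cons/= enorm0 expr1n expr0n addr0 sqrtr1.
  rewrite mulr1 (ger0_norm (enorm_ge0 _)); congr (_ - 2 * _ + _)%R.
  rewrite dotvZ [RHS]dotvC dotvZ [dotv y _](_ : _ = y ord0 ord0); last first.
    by rewrite (rV_consE y) dotv_cons/= mulr1 dotv0 addr0 rV_cons0.
  rewrite -dT [in RHS]dotvC dotvZ [dotv (T y) x]dotvC.
  by field.
Qed.

End rotation.

(** * Splitting off the last coordinates; measurability of continuous functions *)

Section split_rV.
Context (R : realType).
Local Open Scope ereal_scope.
Notation leb := (@lebR R).
Notation L := (lebesgue_rV R).

Lemma mfun_row_mx d (T : measurableType d) k m (f : T -> 'rV[R]_k) (g : T -> 'rV[R]_m) :
  measurable_fun setT f -> measurable_fun setT g ->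
  measurable_fun setT (fun x => row_mx (f x) (g x)).
Proof.
move=> mf mg; apply: measurable_fun_rV => i /=.
case: (split_ordP i) => j ->.
  by under eq_fun do rewrite row_mxEl; mf.
by under eq_fun do rewrite row_mxEr; mf.
Qed.

Lemma row_mx_cons k m (t : R) (a : 'rV[R]_k) (b : 'rV[R]_m) :
  row_mx (rV_cons (t, a)) b = rV_cons (t, row_mx a b) :> 'rV[R]_(k + m).+1.
Proof.
apply/rowP => i; rewrite mxE; case: (@split_ordP k.+1 m i) => j ->.
  case: (unliftP ord0 j) => [j' ->|->].
    rewrite rV_consS (_ : lshift m (lift ord0 j') = lift ord0 (lshift m j')); last exact: val_inj.
    by rewrite rV_consS row_mxEl.
  rewrite rV_cons0 (_ : lshift m ord0 = ord0); last exact: val_inj.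
  by rewrite rV_cons0.
rewrite (_ : rshift k.+1 j = lift ord0 (rshift k j)); last exact: val_inj.
by rewrite rV_consS row_mxEr.
Qed.

Lemma integral_rV_split k m (f : 'rV[R]_(k + m) -> \bar R) :
  measurable_fun setT f -> (forall x, 0 <= f x) ->
  \int[L (k + m)]_x f x = \int[L k]_a \int[L m]_b f (row_mx a b).
Proof.
elim: k f => [|k IH] f mf f0.
  rewrite integral_rV0; last by move=> x; exact: integral_ge0.
  apply: eq_integral => b _; congr f; apply/rowP => i.
  by rewrite [in RHS](_ : i = rshift 0 i) ?row_mxEr//; exact: val_inj.
rewrite (@integral_rVS R (k + m) f mf f0).
have mfr : measurable_fun setT (fun p : ('rV[R]_k.+1 * 'rV[R]_m) => f (row_mx p.1 p.2)).
  by apply: (measurableT_comp mf); exact: mfun_row_mx.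
rewrite (@integral_rVS R k (fun a => \int[L m]_b f (row_mx a b))); last 2 first.
- by apply: (@mfun_int R _ _ _ _ (L m) (fun a b => f (row_mx a b))).
- by move=> x; exact: integral_ge0.
apply: eq_integral => t _.
rewrite (IH (fun v => f (rV_cons (t, v)))); last 2 first.
- by apply: (measurableT_comp mf); apply: mfun_rV_cons.
- by move=> x; exact: f0.
apply: eq_integral => a _; apply: eq_integral => b _.
by rewrite row_mx_cons.
Qed.

(* Rounding every coordinate down to a multiple of 1/n has countable range, and
   a continuous function is the pointwise limit of its composites with it. *)
Lemma continuous_mfun_rV n (f : 'rV[R]_n -> R) :
  continuous f -> measurable_fun setT f.
Proof.
move=> cf.
pose D (N : nat) (x : 'rV[R]_n) : 'rV[int]_n := (\row_i Num.floor (N.+1%:R * x ord0 i))%R.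
pose E (N : nat) (z : 'rV[int]_n) : 'rV[R]_n := (\row_i ((z ord0 i)%:~R / N.+1%:R))%R.
apply: (@measurable_fun_cvg _ _ R setT (fun N x => f (E N (D N x)))).
  move=> N _ Y mY; rewrite setTI.
  rewrite (_ : _ @^-1` _ = \bigcup_(z in [set z | Y (f (E N z))])
     (\bigcap_(i in [set: 'I_n]) [set x : 'rV[R]_n | Num.floor (N.+1%:R * x ord0 i) = z ord0 i]%R)); last first.
    apply/seteqP; split => x /=.
      by move=> Yx; exists (D N x) => //= i _; rewrite /D mxE.
    move=> [z Yz xz]; rewrite (_ : D N x = z)//.
    by apply/rowP => i; rewrite mxE; exact: xz.
  rewrite bigcup_mkcond; apply: countable_bigcupT_measurable.
    exact: countableP.
  move=> z; case: ifPn => // _; apply: fin_bigcap_measurable => // i _.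
  rewrite (_ : [set _ | _] = (fun x : 'rV[R]_n => N.+1%:R * x ord0 i)%R @^-1`
     `[(z ord0 i)%:~R, (z ord0 i + 1)%:~R[%classic); last first.
    by apply/seteqP; split => x /=; rewrite in_itv/= -floor_eq => /eqP.
  rewrite -[X in measurable X]setTI.
  have mm : measurable_fun setT (fun x : 'rV[R]_n => N.+1%:R * x ord0 i)%R by mf.
  exact: mm.
move=> x _.
apply: (cvg_comp (fun N => E N (D N x)) f); last exact: cf.
apply/cvg_ballP => e e0; near=> N.
split=> // i j; rewrite /E /D ord1 /ball/= !mxE.
have /andP[fl fu] := floor_itv (N.+1%:R * x ord0 j)%R.
set z := Num.floor _ in fl fu *.
have N0 : (0 < N.+1%:R :> R)%R by [].
have zl : (z%:~R / N.+1%:R <= x ord0 j)%R by rewrite ler_pdivrMr// mulrC.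
rewrite ger0_norm ?subr_ge0//.
rewrite ltrBlDr -(ltr_pM2l N0) mulrDr mulrCA divff ?gt_eqF// mulr1.
apply: (lt_le_trans fu); rewrite intrD addrC lerD2r.
rewrite -ler_pdivrMr// mul1r ltW// invf_plt ?posrE//.
near: N; exact: near_infty_natSinv_lt (PosNum e0).
Unshelve. all: by end_near. Qed.
End split_rV.

(** * One-dimensional substitutions *)

Section substitution.
Context (R : realType).
Notation leb := (@lebR R).

Lemma FTC_leb (F f : R -> R) (a b : R) : a <= b ->
  {in `[a, b]%R, forall x : R, is_derive x 1 F (f x)} ->
  {in `[a, b]%R, forall x : R, {for x, continuous f}} ->
  (forall x, a <= x <= b -> 0 <= f x) -> measurable_fun setT f ->
  (\int[leb]_(x in `]a, b]) (f x)%:E = (F b - F a)%:E)%E.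
Proof.
rewrite le_eqVlt => /predU1P[<- _ _ _ _|ab dF cf f0 mf].
  by rewrite set_itvoc0 integral_set0 subrr.
rewrite -lebRE//; last 2 first.
- by apply/measurable_funTS/mfun_EFin.
- move=> x; rewrite /= in_itv/= lee_fin => /andP[/ltW ax xb].
  by apply: f0; rewrite ax.
have dFx x : x \in `[a, b] -> derivable F x 1 by move=> /dF [].
rewrite integral_itv_obnd_cbnd; last by apply/measurable_funTS/mfun_EFin.
rewrite (continuous_FTC2 ab (F := F))//.
- by apply: continuous_in_subspaceT => x /set_mem; exact: cf.
- split.
  + move=> x xab; apply: dFx; exact: subset_itv_oo_cc.
  + apply: cvg_at_right_filter; apply: differentiable_continuous.
    by apply/derivable1_diffP/dFx; rewrite in_itv/= lexx ltW.
  + apply: cvg_at_left_filter; apply: differentiable_continuous.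
    by apply/derivable1_diffP/dFx; rewrite in_itv/= lexx ltW.
- move=> x xab; rewrite derive1E; have /dF := subset_itv_oo_cc xab.
  by move=> [].
Qed.

(** By the mean value theorem [phi] increases on I, and [psi] is its inverse; so the preimage of ]a,
    b] in I is ]psi a, psi b], whose mass for the density g is b - a by the fundamental theorem of
    calculus. *)
Lemma integral_subst (I : interval R) (phi psi g : R -> R) (f : R -> \bar R) :
  measurable_fun setT phi -> measurable_fun setT g ->
  {in I, forall x : R, 0 < g x} -> {in I, forall x : R, is_derive x 1 phi (g x)} ->
  {in I, forall x : R, {for x, continuous g}} ->
  (forall y, psi y \in I) -> cancel psi phi ->
  measurable_fun setT f -> (forall x, 0 <= f x)%E ->
  (\int[leb]_x f x = \int[leb]_(x in [set` I]) (f (phi x) * (g x)%:E))%E.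
Proof.
move=> mphi mg g0 dphi cg psiI psiK mf f0.
have Icv x y z : x \in I -> y \in I -> x <= z <= y -> z \in I.
  by move=> xI yI xzy; have := @interval_is_interval _ I x y; apply.
have inc : {in I &, {homo phi : x y / x < y}}.
  move=> x y xI yI xy.
  have [z zxy e] : exists2 z, z \in `]x, y[%R & phi y - phi x = g z * (y - x).
    apply: MVT => //.
    - move=> z; rewrite in_itv/= => /andP[/ltW xz /ltW zy].
      by apply: dphi; apply: (Icv x y) => //; rewrite xz.
    - apply: derivable_within_continuous => z; rewrite in_itv/= => xzy.
      by have [] := dphi _ (Icv _ _ _ xI yI xzy).
  rewrite -subr_gt0 e mulr_gt0 ?subr_gt0// g0//.
  move: zxy; rewrite in_itv/= => /andP[/ltW xz /ltW zy].
  by apply: (Icv x y) => //; rewrite xz.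
pose chi (x : R) : R := g x * \1_[set` I] x.
have chi0 x : 0 <= chi x.
  rewrite /chi indicE; have [/set_mem/= /g0/ltW gx|_] := boolP (_ \in _).
    by rewrite mulr1.
  by rewrite mulr0.
have mchi : measurable_fun setT chi.
  by apply: measurable_funM => //; exact: measurable_indic.
rewrite (@integral_push_leb _ _ R leb phi chi f)//.
- rewrite [RHS]integral_mkcond; apply: eq_integral => x _.
  rewrite patchE /chi indicE; case: ifPn => _; rewrite ?mulr1//.
  by rewrite mulr0 mule0.
- move=> a b ab.
  have pab : psi a < psi b.
    rewrite ltNge; apply/negP; rewrite le_eqVlt => /predU1P[e|].
      by move: ab; rewrite -(psiK a) -(psiK b) e ltxx.
    by move=> /(inc _ _ (psiI _) (psiI _)); rewrite !psiK ltNge (ltW ab).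
  have sub z : z \in `[psi a, psi b] -> z \in I.
    by rewrite in_itv/=; apply: Icv.
  transitivity (\int[leb]_(x in `]psi a, psi b]) (g x)%:E)%E.
    rewrite [LHS]integral_mkcond [RHS]integral_mkcond; apply: eq_integral => x _.
    rewrite !patchE /chi indicE.
    have [xI|xI] := boolP (x \in [set` I]); last first.
      rewrite mulr0 if_same; case: ifPn => // /set_mem /= /subset_itv_oc_cc /sub xI'.
      by rewrite mem_setE xI' in xI.
    rewrite mulr1; have {}xI : x \in I by move/set_mem : xI.
    congr (if _ then _ else _); apply/idP/idP => /set_mem/=; rewrite !in_itv/= => /andP[h1 h2];
      apply/mem_set => /=; rewrite in_itv/=.
    + apply/andP; split.
        rewrite ltNge; apply/negP; rewrite le_eqVlt => /predU1P[e|].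
          by move: h1; rewrite e psiK ltxx.
        by move=> /(inc _ _ xI (psiI _)); rewrite psiK ltNge (ltW h1).
      rewrite leNgt; apply/negP.
      by move=> /(inc _ _ (psiI _) xI); rewrite psiK ltNge h2.
    + apply/andP; split.
        by rewrite -(psiK a); apply: inc.
      move: h2; rewrite le_eqVlt => /predU1P[->|]; first by rewrite psiK.
      by move=> /(inc _ _ xI (psiI _)); rewrite psiK => /ltW.
  rewrite (@FTC_leb phi)//; first by rewrite !psiK.
  + exact: ltW.
  + by move=> x xab; apply: dphi; exact: sub.
  + by move=> x xab; apply: cg; exact: sub.
  + by move=> x xab; apply/ltW/g0/sub; rewrite in_itv.
Qed.

Lemma integral_ln (f : R -> \bar R) :
  measurable_fun setT f -> (forall x, 0 <= f x)%E ->
  (\int[leb]_x f x = \int[leb]_(x in `]0%R, +oo[) (f (ln x) * (x^-1)%:E))%E.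
Proof.
move=> mf f0; apply: (@integral_subst _ _ expR) => //.
- by apply: (@mfun_inv _ _ R id); mf.
- by move=> x; rewrite in_itv/= andbT invr_gt0.
- by move=> x; rewrite in_itv/= andbT => x0; exact: is_derive1_ln.
- move=> x; rewrite in_itv/= andbT => x0; apply: inv_continuous.
  by rewrite gt_eqF.
- by move=> y; rewrite in_itv/= expR_gt0.
- exact: expRK.
Qed.

Lemma integral_exp (f : R -> \bar R) :
  measurable_fun setT f -> (forall x, 0 <= f x)%E ->
  (\int[leb]_(x in `]0%R, +oo[) f x = \int[leb]_x (f (expR x) * (expR x)%:E))%E.
Proof.
move=> mf f0; rewrite integral_ln; last 2 first.
- apply: emeasurable_funM; last by mf.
  by apply: (measurableT_comp mf); mf.
- by move=> x; rewrite mule_ge0// lee_fin expR_ge0.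
apply: eq_integral => x /set_mem/=; rewrite in_itv/= andbT => x0.
by rewrite lnK ?posrE// -muleA -EFinM divff ?gt_eqF// mule1.
Qed.

(** In the variable ln x the inversion is the reflection t -> -t. *)
Lemma integral_inversion (f : R -> \bar R) :
  measurable_fun setT f -> (forall x, 0 <= f x)%E ->
  (\int[leb]_(x in `]1%R, +oo[) f x =
   \int[leb]_(x in `]0%R, 1%R[) (f (x^-1)%R * (x `^ (- 2)%R)%:E))%E.
Proof.
move=> mf f0.
pose g x : \bar R := (f x * (((1 < x)%R)%:R)%:E)%E.
have mg : measurable_fun setT g by rewrite /g; mf.
have g0 x : (0 <= g x)%E by rewrite mule_ge0// lee_fin ler0n.
transitivity (\int[leb]_(x in `]0%R, +oo[) g x)%E.
  rewrite [LHS]integral_mkcond [RHS]integral_mkcond; apply: eq_integral => x _.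
  rewrite !patchE !mem_setE !in_itv/= !andbT /g.
  case: ifPn => x1; last by rewrite mule0 if_same.
  by rewrite (lt_trans _ x1) ?mule1.
rewrite integral_exp//.
pose h x := (g (expR x) * (expR x)%:E)%E.
have mh : measurable_fun setT h.
  apply: emeasurable_funM; last by mf.
  by apply: (measurableT_comp mg); mf.
have h0 x : (0 <= h x)%E by rewrite mule_ge0// lee_fin expR_ge0.
have := @integral_scaleR R (-1) h; rewrite normrN normr1 invr1 mul1e.
have -> : (\int[leb]_x (g (expR x) * (expR x)%:E) = \int[leb]_x h x)%E by [].
have N10 : (-1 : R) != 0 by rewrite oppr_eq0 oner_neq0.
move=> /(_ N10 mh h0) <-.
rewrite integral_ln//; last by apply: (measurableT_comp mh); mf.
rewrite [LHS]integral_mkcond [RHS]integral_mkcond; apply: eq_integral => x _.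
rewrite !patchE !mem_setE !in_itv/= !andbT.
case: ifPn => x0 //=; rewrite /h/g mulN1r expRN lnK ?posrE// invf_gt1//.
case: ifPn => x1; rewrite ?mule0 ?mul0e//.
rewrite mule1 -muleA -EFinM powRN powR_mulrn ?ltW//; congr (_ * _%:E)%E.
by rewrite expr2 invfM.
Qed.

(** The substitution s = t / sqrt(1 - t^2), that is s = tan(theta) for t = sin(theta). It turns the
    ratio of one Cartesian coordinate to the norm of the others into the cosine of the polar
    angle. *)
Lemma integral_sinh (f : R -> \bar R) :
  measurable_fun setT f -> (forall x, 0 <= f x)%E ->
  (\int[leb]_x f x = \int[leb]_(t in `](-1)%R, 1%R[)
     (f (t * (1 - t ^+ 2) `^ (- 2^-1))%R * ((1 - t ^+ 2) `^ (- (3 / 2)))%R%:E))%E.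
Proof.
move=> mf f0.
have p1 (t : R) : t \in `](-1)%R, 1%R[%R -> 0 < 1 - t ^+ 2.
  by rewrite in_itv/= => /andP[t1 t2]; nra.
have A0 (y : R) : 0 < 1 + y ^+ 2 by rewrite ltr_pwDl// sqr_ge0.
have tE (y : R) : 0 < 1 - (y * (1 + y ^+ 2) `^ (- 2^-1)) ^+ 2 /\
    1 - (y * (1 + y ^+ 2) `^ (- 2^-1)) ^+ 2 = (1 + y ^+ 2) `^ (-1).
  have -> : 1 - (y * (1 + y ^+ 2) `^ (- 2^-1)) ^+ 2 = (1 + y ^+ 2) `^ (-1).
    rewrite exprMn -[(_ `^ _) ^+ 2]powR_mulrn ?powR_ge0// -powRrM mulNr mulVf ?pnatr_eq0//.
    by rewrite powR_inv1 ?ltW//; field; rewrite gt_eqF.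
  by split=> //; rewrite powR_gt0.
apply: (@integral_subst _ _ (fun s => s * (1 + s ^+ 2) `^ (- 2^-1))) => //.
- by mf.
- by mf.
- by move=> t /p1 t1; rewrite powR_gt0.
- move=> t /p1 t1.
  have h1 : is_derive t 1 (fun t : R => 1 - t ^+ 2) (- (2 * t)).
    have h := is_deriveB (is_derive_cst (1 : R) t (1 : R)) (is_deriveX 2 (is_derive_id t (1 : R))).
    by apply: (is_derive_eq h); rewrite sub0r /GRing.scale/= mulr1 expr1.
  have h2 := @is_derive1_powR _ (- 2^-1) _ t1.
  have h3 : is_derive t 1 ((fun x => x `^ (- 2^-1)) \o (fun t : R => 1 - t ^+ 2))
     ((- 2^-1 * (1 - t ^+ 2) `^ (- 2^-1 - 1)) * (- (2 * t))).
    exact: (@is_derive1_comp _ (fun x => x `^ (- 2^-1)) (fun t : R => 1 - t ^+ 2) t _ _ h2 h1).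
  have h4 := @is_deriveM _ _ id _ t 1 _ _ (is_derive_id t 1) h3.
  apply: (is_derive_eq h4).
  rewrite /GRing.scale/= mulr1.
  rewrite (_ : (- 2^-1 : R) = - (3/2) + 1) ; last by lra.
  rewrite addrK powRD; last by rewrite (gt_eqF t1) implybT.
  by rewrite powRr1 ?ltW//; field.
- move=> t /p1 t1.
  apply: (@continuous_comp _ _ _ (fun t : R => 1 - t ^+ 2) (fun x => x `^ (- (3/2)))).
    by apply: differentiable_continuous; apply/derivable1_diffP.
  apply: differentiable_continuous; apply/derivable1_diffP.
  by apply: derivable_powR; rewrite in_itv/= t1.
- by move=> y; have := tE y; rewrite in_itv/=; set t := y * _ => ?; apply/andP; split; nra.
- move=> y /=; rewrite (tE y).2 -mulrA -powRrM.
  rewrite -powRD; last by rewrite (gt_eqF (A0 _)) implybT.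
  by rewrite (_ : - 2^-1 + -1 * - 2^-1 = 0 :> R) ?powRr0 ?mulr1//; lra.
Qed.
End substitution.

Lemma integral_gt0 d (T : measurableType d) (R : realType)
    (mu : {measure set T -> \bar R}) (D : set T) (f : T -> \bar R) :
  measurable D -> measurable_fun D f -> (forall x, D x -> (0 < f x)%E) ->
  (0 < mu D)%E -> (0 < \int[mu]_(x in D) f x)%E.
Proof.
move=> mD mf f0 D0.
have fge0 x : D x -> (0 <= f x)%E by move=> /f0/ltW.
rewrite lt_neqAle integral_ge0 ?andbT//.
apply/eqP => I0; move: D0; suff -> : mu D = 0%E by rewrite ltxx.
have : (\int[mu]_(x in D) `|f x| = 0)%E.
  rewrite I0; apply: eq_integral => x /set_mem Dx.
  by rewrite gee0_abs// fge0.
move/(ae_eq_integral_abs mu mD mf) => [N [mN N0 sN]].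
apply/eqP; rewrite -measure_le0 -N0; apply: le_measure; rewrite ?inE//.
move=> x Dx; apply: sN => /= /(_ Dx) fx0.
by move: (f0 x Dx); rewrite fx0 ltxx.
Qed.

Lemma integralZ d (T : measurableType d) (R : realType)
    (mu : {measure set T -> \bar R}) (k : R) (f : T -> R) :
  measurable_fun setT f -> (forall x, 0 <= f x) -> 0 <= k ->
  (\int[mu]_x (k * f x)%:E = k%:E * \int[mu]_x (f x)%:E)%E.
Proof.
move=> mf f0 k0; under eq_integral do rewrite EFinM.
apply: ge0_integralZl => //; first exact/measurable_EFinP.
by move=> x _; rewrite lee_fin.
Qed.

(** * Gamma and beta integrals *)

Section gamma_beta.
Context (R : realType).
Notation leb := (@lebR R).
Notation L := (lebesgue_rV R).

Lemma mkindic (D : set R) (f : R -> \bar R) :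
  (\int[leb]_(x in D) f x = \int[leb]_x (f x * (\1_D x)%:E))%E.
Proof.
rewrite integral_mkcond; apply: eq_integral => x _.
by rewrite patchE indicE; case: ifPn => _; rewrite ?mule1 ?mule0.
Qed.

Lemma integral_scale_pos (c : R) (f : R -> \bar R) : 0 < c ->
  measurable_fun setT f -> (forall x, 0 <= f x)%E ->
  (\int[leb]_(x in `]0%R, +oo[) f (c * x)%R =
   (c^-1)%:E * \int[leb]_(x in `]0%R, +oo[) f x)%E.
Proof.
move=> c0 mf f0; rewrite !(mkindic `]0%R, +oo[).
have mg : measurable_fun setT (fun x : R => f x * (\1_(`]0%R, +oo[%classic : set R) x)%:E)%E.
  by apply: emeasurable_funM => //; apply: mfun_EFin; exact: measurable_indic.
have cn0 : c != 0 by rewrite gt_eqF.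
have := integral_scaleR cn0 mg.
rewrite (gtr0_norm c0) => <-; last by move=> x; rewrite mule_ge0.
apply: eq_integral => x _; congr (_ * _%:E)%E; rewrite !indicE !mem_setE !in_itv/= !andbT.
by rewrite pmulr_rgt0.
Qed.

Lemma integral_powR_gt1 (a : R) : 0 < a ->
  (\int[leb]_(t in `]1%R, +oo[) (t `^ (- a - 1))%:E = (a^-1)%:E)%E.
Proof.
move=> a0; rewrite -lebRE//; last 2 first.
- by apply/measurable_funTS; mf.
- by move=> x _; rewrite lee_fin powR_ge0.
have ispos x : 1 <= x -> 0 < x :> R by apply: lt_le_trans.
have dF (x : R) : 0 < x -> is_derive x 1 (fun t : R => - a^-1 * t `^ (- a)) (x `^ (- a - 1)).
  move=> x0; have h := @is_derive1_powR _ (- a) _ x0.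
  have h2 := @is_deriveZ _ _ _ (fun t => t `^ (- a)) (- a^-1) x 1 _ h.
  apply: (is_derive_eq h2); rewrite /GRing.scale/= mulrA mulrNN mulVf ?gt_eqF// mul1r.
  by [].
rewrite integral_itv_obnd_cbnd; last by apply/measurable_funTS; mf.
rewrite (@ge0_continuous_FTC2y _ _ (fun t => - a^-1 * t `^ (- a)) 1 0).
- by rewrite powR1 mulr1 -EFinB sub0r opprK.
- by move=> x _; exact: powR_ge0.
- apply: continuous_in_subspaceT => x /set_mem/=; rewrite in_itv/= andbT => /ispos x0.
  by apply: differentiable_continuous; apply/derivable1_diffP; apply: derivable_powR; rewrite in_itv/= x0.
- rewrite -(mulr0 (- a^-1)); apply: cvgM; first exact: cvg_cst.
  under eq_fun do rewrite powRN.
  apply/gtr0_cvgV0.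
    by near do rewrite powR_gt0//; exact: nbhs_pinfty_gt.
  apply/cvgryPge => A; near=> x.
  apply: (@le_trans _ _ ((`|A| `^ a^-1) `^ a)).
    by rewrite -powRrM mulVf ?gt_eqF// powRr1// ler_norm.
  apply: ge0_ler_powR; rewrite ?nnegrE ?powR_ge0//.
  - exact: ltW.
- by move=> x /ltW/ispos /dF [].
- apply: cvg_at_right_filter.
  by have [/derivable1_diffP/differentiable_continuous] := dF 1 ltr01.
- move=> x; rewrite in_itv/= andbT => /ltW/ispos /dF[_ h].
  by rewrite derive1E.
Unshelve. all: by end_near. Qed.

Lemma integral_powR_lt1 (a : R) : 0 < a ->
  (\int[leb]_(t in `]0%R, 1%R[) (t `^ (a - 1))%:E = (a^-1)%:E)%E.
Proof.
move=> a0; rewrite -integral_powR_gt1// integral_inversion//; last 2 first.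
- by mf.
- by move=> x; rewrite lee_fin powR_ge0.
apply: eq_integral => t /set_mem/=; rewrite in_itv/= => /andP[t0 t1].
rewrite -powR_inv1 ?ltW// -EFinM; congr (_%:E).
rewrite -powRrM -powRD; last by rewrite (gt_eqF t0) implybT.
by congr (_ `^ _); lra.
Qed.

Definition gammae (a : R) : \bar R :=
  (\int[leb]_(t in `]0%R, +oo[) (t `^ (a - 1) * expR (- t))%:E)%E.

(** The function t^(a+1) e^(-t) is largest at t = a + 1: this is ln x <= x - 1 at x = t/(a+1), and
    the factor e^(-a-1) is dropped. The exponent is left as -1 - 1 to match [integral_powR_gt1]. *)
Lemma gamma_bound (a t : R) : 0 < a -> 0 < t ->
  t `^ (a - 1) * expR (- t) <= (a + 1) `^ (a + 1) * t `^ (- 1 - 1).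
Proof.
move=> a0 t0; have a1 : 0 < a + 1 by rewrite addr_gt0.
rewrite expRN ler_pdivrMr ?expR_gt0//.
rewrite (_ : a - 1 = (a + 1) + (- 1 - 1)); last by lra.
rewrite powRD; last by rewrite (gt_eqF t0) implybT.
rewrite mulrAC ler_pM2r ?powR_gt0//.
rewrite /powR !gt_eqF// -expRD ler_expR.
have -> : ln t = ln (t / (a + 1)) + ln (a + 1).
  by rewrite -lnM ?posrE ?divr_gt0// divfK ?gt_eqF.
rewrite mulrDr addrC lerD2l.
have := @le_ln1Dx _ (t / (a + 1) - 1).
rewrite addrCA subrr addr0 ltrBrDr addNr divr_gt0// => /(_ isT) h.
rewrite -ler_pdivlMl//; apply: le_trans h _; rewrite mulrC lerBlDr lerDl//.
Qed.

Lemma gammae_fin (a : R) : 0 < a -> gammae a \is a fin_num.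
Proof.
move=> a0; rewrite ge0_fin_numE; last first.
  by apply: integral_ge0 => x _; rewrite lee_fin mulr_ge0 ?powR_ge0 ?expR_ge0.
have mg : measurable_fun setT (fun t : R => (t `^ (a - 1) * expR (- t))%:E) by mf.
rewrite /gammae (_ : `]0%R, +oo[%classic = `]0%R, 1%R[%classic `|` `[1%R, +oo[%classic :> set R); last first.
  by rewrite -itv_bndbnd_setU// bnd_simp.
rewrite ge0_integral_setU//; last 3 first.
- exact: measurable_funTS.
- by move=> x _; rewrite lee_fin mulr_ge0 ?powR_ge0 ?expR_ge0.
- apply/disj_setPS => x [] /=; rewrite !in_itv/= andbT => /andP[_ x1].
  by rewrite leNgt x1.
have f0 (x : R) : (0 <= (x `^ (a - 1) * expR (- x))%:E)%E.
  by rewrite lee_fin mulr_ge0 ?powR_ge0 ?expR_ge0.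
rewrite -[X in (_ + X)%E](lebRE (D := `[1%R, +oo[))//; last exact: measurable_funTS.
rewrite -integral_itv_obnd_cbnd; last exact: measurable_funTS.
rewrite lebRE//; last exact: measurable_funTS.
apply: lte_add_pinfty.
- apply: (@le_lt_trans _ _ (\int[leb]_(t in `]0%R, 1%R[) (t `^ (a - 1))%:E)%E).
    apply: ge0_le_integral => //.
    + exact: measurable_funTS.
    + by apply/measurable_funTS; mf.
    + move=> x /=; rewrite in_itv/= => /andP[x0 _].
      rewrite lee_fin ler_piMr ?powR_ge0//.
      by rewrite -expR0 ler_expR oppr_le0 ltW.
  by rewrite integral_powR_lt1// ltry.
- apply: (@le_lt_trans _ _ (\int[leb]_(t in `]1%R, +oo[) (((a + 1) `^ (a + 1))%:E * (t `^ (- 1 - 1))%:E))%E).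
    apply: ge0_le_integral => //.
    + exact: measurable_funTS.
    + by apply/measurable_funTS; mf.
    + move=> x /=; rewrite in_itv/= andbT => /(lt_trans ltr01) x0.
      by rewrite -EFinM lee_fin gamma_bound.
  rewrite ge0_integralZl//; last 3 first.
  + by apply/measurable_funTS; mf.
  + by move=> x _; rewrite lee_fin powR_ge0.
  + by rewrite lee_fin powR_ge0.
  by rewrite integral_powR_gt1// -EFinM ltry.
Qed.

Lemma gammaeE a : 0 < a -> (Gamma_fun a)%:E = gammae a.
Proof.
move=> a0; rewrite -[RHS]fineK ?gammae_fin//; congr (_%:E).
rewrite /Gamma_fun /Rintegral lebRE//.
- by apply/measurable_funTS; mf.
- by move=> x _; rewrite lee_fin mulr_ge0 ?powR_ge0 ?expR_ge0.
Qed.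
End gamma_beta.
Section beta.
Context (R : realType).
Notation leb := (@lebR R).
Notation L := (lebesgue_rV R).

Lemma mkpos (f : R -> R) :
  (\int[leb]_(x in `]0%R, +oo[) (f x)%:E = \int[leb]_x (f x * (0 < x)%R%:R)%:E)%E.
Proof.
rewrite (mkindic `]0%R, +oo[); apply: eq_integral => x _.
by rewrite -EFinM indicE mem_setE in_itv/= andbT.
Qed.

Lemma gauss_leb (c : R) : 0 < c ->
  (\int[leb]_t (expR (- (c * t ^+ 2)))%:E = (Num.sqrt pi * c `^ (- 2^-1))%:E)%E.
Proof.
move=> c0; have mG : measurable_fun setT (fun t : R => (expR (- (t ^+ 2)))%:E) by mf.
have G0 (t : R) : (0 <= (expR (- (t ^+ 2)))%:E)%E by rewrite lee_fin expR_ge0.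
have sc0 : Num.sqrt c != 0 by rewrite gt_eqF// sqrtr_gt0.
have := integral_scaleR sc0 mG G0.
rewrite ger0_norm ?sqrtr_ge0// -[X in (_ * X)%E]lebRE//.
rewrite -[X in (_ * X)%E]/(\int[lebesgue_measure]_t (gauss_fun t)%:E)%E integralT_gauss.
rewrite powRN powR12_sqrt ?ltW// -EFinM mulrC => <-.
by apply: eq_integral => t _; rewrite exprMn sqr_sqrtr// ltW.
Qed.

Lemma gamma_scale (a c : R) : 0 < a -> 0 < c ->
  (\int[leb]_(t in `]0%R, +oo[) (t `^ (a - 1) * expR (- (c * t)))%:E =
   (c `^ (- a))%:E * gammae a)%E.
Proof.
move=> a0 c0.
have mg : measurable_fun setT (fun t : R => (t `^ (a - 1) * expR (- t))%:E) by mf.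
have g0 (t : R) : (0 <= (t `^ (a - 1) * expR (- t))%:E)%E.
  by rewrite lee_fin mulr_ge0 ?powR_ge0 ?expR_ge0.
have mg' : measurable_fun setT (fun t : R => (t `^ (a - 1) * expR (- (c * t)))%:E) by mf.
have := integral_scale_pos c0 mg g0; rewrite -/(gammae a) => H.
have : (\int[leb]_(t in `]0%R, +oo[) ((c `^ (a - 1))%:E * (t `^ (a - 1) * expR (- (c * t)))%:E) =
  (c^-1)%:E * gammae a)%E.
  rewrite -H; apply: eq_integral => t /set_mem/=; rewrite in_itv/= andbT => t0.
  by rewrite -EFinM mulrA -powRM ?ltW.
rewrite ge0_integralZl//; last 3 first.
- exact: measurable_funTS.
- by move=> x _; rewrite lee_fin mulr_ge0 ?powR_ge0 ?expR_ge0.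
- by rewrite lee_fin powR_ge0.
move=> {}H.
transitivity ((c `^ (1 - a))%:E * ((c `^ (a - 1))%:E *
  \int[leb]_(t in `]0%R, +oo[) (t `^ (a - 1) * expR (- (c * t)))%:E))%E.
  rewrite muleA -EFinM -powRD; last by rewrite (gt_eqF c0) implybT.
  by rewrite addrA subrK subrr powRr0 mul1e.
rewrite H muleA -EFinM -powR_inv1 ?ltW// -powRD; last by rewrite (gt_eqF c0) implybT.
by congr ((_ `^ _)%:E * _)%E; lra.
Qed.

(** Write Gamma(s) (A + t^2)^(-s) as the integral of u^(s-1) e^(-(A+t^2)u) over u > 0 and exchange
    the integrals; the one in t is Gaussian and contributes u^(-1/2). *)
Lemma beta1 (A s : R) : 0 < A -> 2^-1 < s ->
  (gammae s * \int[leb]_t ((A + t ^+ 2) `^ (- s))%:E =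
   (Num.sqrt pi * A `^ (2^-1 - s))%:E * gammae (s - 2^-1))%E.
Proof.
move=> A0 s2; have s0 : 0 < s by apply: lt_trans s2; rewrite invr_gt0.
have At (t : R) : 0 < A + t ^+ 2 by rewrite ltr_pwDl// sqr_ge0.
pose F (t u : R) : R := u `^ (s - 1) * expR (- ((A + t ^+ 2) * u)) * (0 < u)%R%:R.
have F0 t u : (0 <= (F t u)%:E)%E by rewrite lee_fin !mulr_ge0 ?powR_ge0 ?expR_ge0.
transitivity (\int[leb]_t \int[leb]_u (F t u)%:E)%E.
  rewrite -ge0_integralZl//; last 3 first.
  - by mf.
  - by move=> t _; rewrite lee_fin powR_ge0.
  - by apply: integral_ge0 => x _; rewrite lee_fin mulr_ge0 ?powR_ge0 ?expR_ge0.
  by apply: eq_integral => t _; rewrite -mkpos gamma_scale// muleC.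
rewrite (@tonelli R _ _ _ _ _ _ (fun t u => (F t u)%:E)); last 2 first.
- by rewrite /F; mf.
- exact: F0.
transitivity (\int[leb]_u ((Num.sqrt pi)%:E * (u `^ ((s - 2^-1) - 1) * expR (- (A * u)) * (0 < u)%R%:R)%:E))%E.
  apply: eq_integral => u _; rewrite /F.
  have [u0|u0] := ltP 0 u; last first.
    by rewrite mulr0 mule0; under eq_integral do rewrite mulr0; exact: integral0.
  under eq_integral do rewrite mulr1 mulrDl opprD expRD mulrA EFinM (mulrC (_ ^+ 2)).
  under eq_integral do rewrite -EFinM.
  rewrite integralZ; last 3 first.
  - by mf.
  - by move=> x; rewrite expR_ge0.
  - by rewrite mulr_ge0 ?powR_ge0 ?expR_ge0.
  rewrite gauss_leb// -!EFinM mulr1; congr (_%:E).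
  rewrite (_ : s - 2^-1 - 1 = (s - 1) + (- 2^-1)); last by lra.
  by rewrite (@powRD _ _ (s - 1)); [ring|rewrite (gt_eqF u0) implybT].
under eq_integral do rewrite -EFinM.
rewrite integralZ; last 3 first.
- by mf.
- by move=> x; rewrite !mulr_ge0 ?powR_ge0 ?expR_ge0.
- exact: sqrtr_ge0.
rewrite -(mkpos (fun u => u `^ ((s - 2^-1) - 1) * expR (- (A * u)))).
rewrite gamma_scale//; last by rewrite subr_gt0.
by rewrite muleA -EFinM opprB.
Qed.

Lemma gamma_gt0 (a : R) : 0 < a -> 0 < Gamma_fun a.
Proof.
move=> a0; rewrite -lte_fin gammaeE//; apply: integral_gt0 => //.
- by apply/measurable_funTS; mf.
- by move=> x /=; rewrite in_itv/= andbT => x0; rewrite lte_fin mulr_gt0 ?powR_gt0 ?expR_gt0.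
- have h : @lebR R `]0, +oo[%classic = +oo%E.
    by rewrite lebR_itv lebesgue_measure_itv/= ltry.
  by rewrite (lt_le_trans (ltry 0))// -h.
Qed.

Lemma beta1R (A s : R) : 0 < A -> 2^-1 < s ->
  (\int[leb]_t ((A + t ^+ 2) `^ (- s))%:E =
   (Num.sqrt pi * Gamma_fun (s - 2^-1) / Gamma_fun s * A `^ (2^-1 - s))%:E)%E.
Proof.
move=> A0 s2; have s0 : 0 < s by apply: lt_trans s2; rewrite invr_gt0.
have := beta1 A0 s2; rewrite -!gammaeE ?subr_gt0// => H.
transitivity (((Gamma_fun s)^-1)%:E * ((Gamma_fun s)%:E * \int[leb]_t ((A + t ^+ 2) `^ (- s))%:E))%E.
  by rewrite muleA -EFinM mulVf ?mul1e// gt_eqF// gamma_gt0.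
by rewrite H -!EFinM; congr (_%:E); ring.
Qed.

(** By [integral_bessel] this is the integral over R^m of (1 + |z|^2)^(-(q+m)/2). For q = k + sp and
    m = d - k it is the factor of the Hardy constant in front of C_1. *)
Definition gconst (m : nat) (q : R) : R :=
  pi `^ (m%:R / 2) * Gamma_fun (q / 2) / Gamma_fun ((q + m%:R) / 2).

(** The coordinates are integrated one at a time with [beta1R]: each lowers the exponent by 1/2, and
    the Gamma quotients telescope. *)
Lemma integral_bessel m (A q : R) : 0 < A -> 0 < q ->
  (\int[L m]_z ((A + enorm z ^+ 2) `^ (- ((q + m%:R) / 2)))%:E =
   (gconst m q * A `^ (- (q / 2)))%:E)%E.
Proof.
elim: m A q => [|m IH] A q A0 q0.
  rewrite integral_rV0 => [|x]; last by rewrite lee_fin powR_ge0.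
  rewrite enorm0 expr0n addr0 /gconst addr0 mul0r powRr0 mul1r divff ?mul1r//.
  by rewrite gt_eqF// gamma_gt0// divr_gt0.
rewrite integral_rVS'; last 2 first.
- by apply: mfun_EFin; apply: mfun_powR; apply: measurable_funD => //; apply: measurable_funX; exact: mfun_enorm.
- by move=> x; rewrite lee_fin powR_ge0.
have s2 : 2^-1 < (q + m.+1%:R) / 2.
  by have m0 : 0 <= m%:R :> R by []; rewrite -[m.+1%:R]natr1; lra.
set s := (q + m.+1%:R) / 2.
have sE : s - 2^-1 = (q + m%:R) / 2 by rewrite /s -[m.+1%:R]natr1; field.
transitivity (\int[L m]_v ((Num.sqrt pi * Gamma_fun (s - 2^-1) / Gamma_fun s) *
    ((A + enorm v ^+ 2) `^ (- ((q + m%:R) / 2))))%:E)%E.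
  apply: eq_integral => v _.
  have Av : 0 < A + enorm v ^+ 2 by rewrite ltr_pwDl// sqr_ge0.
  rewrite -sE opprB -(beta1R Av s2); apply: eq_integral => t _.
  rewrite enorm_cons/= sqr_sqrtr ?addr_ge0 ?sqr_ge0//.
  by rewrite -addrA [t ^+ 2 + _]addrC.
have G0 : 0 < Gamma_fun (s - 2^-1) / Gamma_fun s.
  by rewrite divr_gt0 ?gamma_gt0// ?subr_gt0//; apply: lt_trans s2; rewrite invr_gt0.
rewrite integralZ; last 3 first.
- by apply: mfun_powR; apply: measurable_funD => //; apply: measurable_funX; exact: mfun_enorm.
- by move=> x; rewrite powR_ge0.
- by rewrite -mulrA mulr_ge0 ?sqrtr_ge0// ltW.
rewrite (IH _ _ A0 q0) -EFinM mulrA; congr (_ * _)%:E.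
rewrite /gconst -sE /s -[m.+1%:R]natr1 (mulrDl m%:R) (@powRD _ _ (m%:R / 2)); last by rewrite (gt_eqF (pi_gt0 _)) implybT.
rewrite div1r powR12_sqrt ?pi_ge0//.
have G1 : Gamma_fun ((q + (m%:R + 1)) / 2 - 2^-1) != 0.
  by rewrite natr1 gt_eqF// gamma_gt0// subr_gt0.
have G2 : Gamma_fun ((q + (m%:R + 1)) / 2) != 0.
  by rewrite natr1 gt_eqF// gamma_gt0//; apply: lt_trans s2; rewrite invr_gt0.
move: (Gamma_fun _) G1 (Gamma_fun (q / 2)) (Gamma_fun _) G2 => g1 g10 g2 g3 g30.
move: (pi `^ _) (Num.sqrt _) => P S.
by field; rewrite g10 g30.
Qed.

End beta.

(** * Radial and polar coordinates *)

Section radial.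
Context (R : realType).
Local Open Scope ereal_scope.
Notation leb := (@lebR R).
Notation L := (lebesgue_rV R).

Lemma measurable_enorm_set n (A : set R) : measurable A ->
  measurable [set z : 'rV[R]_n | A (enorm z)].
Proof.
move=> mA; have m : measurable_fun setT (fun z : 'rV[R]_n => enorm z).
  exact: mfun_enorm.
by rewrite -[X in measurable X]setTI; exact: m.
Qed.

Lemma measurable_rV_box n (A : 'I_n -> set R) : (forall i, measurable (A i)) ->
  measurable [set v : 'rV[R]_n | forall i, A i (v ord0 i)].
Proof.
move=> mA; rewrite (_ : [set v | _] = \bigcap_(i in [set: 'I_n])
  ((fun v : 'rV[R]_n => v ord0 i) @^-1` A i)); last first.
  by apply/seteqP; split => [v + i _|v + i]; apply.
apply: fin_bigcap_measurable => // i _.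
by rewrite -[X in measurable X]setTI; exact: measurable_coord.
Qed.

Definition pball n : set 'rV[R]_n := [set x | (0 < enorm x <= 1)%R].

Lemma measurable_pball n : measurable (@pball n).
Proof.
have -> : @pball n = [set z | `]0%R, 1%R]%classic (enorm z)].
  by apply/seteqP; split => x; rewrite /= in_itv.
exact: measurable_enorm_set.
Qed.

Lemma pball_fin n : L n (@pball n) < +oo.
Proof.
pose B : set 'rV[R]_n := [set v | forall i, `[(-1)%R, 1%R]%classic (v ord0 i)].
have mB : measurable B by apply: (@measurable_rV_box n (fun=> `[(-1)%R, 1%R]%classic)).
have BL : L n (@pball n) <= L n B.
  apply: le_measure; [exact: (mem_set (@measurable_pball n))|exact: (mem_set mB)|].
  move=> x /= /andP[_ x1] i /=; rewrite in_itv/= -ler_norml.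
  exact: le_trans (coord_le_enorm _ _) x1.
apply: (le_lt_trans BL); rewrite (@lebesgue_rV_box R n (fun=> `[(-1)%R, 1%R]%classic))//.
under eq_bigr do rewrite lebesgue_measure_itv/= lte_fin gtrN// -EFinB.
by rewrite prodEFin ltry.
Qed.

Lemma sphere_areaE n : (sphere_area R n)%:E = n%:R%:E * L n (@pball n).
Proof.
rewrite /sphere_area /surface_measure.
rewrite (_ : [set x | _] = @pball n); last first.
  apply/seteqP; split => x /=; first by move=> [].
  move=> x01; split=> //; rewrite /unit_sphere/= enormZ normfV.
  move: x01 => /andP[x0 _].
  by rewrite ger0_norm ?enorm_ge0// mulVf// gt_eqF.
rewrite fineK// ge0_fin_numE; last by rewrite mule_ge0// lee_fin ler0n.
by rewrite lte_mul_pinfty// ?lee_fin ?ler0n// pball_fin.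
Qed.

Lemma sphere_area_ge0 n : (0 <= sphere_area R n)%R.
Proof. by rewrite -lee_fin sphere_areaE mule_ge0// lee_fin ler0n. Qed.

Lemma lebesgue_rV0 n : L n.+1 [set 0%R] = 0.
Proof.
rewrite (_ : [set 0%R] = [set v : 'rV[R]_n.+1 | forall i, [set (0 : R)%R] (v ord0 i)]); last first.
  apply/seteqP; split => [x ->i|x /= x0]; first by rewrite /= mxE.
  by apply/rowP => i; rewrite x0 mxE.
by rewrite (@lebesgue_rV_box R n.+1 (fun=> [set 0%R]))// big_ord_recl/= lebesgue_measure_set1 mul0e.
Qed.

Lemma lebesgue_rV_ball n (b : R) : (0 < b)%R ->
  L n [set z | (0 < enorm z <= b)%R] = (b ^+ n)%:E * L n (@pball n).
Proof.
move=> b0; have bV : (b^-1 != 0)%R by rewrite invr_eq0 gt_eqF.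
pose f (z : 'rV[R]_n) : \bar R := ((0 < enorm z)%R && (enorm z <= 1)%R)%:R%:E.
have mf : measurable_fun setT f.
  have me : measurable_fun setT (fun z : 'rV[R]_n => enorm z) by exact: mfun_enorm.
  by rewrite /f; mf.
have := integral_scale_rV bV mf.
have fE : f = fun z => (\1_(@pball n) z)%:E.
  by apply/funext => z; rewrite /f indicE; congr ((nat_of_bool _)%:R%:E); apply/idP/idP;
    [move=> h; exact/mem_set|move/set_mem].
have -> : \int[L n]_x f x = L n (@pball n).
  by rewrite fE integral_indic ?setIT//; exact: measurable_pball.
rewrite normfV exprVn invrK (gtr0_norm b0) => <-; last first.
  by move=> x; rewrite lee_fin ler0n.
set B := [set z | _]; have mB : measurable B.
  have -> : B = [set z | `]0%R, b]%classic (enorm z)].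
    by apply/seteqP; split => x; rewrite /= in_itv.
  exact: measurable_enorm_set.
rewrite -[in LHS](setIT B) -(integral_indic (L n) measurableT mB); apply: eq_integral => z _.
rewrite /f enormZ normfV (gtr0_norm b0) indicE; congr ((nat_of_bool _)%:R%:E).
rewrite pmulr_rgt0 ?invr_gt0// ler_pdivrMl// mulr1.
by apply/idP/idP; [move/set_mem|move=> h; exact/mem_set].
Qed.

(** Both sides are images of weighted measures under the logarithm of the radius. [I1] finds the
    volume of the shell between the radii e^a and e^b from the homogeneity of ball volumes, [I2]
    finds the same number by integrating the area of spheres, and [integral_push_unique]
    concludes. *)
Lemma integral_radial n (g : R -> \bar R) :
  measurable_fun setT g -> (forall r, 0 <= g r) ->
  \int[L n.+1]_z g (enorm z) = (sphere_area R n.+1)%:E *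
    \int[leb]_(r in `]0%R, +oo[) (g r * (r ^+ n)%:E).
Proof.
move=> mg g0.
have me : measurable_fun setT (fun z : 'rV[R]_n.+1 => enorm z) by exact: mfun_enorm.
pose f (tau : R) := g (expR tau).
have mf : measurable_fun setT f by apply: (measurableT_comp mg); mf.
pose v := fine (L n.+1 (@pball n.+1)).
have vE : v%:E = L n.+1 (@pball n.+1) by rewrite fineK// ge0_fin_numE// pball_fin.
have v0 : (0 <= v)%R by rewrite -lee_fin vE.
have SE : sphere_area R n.+1 = (n.+1%:R * v)%R.
  by apply/EFin_inj; rewrite sphere_areaE -vE.
pose g1 (z : 'rV[R]_n.+1) : R := (0 < enorm z)%R%:R.
pose g2 (r : R) : R := (sphere_area R n.+1 * r ^+ n * (0 < r)%R%:R)%R.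
have mg1 : measurable_fun setT g1 by rewrite /g1; mf.
have mg2 : measurable_fun setT g2 by rewrite /g2; mf.
have g10 z : (0 <= g1 z)%R by exact: ler0n.
have g20 r : (0 <= g2 r)%R.
  rewrite /g2; case: ltP => r0; rewrite ?mulr0// mulr1 mulr_ge0 ?sphere_area_ge0//.
  by rewrite exprn_ge0// ltW.
have I1 (a b : R) : (a < b)%R ->
    \int[L n.+1]_(x in (fun z => ln (enorm z)) @^-1` `]a, b]) (g1 x)%:E =
    (v * (expR b ^+ n.+1 - expR a ^+ n.+1))%:E.
  move=> ab.
  pose Bl (c : R) := [set z : 'rV[R]_n.+1 | (0 < enorm z <= expR c)%R].
  have mBl c : measurable (Bl c).
    have -> : Bl c = [set z | `]0%R, expR c]%classic (enorm z)].
      by apply/seteqP; split => x; rewrite /= in_itv.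
    exact: measurable_enorm_set.
  have Blab : Bl a `<=` Bl b.
    move=> x /= /andP[x0 xa]; rewrite /Bl/= x0/=; apply: (le_trans xa).
    by rewrite ler_expR ltW.
  have BlE c : L n.+1 (Bl c) = (expR c ^+ n.+1 * v)%:E.
    by rewrite lebesgue_rV_ball ?expR_gt0// EFinM vE.
  transitivity (L n.+1 (Bl b `\` Bl a)); last first.
    have BF : L n.+1 (Bl b) < +oo by rewrite BlE ltry.
    rewrite (measureD (mBl b) (mBl a) BF).
    rewrite (setIidr Blab).
    transitivity ((expR b ^+ n.+1 * v)%:E - (expR a ^+ n.+1 * v)%:E).
      by congr (_ - _); exact: BlE.
    by rewrite -EFinB; congr (_%:E); ring.
  rewrite -[in RHS](setIT (Bl b `\` Bl a)) -(integral_indic (L n.+1) measurableT (measurableD (mBl b) (mBl a))).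
  rewrite [LHS]integral_mkcond; apply: eq_integral => z _; rewrite patchE indicE /g1.
  have [z0|z0] := ltP 0%R (enorm z); last first.
    rewrite if_same memNset//= => -[/andP[+ _] _].
    by rewrite ltNge z0.
  rewrite -[if _ then _ else _]/(if _ then 1%:E else 0%:E) -(fun_if EFin).
  rewrite [X in X%:E](_ : _ = (z \in (fun z => ln (enorm z)) @^-1` `]a, b])%:R); last by case: ifP.
  congr ((nat_of_bool _)%:R%:E); apply/idP/idP => /set_mem h; apply/mem_set.
    move: h; rewrite /= in_itv/= => /andP[za zb]; rewrite /Bl/= z0/=.
    rewrite -ler_ln ?posrE ?expR_gt0// expRK; split => //.
    by apply/negP; rewrite -ler_ln ?posrE ?expR_gt0// expRK -ltNge.
  move: h; rewrite /Bl/= z0/= => -[zb /negP]; rewrite -ltNge => za.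
  by rewrite in_itv/= -(expRK a) -(expRK b) ltr_ln ?ler_ln ?posrE ?expR_gt0// za.
have I2 (a b : R) : (a < b)%R ->
    \int[leb]_(x in (@ln R) @^-1` `]a, b]) (g2 x)%:E =
    (v * (expR b ^+ n.+1 - expR a ^+ n.+1))%:E.
  move=> ab.
  transitivity (\int[leb]_(r in `]expR a, expR b]) (sphere_area R n.+1 * r ^+ n)%:E).
    rewrite [LHS]integral_mkcond [RHS]integral_mkcond; apply: eq_integral => r _.
    rewrite !patchE /g2; have [r0|r0] := ltP 0%R r; last first.
      rewrite mulr0 if_same; case: ifPn => // /set_mem/=; rewrite in_itv/= => /andP[h _].
      by have := lt_le_trans h r0; rewrite ltNge expR_ge0.
    rewrite mulr1; congr (if _ then _ else _).
    apply/idP/idP => /set_mem h; apply/mem_set; move: h; rewrite /= !in_itv/=.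
      by rewrite -{3 4}(lnK (x := r)) ?posrE// ltr_expR ler_expR.
    by rewrite -{1 2}(lnK (x := r)) ?posrE// ltr_expR ler_expR.
  rewrite (@FTC_leb _ (fun r => v * r ^+ n.+1)%R).
  - by rewrite -mulrBr.
  - by rewrite ler_expR ltW.
  - move=> x _; have h1 : is_derive x 1%R (fun r : R => r ^+ n.+1)%R (n.+1%:R * x ^+ n)%R.
      have h := is_deriveX n.+1 (is_derive_id x (1 : R)%R); rewrite exprfctE in h.
      by apply: (is_derive_eq h); rewrite /GRing.scale/= mulr1.
    have h := is_deriveZ v h1.
    by apply: (is_derive_eq h); rewrite /GRing.scale/= SE mulrA [(v * _)%R]mulrC.
  - move=> x _; apply: cvgM; first exact: cvg_cst.
    exact: exprn_continuous.
  - move=> x /andP[ax _]; rewrite mulr_ge0 ?sphere_area_ge0// exprn_ge0//.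
    by apply: le_trans ax; exact: expR_ge0.
  - by mf.
have H := @integral_push_unique R _ _ _ _ (L n.+1) leb (fun z => ln (enorm z)) (@ln R)
  g1 g2 f.
transitivity (\int[L n.+1]_x (f (ln (enorm x)) * (g1 x)%:E)).
  (* The origin is discarded: since ln 0 is 0 by convention, f (ln |z|) does not return g |z|
     there. *)
  have -> : \int[L n.+1]_z g (enorm z) =
      \int[L n.+1]_(z in [set: 'rV[R]_n.+1] `\` [set (0 : 'rV[R]_n.+1)%R]) g (enorm z).
    apply: ge0_negligible_integral => //; last exact: lebesgue_rV0.
    - rewrite (_ : [set 0%R] = [set z : 'rV[R]_n.+1 | [set (0 : R)%R] (enorm z)]).
        exact: measurable_enorm_set.
      by apply/seteqP; split => z /= /eqP; [rewrite -enorm_eq0|rewrite enorm_eq0] => /eqP.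
    - exact: (measurableT_comp mg).
  rewrite [LHS]integral_mkcond; apply: eq_integral => z _; rewrite patchE /f /g1.
  rewrite enorm_gt0; case: ifPn => [/set_mem[_ /= /eqP z0]|].
    by rewrite z0 mule1 lnK// posrE enorm_gt0.
  by rewrite in_setD in_setT/= negbK => /set_mem/= ->; rewrite eqxx mule0.
have m1 : measurable_fun setT (fun z : 'rV[R]_n.+1 => ln (enorm z)) by mf.
have m2 : measurable_fun setT (@ln R) by exact: mfun_ln.
have ff0 t : 0 <= f t by exact: g0.
rewrite (H m1 m2 mg1 mg2 g10 g20 _ _ mf ff0); last 2 first.
- by move=> a b ab; rewrite (I1 _ _ ab) ltry.
- by move=> a b ab; rewrite (I1 _ _ ab) (I2 _ _ ab).
have mgr : measurable_fun setT (fun r : R => g r * (r ^+ n)%:E).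
  by apply: emeasurable_funM => //; mf.
rewrite -ge0_integralZl//; last 3 first.
- exact: measurable_funTS.
- move=> r /=; rewrite in_itv/= andbT => r0.
  by rewrite mule_ge0// lee_fin exprn_ge0// ltW.
- by rewrite lee_fin sphere_area_ge0.
rewrite [RHS](mkindic `]0%R, +oo[); apply: eq_integral => r _.
rewrite /g2 /f indicE mem_setE in_itv/= andbT.
case: ltP => r0; last by rewrite mulr0 !mule0.
by rewrite lnK// mulr1 mule1 EFinM muleCA.
Qed.

End radial.
Section polar.
Context (R : realType).
Local Open Scope ereal_scope.
Notation leb := (@lebR R).
Notation L := (lebesgue_rV R).

Lemma tonelliD (D1 D2 : set R) (f : R -> R -> \bar R) :
  measurable D1 -> measurable D2 ->
  measurable_fun setT (fun p => f p.1 p.2) -> (forall x y, 0 <= f x y) ->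
  \int[leb]_(x in D1) \int[leb]_(y in D2) f x y =
  \int[leb]_(y in D2) \int[leb]_(x in D1) f x y.
Proof.
move=> mD1 mD2 mf f0.
have m1 : measurable_fun setT (\1_D1 : R -> R) by exact: measurable_indic.
have m2 : measurable_fun setT (\1_D2 : R -> R) by exact: measurable_indic.
pose h x y := f x y * (\1_D1 x * \1_D2 y)%R%:E.
have mh : measurable_fun setT (fun p : R * R => h p.1 p.2).
  apply: emeasurable_funM => //; apply: mfun_EFin; apply: measurable_funM.
    exact: (measurableT_comp m1 measurable_fst).
  exact: (measurableT_comp m2 measurable_snd).
have h0 x y : 0 <= h x y by rewrite mule_ge0// lee_fin mulr_ge0.
have E1 : \int[leb]_(x in D1) \int[leb]_(y in D2) f x y =
    \int[leb]_x \int[leb]_y h x y.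
  rewrite (mkindic D1); apply: eq_integral => x _.
  rewrite (mkindic D2) -ge0_integralZr ?lee_fin//; last 2 first.
  - apply: emeasurable_funM; first exact: (mfun_pair1 x mf).
    exact: mfun_EFin.
  - by move=> y _; rewrite mule_ge0// lee_fin.
  by apply: eq_integral => y _; rewrite /h mulrC EFinM -muleA.
have E2 : \int[leb]_(y in D2) \int[leb]_(x in D1) f x y =
    \int[leb]_y \int[leb]_x h x y.
  rewrite (mkindic D2); apply: eq_integral => y _.
  rewrite (mkindic D1) -ge0_integralZr ?lee_fin//; last 2 first.
  - apply: emeasurable_funM; first exact: (mfun_pair2 y mf).
    exact: mfun_EFin.
  - by move=> x _; rewrite mule_ge0// lee_fin.
  by apply: eq_integral => x _; rewrite /h EFinM -muleA.
by rewrite E1 E2; exact: (@tonelli R _ _ _ _ leb leb h).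
Qed.

(** With z = (s, v) and rho = |v|, the integral in v is radial. Putting s = rho t / sqrt(1 - t^2)
    makes t = s/|z| and |z| = rho c(t) with c(t) = (1 - t^2)^(-1/2); rescaling rho at fixed t then
    gives the polar Jacobian. *)
Lemma integral_polar n (F : R -> R -> R) :
  measurable_fun setT (fun p => F p.1 p.2) -> (forall r t, (0 <= F r t)%R) ->
  \int[L n.+2]_z (F (enorm z) (z ord0 ord0 / enorm z)%R)%:E =
  (sphere_area R n.+1)%:E * \int[leb]_(r in `]0%R, +oo[) \int[leb]_(t in `](-1)%R, 1%R[)
    (F r t * (1 - t ^+ 2) `^ ((n%:R - 1) / 2) * r ^+ n.+1)%:E.
Proof.
move=> mF F0.
have mF2 d (T : measurableType d) (f g : T -> R) : measurable_fun setT f ->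
    measurable_fun setT g -> measurable_fun setT (fun x => F (f x) (g x)).
  move=> mf mg; apply: (measurableT_comp mF (g := fun x => (f x, g x))).
  exact/measurable_fun_pairP.
pose K (rho s : R) : R := F (Num.sqrt (s ^+ 2 + rho ^+ 2))%R (s / Num.sqrt (s ^+ 2 + rho ^+ 2))%R.
pose G (rho : R) : \bar R := \int[leb]_s (K rho s)%:E.
have mK : measurable_fun setT (fun p : R * R => (K p.1 p.2)%:E).
  by apply: mfun_EFin; apply: mF2; mf.
have K0 rho s : 0 <= (K rho s)%:E by rewrite lee_fin; exact: F0.
have mG : measurable_fun setT G by exact: (@mfun_int R _ _ _ _ leb (fun r s => (K r s)%:E)).
have G0 rho : 0 <= G rho by exact: integral_ge0.
have mz : measurable_fun setT (fun z : 'rV[R]_n.+2 => enorm z) by exact: mfun_enorm.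
rewrite integral_rVS'; last 2 first.
- by apply: mfun_EFin; apply: mF2 => //; mf.
- by move=> z; rewrite lee_fin; exact: F0.
transitivity (\int[L n.+1]_v G (enorm v)).
  apply: eq_integral => v _; apply: eq_integral => t _.
  by rewrite enorm_cons rV_cons0.
rewrite integral_radial//; congr (_ * _).
pose c (t : R) : R := ((1 - t ^+ 2) `^ (- 2^-1))%R.
pose H (rho t : R) : R := (F (rho * c t)%R t * ((1 - t ^+ 2) `^ (- (3 / 2)) * rho ^+ n.+1))%R.
have mH : measurable_fun setT (fun p : R * R => (H p.1 p.2 * (0 < p.1)%R%:R)%R%:E).
  apply: mfun_EFin; apply: measurable_funM; last by mf.
  apply: measurable_funM; last by mf.
  by apply: mF2; rewrite /c; mf.
have H0 rho t : 0 <= (H rho t * (0 < rho)%R%:R)%R%:E.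
  rewrite lee_fin /H; case: ltP => r0; last by rewrite mulr0.
  by rewrite mulr1 mulr_ge0// mulr_ge0 ?powR_ge0// exprn_ge0// ltW.
have p1 (t : R) : t \in `](-1)%R, 1%R[%classic -> (0 < 1 - t ^+ 2)%R.
  by move=> /set_mem; rewrite /= in_itv/= => /andP[t1 t2]; nra.
transitivity (\int[leb]_(rho in `]0%R, +oo[) \int[leb]_(t in `](-1)%R, 1%R[) (H rho t * (0 < rho)%R%:R)%R%:E).
  apply: eq_integral => rho /set_mem/=; rewrite in_itv/= andbT => rho0.
  have rn0 : (rho != 0)%R by rewrite gt_eqF.
  have mKr : measurable_fun setT (fun s => (K rho s)%:E) by exact: (mfun_pair1 rho mK).
  have rV0 : (rho != 0)%R by [].
  have GE : G rho = rho%:E * \int[leb]_s (K rho (rho * s)%R)%:E.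
    rewrite (integral_scaleR rV0 mKr (K0 rho)) muleA -EFinM (gtr0_norm rho0).
    by rewrite divff// mul1e.
  have mKs : measurable_fun setT (fun s => (K rho (rho * s)%R)%:E).
    by apply: (measurableT_comp mKr); mf.
  rewrite GE (integral_sinh mKs); last by move=> s; exact: K0.
  rewrite -muleA muleC -muleA -EFinM -exprSr -ge0_integralZr//; last 3 first.
  - apply/measurable_funTS/emeasurable_funM; last by mf.
    by apply: (measurableT_comp mKs); mf.
  - by move=> t _; rewrite mule_ge0// lee_fin powR_ge0.
  - by rewrite lee_fin exprn_ge0// ltW.
  apply: eq_integral => t /p1 t1; rewrite -!EFinM rho0 mulr1 -mulrA; congr (_ * _)%:E.
  rewrite /K; have sE : (Num.sqrt ((rho * (t * (1 - t ^+ 2) `^ (- 2^-1))) ^+ 2 + rho ^+ 2) = rho * c t)%R.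
    rewrite exprMn -{2}[(rho ^+ 2)%R]mulr1 -mulrDr sqrtrM ?sqr_ge0// sqrtr_sqr gtr0_norm//.
    congr (_ * _)%R; rewrite -powR12_sqrt; last by rewrite addr_ge0 ?sqr_ge0.
    rewrite (_ : _ + 1 = (1 - t ^+ 2) `^ (-1))%R.
      by rewrite -powRrM /c; congr (_ `^ _)%R; lra.
    rewrite exprMn -[((_ `^ _) ^+ 2)%R]powR_mulrn ?powR_ge0// -powRrM mulNr mulVf ?pnatr_eq0//.
    by rewrite powR_inv1 ?ltW//; field; rewrite gt_eqF.
  rewrite sE; congr F; rewrite /c; field.
  by rewrite rn0 gt_eqF// powR_gt0.
have mI1 : measurable (`]0%R, +oo[%classic : set R) by [].
have mI2 : measurable (`](-1)%R, 1%R[%classic : set R) by [].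
rewrite (tonelliD (f := fun rho t => (H rho t * (0 < rho)%R%:R)%R%:E) mI1 mI2 mH H0).
transitivity (\int[leb]_(t in `](-1)%R, 1%R[) \int[leb]_(r in `]0%R, +oo[)
    (F r t * (1 - t ^+ 2) `^ ((n%:R - 1) / 2) * (r ^+ n.+1 * (0 < r)%R%:R))%:E); last first.
  rewrite (tonelliD mI2 mI1); last 2 first.
  - by apply: mfun_EFin; apply: measurable_funM; [apply: measurable_funM; [apply: mF2|]|]; mf.
  - move=> t r; rewrite lee_fin; case: ltP => r0; last by rewrite !mulr0.
    by rewrite mulr1 mulr_ge0 ?mulr_ge0 ?powR_ge0// exprn_ge0// ltW.
  apply: eq_integral => r /set_mem/=; rewrite in_itv/= andbT => r0.
  by apply: eq_integral => t _; rewrite r0 mulr1.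
apply: eq_integral => t /p1 t1.
have ct : (0 < c t)%R by rewrite powR_gt0.
pose f (r : R) : \bar R := (F r t * ((1 - t ^+ 2) `^ (- (3 / 2)) * (r / c t) ^+ n.+1 * (0 < r)%R%:R))%:E.
have mf' : measurable_fun setT f.
  by apply: mfun_EFin; apply: measurable_funM; [apply: mF2|]; mf.
have f0 r : 0 <= f r.
  rewrite lee_fin; case: ltP => r0; last by rewrite !mulr0.
  by rewrite mulr1 !mulr_ge0 ?powR_ge0// exprn_ge0// divr_ge0// ltW.
transitivity (\int[leb]_(x in `]0%R, +oo[) f (c t * x)%R).
  apply: eq_integral => r /set_mem/=; rewrite in_itv/= andbT => r0.
  rewrite /f /H [(c t * r)%R]mulrC mulfK ?gt_eqF// r0 mulr_gt0//.
  by rewrite !mulr1.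
rewrite (integral_scale_pos ct mf' f0) -ge0_integralZl//; last 2 first.
- exact: measurable_funTS.
- by rewrite lee_fin invr_ge0 ltW.
apply: eq_integral => r /set_mem/=; rewrite in_itv/= andbT => r0.
rewrite /f r0 !mulr1 -EFinM; congr (_%:E).
(* The exponent is -3/2 from the derivative of s, plus (n+2)/2 from rho^(n+1) d rho = (r/c)^(n+1)
   dr/c. *)
have -> : ((1 - t ^+ 2) `^ ((n%:R - 1) / 2) =
    (1 - t ^+ 2) `^ (- (3 / 2)) / (c t ^+ n.+2))%R.
  rewrite (_ : ((n%:R - 1) / 2 = - (3 / 2) + (- 2^-1 * - (n.+2%:R)))%R); last first.
    by rewrite -[n.+2]addn2 natrD; field.
  rewrite powRD; last by rewrite (gt_eqF t1) implybT.
  by congr (_ * _)%R; rewrite (powRrM _ (- 2^-1)) -/(c t) powRN powR_mulrn ?ltW.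
move: (c t) ct => C C0; rewrite expr_div_n [(C ^+ n.+2)%R]exprS.
have Cn0 : (C ^+ n.+1 != 0)%R by rewrite expf_neq0 ?gt_eqF.
move: (C ^+ n.+1)%R Cn0 => D D0; field.
by rewrite D0 gt_eqF.
Qed.

End polar.

(** * The kernel integral in polar coordinates *)

Section kernel_integral.
Context (R : realType).
Local Open Scope ereal_scope.
Notation leb := (@lebR R).
Notation L := (lebesgue_rV R).

Lemma measurable_rV1 n (a : 'rV[R]_n) : measurable [set a].
Proof.
have m : measurable_fun setT (fun x : 'rV[R]_n => enorm (x - a)%R).
  by apply: mfun_enorm; mf.
have -> : [set a] = (fun x : 'rV[R]_n => enorm (x - a)%R) @^-1` [set 0%R].
  apply/seteqP; split => x /=; first by move=> ->; rewrite subrr enorm0.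
  by move/eqP; rewrite enorm_eq0 subr_eq0 => /eqP.
by rewrite -[X in measurable X]setTI; exact: m.
Qed.

Lemma integral_neq n (a : 'rV[R]_n.+1) (f : 'rV[R]_n.+1 -> \bar R) :
  measurable_fun setT f -> (forall x, 0 <= f x) ->
  \int[L n.+1]_x f x = \int[L n.+1]_x (f x * (x != a)%:R%:E).
Proof.
move=> mf f0.
have La : L n.+1 [set a] = 0.
  rewrite -[in LHS](setIT [set a]) -(integral_indic (L n.+1) measurableT (measurable_rV1 a)).
  rewrite -(lebesgue_rV0 R n) -[in RHS](setIT [set 0%R]).
  rewrite -(integral_indic (L n.+1) measurableT (measurable_rV1 0%R)).
  have i0 (x : 'rV[R]_n.+1) : 0 <= (\1_[set a] x : R)%:E :> \bar R by rewrite lee_fin.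
  have mia : measurable_fun setT (fun x : 'rV[R]_n.+1 => (\1_[set a] x : R)%:E : \bar R).
    by apply: mfun_EFin; apply: measurable_indic; exact: measurable_rV1.
  rewrite -(integral_shift_rV a mia i0); apply: eq_integral => x _.
  rewrite !indicE; congr ((nat_of_bool _)%:R%:E).
  apply/idP/idP => /set_mem/= h; apply/mem_set => /=; last by rewrite h add0r.
  by apply: (addIr a); rewrite add0r.
have Ha := @ge0_negligible_integral _ _ R (L n.+1) setT [set a] f.
rewrite (Ha (measurable_rV1 a) measurableT mf (fun x _ => f0 x) La).
rewrite [LHS]integral_mkcond; apply: eq_integral => x _; rewrite patchE.
have [->|xa] := eqVneq x a.
  by rewrite mule0 memNset//= => -[_]; exact.
by rewrite mule1 mem_set//; split => //= /eqP; exact/negP.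
Qed.

Lemma integral_evenodd (f : R -> \bar R) : measurable_fun setT f ->
  (forall x, 0 <= f x) ->
  \int[leb]_t f t = \int[leb]_(t in `]0%R, +oo[) (f t + f (- t)%R).
Proof.
move=> mf f0.
have mNf : measurable_fun setT (fun t : R => f (- t)%R).
  by apply: (measurableT_comp mf); mf.
have L0 : leb [set 0%R] = 0 by exact: lebesgue_measure_set1.
have H := @ge0_negligible_integral _ _ R leb setT [set 0%R] f.
rewrite (H (measurable_set1 0%R) measurableT mf (fun x _ => f0 x) L0).
rewrite ge0_integralD//; last 2 first.
- exact: measurable_funTS.
- exact: measurable_funTS.
pose h (t : R) : \bar R := f t * (t < 0)%R%:R%:E.
have mh : measurable_fun setT h by rewrite /h; mf.
have h0 t : 0 <= h t by rewrite mule_ge0// lee_fin ler0n.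
have -> : \int[leb]_(t in `]0%R, +oo[) f (- t)%R = \int[leb]_t h t.
  have N10 : (-1 != 0 :> R)%R by rewrite oppr_eq0 oner_neq0.
  have := integral_scaleR N10 mh h0.
  rewrite normrN normr1 invr1 mul1e => <-.
  rewrite (mkindic `]0%R, +oo[); apply: eq_integral => t _.
  by rewrite /h mulN1r oppr_lt0 indicE mem_setE in_itv/= andbT.
rewrite (mkindic `]0%R, +oo[) -ge0_integralD//; last 2 first.
- by move=> t _; rewrite mule_ge0// lee_fin.
- by apply: emeasurable_funM => //; apply: mfun_EFin; exact: measurable_indic.
rewrite [LHS]integral_mkcond; apply: eq_integral => t _.
rewrite patchE /h indicE mem_setE in_itv/= andbT.
have [->|t0] := eqVneq t 0%R.
  by rewrite ltxx !mule0 adde0 memNset//= => -[_]; exact.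
rewrite mem_set; last by split => //= /eqP; exact/negP.
case: (ltgtP t 0%R) t0 => // _ _; first by rewrite mule0 mule1 add0e.
by rewrite mule0 mule1 adde0.
Qed.

(** The index is shifted by two: (k-1)/2 is (n-3)/2 for n = k + 2, and q stands for (n + sp)/2. *)
Definition Psi0 (k : nat) (q r : R) : \bar R :=
  \int[leb]_(t in `](-1)%R, 1%R[)
    ((1 - 2 * t * r + r ^+ 2) `^ (- q) * (1 - t ^+ 2) `^ ((k%:R - 1) / 2))%:E.

(* [Phi k.+1] with values in [\bar R], and meaningful for every [r > 0]. *)
Definition Psi (k : nat) (q r : R) : \bar R :=
  if k is k'.+1 then (sphere_area R k)%:E * Psi0 k' q r
  else (`|1 - r| `^ (- (2 * q)) + `|1 + r| `^ (- (2 * q)))%:E.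

Lemma Psi0_ge0 k q r : 0 <= Psi0 k q r.
Proof. by apply: integral_ge0 => x _; rewrite lee_fin mulr_ge0 ?powR_ge0. Qed.

Lemma measurable_Psi0 k q : measurable_fun setT (Psi0 k q).
Proof.
pose f (r t : R) : \bar R :=
  ((1 - 2 * t * r + r ^+ 2) `^ (- q) * (1 - t ^+ 2) `^ ((k%:R - 1) / 2))%:E * (\1_(`](-1)%R, 1%R[) t)%:E.
rewrite (_ : Psi0 k q = fun r => \int[leb]_t f r t); last first.
  by apply/funext => r; rewrite /Psi0 (mkindic `](-1)%R, 1%R[).
apply: (@mfun_int R _ _ _ _ leb f).
  apply: emeasurable_funM; first by mf.
  apply: mfun_EFin; apply: (measurableT_comp _ measurable_snd).
  exact: measurable_indic.
by move=> r t; rewrite mule_ge0// lee_fin mulr_ge0 ?powR_ge0.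
Qed.

(** The integral over R^(k+1) of g(|z|) |e - z|^(-2q), with e the first basis vector. Integrals in y
    at fixed x reduce to such a number, with 2q = k + 1 + sp. *)
Definition Jint k (q : R) (g : R -> R) : \bar R :=
  \int[L k.+1]_z (g (enorm z) * enorm (e0 R k - z)%R `^ (- (2 * q)))%:E.

Lemma enorm_powR n (x : 'rV[R]_n) (q : R) : (enorm x `^ (- (2 * q)) = dotv x x `^ (- q))%R.
Proof.
rewrite -sqr_enorm -[(enorm x ^+ 2)%R]powR_mulrn ?enorm_ge0// -powRrM.
by rewrite mulrN.
Qed.

Lemma Psi_ge0 k q r : 0 <= Psi k q r.
Proof.
case: k => [|k] /=; first by rewrite lee_fin addr_ge0 ?powR_ge0.
by rewrite mule_ge0 ?lee_fin ?sphere_area_ge0// Psi0_ge0.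
Qed.

Lemma measurable_Psi k q : measurable_fun setT (Psi k q).
Proof.
case: k => [|k] /=; first by mf.
by apply: emeasurable_funM => //; exact: measurable_Psi0.
Qed.

Lemma cosine_law_ge (r t : R) : (0 < r)%R -> (t < 1)%R ->
  ((1 - r) ^+ 2 <= 1 - 2 * t * r + r ^+ 2)%R.
Proof.
move=> r0 t1; rewrite -subr_ge0.
rewrite (_ : (_ - _ = 2 * r * (1 - t))%R); last by ring.
by rewrite !mulr_ge0 ?subr_ge0// ltW.
Qed.

(** For a unit vector w one has |e - w/r| = |e - r w| / r. *)
Lemma Psi_inv k (q r : R) : (0 < r)%R -> Psi k q r^-1%R = (r `^ (2 * q))%:E * Psi k q r.
Proof.
move=> r0; have rn0 : (r != 0)%R by rewrite gt_eqF.
case: k => [|k] /=.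
  rewrite -EFinM mulrDr; congr (_ + _)%:E.
    have -> : (1 - r^-1 = r^-1 * (- (1 - r)))%R by field.
    rewrite normrM normrN normfV (gtr0_norm r0) powRM ?invr_ge0 ?normr_ge0 ?(ltW r0)//.
    by rewrite -powR_inv1 ?(ltW r0)// -powRrM mulN1r opprK.
  have -> : (1 + r^-1 = r^-1 * (1 + r))%R by field.
  rewrite normrM normfV (gtr0_norm r0) powRM ?invr_ge0 ?normr_ge0 ?(ltW r0)//.
  by rewrite -powR_inv1 ?(ltW r0)// -powRrM mulN1r opprK.
rewrite muleCA; congr (_ * _); rewrite -ge0_integralZl//; last 3 first.
- by apply/measurable_funTS; mf.
- by move=> t _; rewrite lee_fin mulr_ge0 ?powR_ge0.
- by rewrite lee_fin powR_ge0.
apply: eq_integral => t /set_mem/=; rewrite in_itv/= => /andP[t1 t2].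
rewrite -EFinM mulrA; congr (_ * _)%:E.
have -> : (1 - 2 * t * r^-1 + r^-1 ^+ 2 = r `^ (-2) * (1 - 2 * t * r + r ^+ 2))%R.
  by rewrite powRN powR_mulrn ?(ltW r0)//; field.
rewrite powRM ?powR_ge0//; last first.
  exact: le_trans (sqr_ge0 _) (cosine_law_ge r0 t2).
by rewrite -powRrM mulrNN.
Qed.

(** For k = 0 the sphere is a pair of points and the line is folded at 0. Otherwise [integral_polar]
    applies, with the law of cosines for |e - z|^2. *)
Lemma Jint_Psi k (q : R) (g : R -> R) : measurable_fun setT g ->
  (forall r, (0 <= g r)%R) ->
  Jint k q g = \int[leb]_(r in `]0%R, +oo[) ((g r * r ^+ k)%:E * Psi k q r).
Proof.
move=> mg g0; rewrite /Jint; case: k => [|k].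
  rewrite integral_rVS'; last 2 first.
  - apply: mfun_EFin; apply: measurable_funM.
      by apply: (measurableT_comp mg); exact: mfun_enorm.
    by apply: mfun_powR; apply: mfun_enorm; mf.
  - by move=> z; rewrite lee_fin mulr_ge0 ?powR_ge0.
  rewrite integral_rV0; last by move=> z; apply: integral_ge0 => x _; rewrite lee_fin mulr_ge0 ?powR_ge0.
  pose f (t : R) : \bar R := (g `|t| * `|1 - t| `^ (- (2 * q)))%:E.
  have mf : measurable_fun setT f.
    by apply: mfun_EFin; apply: measurable_funM; [apply: (measurableT_comp mg)|]; mf.
  have f0 t : 0 <= f t by rewrite lee_fin mulr_ge0 ?powR_ge0.
  transitivity (\int[leb]_t f t).
    apply: eq_integral => t _; congr (g _ * _ `^ _)%:E.
      by rewrite enorm_cons/= enorm0 expr0n addr0 sqrtr_sqr.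
    rewrite /e0 -scaleN1r rV_consZ rV_consD/= scaler0 addr0 mulN1r.
    by rewrite enorm_cons/= enorm0 expr0n addr0 sqrtr_sqr.
  rewrite (integral_evenodd mf f0).
  apply: eq_integral => r /set_mem/=; rewrite in_itv/= andbT => r0.
  rewrite /f normrN (gtr0_norm r0) opprK -EFinM -EFinD expr0 mulr1.
  by rewrite -mulrDr.
pose F (r t : R) : R := (g r * (1 - 2 * t * r + r ^+ 2) `^ (- q))%R.
have mF : measurable_fun setT (fun p : R * R => F p.1 p.2).
  apply: measurable_funM; first exact: (measurableT_comp mg measurable_fst).
  by mf.
have F0 r t : (0 <= F r t)%R by rewrite mulr_ge0 ?powR_ge0.
transitivity (\int[L k.+2]_z (F (enorm z) (z ord0 ord0 / enorm z)%R)%:E).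
  apply: eq_integral => z _; rewrite /F; congr (_ * _)%:E.
  rewrite enorm_powR; congr (_ `^ _)%R.
  rewrite dotvBB dotv_cons/= dotv0 addr0 mulr1 -sqr_enorm.
  rewrite [dotv _ z](_ : _ = z ord0 ord0); last first.
    by rewrite (rV_consE z) dotv_cons/= mul1r dotvC dotv0 addr0 rV_cons0.
  have [z0|z0] := eqVneq (enorm z) 0%R; last by congr (1 - _ + _)%R; field.
  by move: (z0) => /eqP; rewrite enorm_eq0 => /eqP ->; rewrite mxE enorm0 !mulr0.
rewrite (integral_polar k mF F0) /Psi.
transitivity (\int[leb]_(r in `]0%R, +oo[) ((sphere_area R k.+1)%:E *
    ((g r * `|r| ^+ k.+1)%:E * Psi0 k q r))); last first.
  apply: eq_integral => r /set_mem/=; rewrite in_itv/= andbT => r0.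
  by rewrite gtr0_norm// muleCA.
rewrite ge0_integralZl//; last 3 first.
- apply/measurable_funTS/emeasurable_funM; last exact: measurable_Psi0.
  by mf.
- by move=> r _; rewrite mule_ge0 ?Psi0_ge0// lee_fin mulr_ge0.
- by rewrite lee_fin sphere_area_ge0.
congr (_ * _); apply: eq_integral => r /set_mem/=; rewrite in_itv/= andbT => r0.
rewrite /Psi0 -ge0_integralZl//; last 3 first.
- by apply/measurable_funTS; mf.
- by move=> t _; rewrite lee_fin mulr_ge0 ?powR_ge0.
- by rewrite lee_fin mulr_ge0.
apply: eq_integral => t _; rewrite /F gtr0_norm// -EFinM; congr (_%:E); ring.
Qed.

Lemma integral_split1 (f : R -> \bar R) : measurable_fun setT f ->
  (forall x, 0 <= f x) ->
  \int[leb]_(r in `]0%R, +oo[) f r =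
  \int[leb]_(r in `]0%R, 1%R[) (f r + f (r^-1)%R * (r `^ (- 2)%R)%:E).
Proof.
move=> mf f0.
have mVf : measurable_fun setT (fun r : R => f (r^-1)%R * (r `^ (- 2)%R)%:E).
  apply: emeasurable_funM; last by mf.
  by apply: (measurableT_comp mf); apply: (@mfun_inv _ _ R id); mf.
rewrite ge0_integralD//; last 3 first.
- exact: measurable_funTS.
- by move=> x _; rewrite mule_ge0// lee_fin powR_ge0.
- exact: measurable_funTS.
rewrite -(integral_inversion mf f0).
rewrite (_ : `]0%R, +oo[%classic = `]0%R, 1%R[%classic `|` `[1%R, +oo[%classic :> set R); last first.
  by rewrite -itv_bndbnd_setU// bnd_simp.
rewrite ge0_integral_setU//; last 2 first.
- exact: measurable_funTS.
- apply/disj_setPS => x [] /=; rewrite !in_itv/= andbT => /andP[_ x1].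
  by rewrite leNgt x1.
congr (_ + _).
rewrite -(lebRE (D := `[1%R, +oo[))//; last exact: measurable_funTS.
rewrite -integral_itv_obnd_cbnd; last exact: measurable_funTS.
by rewrite lebRE//; exact: measurable_funTS.
Qed.

(** The half-line r > 1 is folded onto ]0, 1[ by r -> 1/r, and [Psi_inv] brings the kernel back to
    r. *)
Lemma Jint01 k (q : R) (g : R -> R) : measurable_fun setT g ->
  (forall r, (0 <= g r)%R) ->
  Jint k q g = \int[leb]_(r in `]0%R, 1%R[)
    ((g r * r ^+ k + g r^-1 * r `^ (2 * q - k%:R - 2))%:E * Psi k q r).
Proof.
move=> mg g0; rewrite (Jint_Psi k q mg g0).
transitivity (\int[leb]_(r in `]0%R, +oo[) ((g r * `|r| ^+ k)%:E * Psi k q r)).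
  apply: eq_integral => r /set_mem/=; rewrite in_itv/= andbT => r0.
  by rewrite gtr0_norm.
rewrite (@integral_split1 (fun r => (g r * `|r| ^+ k)%:E * Psi k q r)); last 2 first.
- by apply: emeasurable_funM; [mf|exact: measurable_Psi].
- by move=> r; rewrite mule_ge0 ?Psi_ge0// lee_fin mulr_ge0.
apply: eq_integral => r /set_mem/=; rewrite in_itv/= => /andP[r0 r1].
rewrite (Psi_inv k q r0) EFinD ge0_muleDl ?lee_fin; last 2 first.
- by rewrite mulr_ge0// exprn_ge0// ltW.
- by rewrite mulr_ge0// powR_ge0.
rewrite (gtr0_norm r0) gtr0_norm ?invr_gt0//.
congr (_ + _); rewrite -!muleA [Psi _ _ _ * _]muleC !muleA; congr (_ * _).
rewrite -!EFinM; congr (_%:E); rewrite -!mulrA; congr (_ * _)%R.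
rewrite -powR_mulrn ?invr_ge0 ?ltW// -[(r^-1)%R]powR_inv1 ?ltW// -powRrM.
rewrite -!powRD ?(gt_eqF r0) ?implybT//.
by congr (_ `^ _)%R; ring.
Qed.

End kernel_integral.

(** * Identification of the constant C_1 *)

Section constant.
Context (R : realType).
Notation leb := (@lebR R).
Notation L := (lebesgue_rV R).

(** Otherwise radial integration would give the whole space measure 0, whereas the unit cube has
    measure 1. *)
Lemma sphere_area_gt0 n : 0 < sphere_area R n.+1.
Proof.
rewrite lt_neqAle sphere_area_ge0 andbT; apply/eqP => S0.
have H := @integral_radial R n (fun=> 1%E) (measurable_cst 1%E) (fun=> lee01).
have : (1%:E <= \int[L n.+1]_z 1)%E.
  rewrite integral_cst// mul1e.
  pose B : set 'rV[R]_n.+1 := [set v | forall i, `[0%R, 1%R]%classic (v ord0 i)].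
  have mB : measurable B by apply: (@measurable_rV_box R n.+1 (fun=> `[0%R, 1%R]%classic)).
  apply: (@le_trans _ _ (L n.+1 B)); last first.
    by apply: le_measure; [exact: (mem_set mB)|exact: (mem_set measurableT)|].
  rewrite (@lebesgue_rV_box R n.+1 (fun=> `[0%R, 1%R]%classic))//.
  under eq_bigr do rewrite lebesgue_measure_itv/= lte_fin ltr01 -EFinB subr0.
  by rewrite prodEFin big1.
by rewrite H -S0 mul0e lee_fin ler10.
Qed.

(** Read off the polar formula for the unit ball: an infinite angular integral would make its volume
    infinite. For k = 0 the integrand is unbounded, and the same argument applies. *)
Lemma sin_int_fin k :
  (\int[leb]_(t in `](-1)%R, 1%R[) ((1 - t ^+ 2) `^ ((k%:R - 1) / 2))%:E < +oo)%E.
Proof.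
pose F (r t : R) : R := ((0 < r) && (r <= 1))%:R.
have mF : measurable_fun setT (fun p : R * R => F p.1 p.2) by rewrite /F; mf.
have F0 r t : 0 <= F r t by exact: ler0n.
have H := @integral_polar R k F mF F0.
have Hfin : (\int[L k.+2]_z (F (enorm z) (z ord0 ord0 / enorm z))%:E < +oo)%E.
  rewrite (_ : (\int[L k.+2]_z _)%E = L k.+2 (@pball R k.+2)) ?pball_fin//.
  rewrite -[in RHS](setIT (@pball R k.+2)) -(integral_indic (L k.+2) measurableT (@measurable_pball R k.+2)).
  apply: eq_integral => z _; rewrite /F indicE; congr ((nat_of_bool _)%:R%:E).
  by apply/idP/idP; [move=> h; exact/mem_set|move/set_mem].
rewrite H in Hfin; set T := (\int[leb]_(t in _) _)%E.
have T0 : (0 <= T)%E by apply: integral_ge0 => t _; rewrite lee_fin powR_ge0.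
rewrite ltNge leye_eq; apply/negP => /eqP Ty; move: Hfin; rewrite ltNge leye_eq => /negP; apply.
pose c := (\int[leb]_(r in `]0%R, 1%R[) (r ^+ k.+1)%:E)%E.
have c0 : (0 < c)%E.
  apply: integral_gt0 => //.
  - by apply/measurable_funTS; mf.
  - by move=> r /=; rewrite in_itv/= => /andP[r0 _]; rewrite lte_fin exprn_gt0.
  - have h : @lebR R `]0, 1[%classic = 1%E.
      by rewrite lebR_itv lebesgue_measure_itv/= lte_fin ltr01 -EFinB subr0.
    by rewrite (lt_le_trans (@lte01 R))// -h.
have Ig : (\int[leb]_(r in `]0%R, +oo[) \int[leb]_(t in `](-1)%R, 1%R[)
    (F r t * (1 - t ^+ 2) `^ ((k%:R - 1) / 2) * r ^+ k.+1)%:E = +oo)%E.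
  apply/eqP; rewrite -leye_eq.
  have -> : (+oo = c * T)%E by rewrite Ty gt0_muley.
  rewrite -ge0_integralZr//; last 2 first.
  - by apply/measurable_funTS; mf.
  - by move=> r /=; rewrite in_itv/= => /andP[r0 _]; rewrite lee_fin exprn_ge0// ltW.
  have mtot : measurable_fun setT (fun r => \int[leb]_(t in `](-1)%R, 1%R[)
      (F r t * (1 - t ^+ 2) `^ ((k%:R - 1) / 2) * r ^+ k.+1)%:E)%E.
    rewrite (_ : (fun r => _) = (fun r => \int[leb]_t ((F r t * (1 - t ^+ 2) `^ ((k%:R - 1) / 2) * r ^+ k.+1)%:E *
      (\1_(`](-1)%R, 1%R[) t)%:E))%E); last by apply/funext => r; rewrite (mkindic `](-1)%R, 1%R[).
    apply: (@mfun_int R _ _ _ _ leb (fun r t => ((F r t * (1 - t ^+ 2) `^ ((k%:R - 1) / 2) * r ^+ k.+1)%:E *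
      (\1_(`](-1)%R, 1%R[) t)%:E)%E)).
      apply: emeasurable_funM; first by rewrite /F; mf.
      apply: mfun_EFin; apply: (measurableT_comp _ measurable_snd).
      exact: measurable_indic.
    move=> r t; rewrite mule_ge0// lee_fin mulrAC mulr_ge0 ?powR_ge0//.
    rewrite /F; have [r0|] := ltP 0 r; last by rewrite mul0r.
    by rewrite mulr_ge0 ?ler0n// exprn_ge0// ltW.
  apply: (@le_trans _ _ (\int[leb]_(r in `]0%R, 1%R[) \int[leb]_(t in `](-1)%R, 1%R[)
    (F r t * (1 - t ^+ 2) `^ ((k%:R - 1) / 2) * r ^+ k.+1)%:E)%E).
    rewrite le_eqVlt; apply/orP; left; apply/eqP; apply: eq_integral => r /set_mem/=.
    rewrite in_itv/= => /andP[r0 r1].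
    rewrite -ge0_integralZl//; last 3 first.
    - by apply/measurable_funTS; mf.
    - by move=> t _; rewrite lee_fin powR_ge0.
    - by rewrite lee_fin exprn_ge0// ltW.
    apply: eq_integral => t _; rewrite /F r0 (ltW r1)/= mul1r -EFinM mulrC//.
  apply: ge0_subset_integral => //.
  - exact: measurable_funTS.
  - move=> r /=; rewrite in_itv/= andbT => r0; apply: integral_ge0 => t _.
    by rewrite lee_fin !mulr_ge0 ?powR_ge0// exprn_ge0// ltW.
  - by move=> r /=; rewrite !in_itv/= => /andP[-> _].
by rewrite Ig gt0_muley// lte_fin sphere_area_gt0.
Qed.

Lemma Psi_fin k (q r : R) : 0 <= q -> 0 < r < 1 -> (Psi k q r < +oo)%E.
Proof.
move=> q0 /andP[r0 r1]; case: k => [|k] /=; first exact: ltry.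
rewrite lte_mul_pinfty ?lee_fin ?sphere_area_ge0//.
apply: (@le_lt_trans _ _ ((((1 - r) ^+ 2) `^ (- q))%:E *
   \int[leb]_(t in `](-1)%R, 1%R[) ((1 - t ^+ 2) `^ ((k%:R - 1) / 2))%:E)%E); last first.
  by rewrite lte_mul_pinfty ?lee_fin ?powR_ge0// sin_int_fin.
rewrite -ge0_integralZl//; last 3 first.
- by apply/measurable_funTS; mf.
- by move=> t _; rewrite lee_fin powR_ge0.
- by rewrite lee_fin powR_ge0.
apply: ge0_le_integral => //.
- by move=> t _; rewrite lee_fin mulr_ge0 ?powR_ge0.
- by apply/measurable_funTS; mf.
- by apply/measurable_funTS; mf.
- move=> t /=; rewrite in_itv/= => /andP[t1 t2].
  rewrite -EFinM lee_fin ler_wpM2r ?powR_ge0//.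
  have p1 : 0 < (1 - r) ^+ 2 by rewrite exprn_gt0// subr_gt0.
  have c1 := cosine_law_ge r0 t2.
  rewrite !powRN lef_pV2 ?posrE ?powR_gt0//; last exact: lt_le_trans c1.
  by apply: ge0_ler_powR => //; rewrite nnegrE ltW//; exact: lt_le_trans c1.
Qed.

Lemma PhiE k (s p r : R) : 0 <= s * p -> 0 < r < 1 ->
  (Phi k.+1 s p r)%:E = Psi k ((k.+1%:R + s * p) / 2) r.
Proof.
move=> sp0 r01; have q0 : 0 <= (k.+1%:R + s * p) / 2 by rewrite divr_ge0// addr_ge0.
have := Psi_fin k q0 r01; have := Psi_ge0 k ((k.+1%:R + s * p) / 2) r.
move: r01 => /andP[r0 r1]; case: k q0 => [|k] q0 P0 Pfin.
  rewrite /Phi/=; congr (_ + _)%:E.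
    rewrite ger0_norm ?subr_ge0 ?ltW//; congr (_ `^ _); by field.
  rewrite ger0_norm ?addr_ge0 ?ltW//; congr (_ `^ _); by field.
have Sn0 := sphere_area_gt0 k.
have I0 := Psi0_ge0 k ((k.+2%:R + s * p) / 2) r.
have Ifin : Psi0 k ((k.+2%:R + s * p) / 2) r \is a fin_num.
  rewrite ge0_fin_numE// ltNge leye_eq; apply/negP => /eqP Iy.
  by move: Pfin; rewrite /= Iy gt0_muley ?lte_fin// ltxx.
rewrite /Phi/= EFinM; congr (_ * _)%E; rewrite -[RHS]fineK//; congr (_%:E).
rewrite /Rintegral lebRE//; last 2 first.
- by apply/measurable_funTS; mf.
- move=> t _; rewrite lee_fin mulr_ge0 ?powR_ge0// invr_ge0 powR_ge0//.
congr fine; rewrite /Psi0; apply: eq_integral => t _.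
rewrite powRN [in RHS]mulrC; congr (_ `^ _ / _)%:E.
by rewrite -[k.+2]addn2 natrD; field.
Qed.

(** With r = |y_k|/|x_k| and the ground state w = |x_k|^(-g), this is |w(x) - w(y)|^p / w(x)^p times
    the factor r^b coming from the weights. *)
Definition hgt (g p b r : R) : R := `|1 - r `^ (- g)| `^ p * r `^ b.

Definition hardyw (t p a b g r : R) : R :=
  r `^ (t - 1) * (r `^ (- a) + r `^ (- b)) * `|1 - r `^ g| `^ p.

Lemma hardy_C1E k (s p a b : R) : 0 <= s * p ->
  hardy_C1 k.+1 s p a b = fine (\int[leb]_(r in `]0%R, 1%R[)
    ((hardyw (s * p) p a b ((k.+1%:R + a + b - s * p) / p) r)%:E *
     Psi k ((k.+1%:R + s * p) / 2) r))%E.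
Proof.
move=> sp0; rewrite /hardy_C1 /Rintegral.
have e r : r \in `]0%R, 1%R[%classic -> ((hardyw (s * p) p a b ((k.+1%:R + a + b - s * p) / p) r)%:E *
     Psi k ((k.+1%:R + s * p) / 2) r)%E =
    (r `^ (s * p - 1) * (r `^ (- a) + r `^ (- b)) *
      `|1 - r `^ ((k.+1%:R + a + b - s * p) / p)| `^ p * Phi k.+1 s p r)%:E.
  by move=> /set_mem/=; rewrite in_itv/= => r01; rewrite -PhiE.
rewrite lebRE//; first by congr fine; apply: eq_integral => r rI; rewrite -e.
- apply: (eq_measurable_fun (fun r => (hardyw (s * p) p a b ((k.+1%:R + a + b - s * p) / p) r)%:E *
     Psi k ((k.+1%:R + s * p) / 2) r)%E); first exact: e.
  apply/measurable_funTS/emeasurable_funM; last exact: measurable_Psi.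
  by rewrite /hardyw; mf.
- move=> r /mem_set rI; rewrite -e// mule_ge0 ?Psi_ge0// lee_fin.
  by rewrite !mulr_ge0 ?addr_ge0 ?powR_ge0.
Qed.

(** The point r contributes the term r^(-a) of the integrand of C_1 and the point 1/r the term
    r^(-b): the value of g p turns -g p + b + k into t - 1 - a. *)
Lemma hgt_pair (k : nat) (t p a b g r : R) : 0 < p -> g * p = k.+1%:R + a + b - t -> 0 < r ->
  hgt g p b r * r ^+ k + hgt g p b r^-1 * r `^ (k.+1%:R + t - k%:R - 2) = hardyw t p a b g r.
Proof.
move=> p0 gp r0; rewrite /hgt /hardyw.
have rE x : r^-1 `^ x = r `^ (- x).
  by rewrite -powR_inv1 ?ltW// -powRrM mulN1r.
rewrite !rE opprK.
have -> : 1 - r `^ (- g) = r `^ (- g) * (r `^ g - 1).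
  by rewrite mulrBr mulr1 -powRD ?addNr ?powRr0// (gt_eqF r0) implybT.
rewrite normrM distrC (ger0_norm (powR_ge0 _ _)) powRM ?powR_ge0// -powRrM.
rewrite -[r ^+ k]powR_mulrn ?ltW//.
set X := `|_| `^ p; transitivity (X * (r `^ (- g * p) * r `^ b * r `^ k%:R +
   r `^ (- b) * r `^ (k.+1%:R + t - k%:R - 2))); first by ring.
rewrite -!powRD ?(gt_eqF r0) ?implybT// mulrC mulrDr -!powRD ?(gt_eqF r0) ?implybT//.
congr (_ * _); congr (_ + _); congr (_ `^ _).
  by rewrite mulNr gp -[k.+1%:R]natr1; ring.
by rewrite -[k.+1%:R]natr1; ring.
Qed.

Lemma hardyw_Jint (k : nat) (t p a b g : R) : 0 < p -> g * p = k.+1%:R + a + b - t ->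
  Jint k ((k.+1%:R + t) / 2) (hgt g p b) = (\int[leb]_(r in `]0%R, 1%R[)
    ((hardyw t p a b g r)%:E * Psi k ((k.+1%:R + t) / 2) r))%E.
Proof.
move=> p0 gp; rewrite Jint01; last 2 first.
- by rewrite /hgt; mf.
- by move=> r; rewrite mulr_ge0 ?powR_ge0.
apply: eq_integral => r /set_mem/=; rewrite in_itv/= => /andP[r0 r1].
rewrite -(hgt_pair p0 gp r0); congr ((_ + _ * _ `^ _)%:E * _)%E.
by field.
Qed.

End constant.

(** * Reduction of the kernel to the singular coordinates *)

Lemma mfun_enormk d (T : measurableType d) (R : realType) k n (f : T -> 'rV[R]_n) :
  measurable_fun setT f -> measurable_fun setT (fun x => enormk k (f x)).
Proof.
move=> mf; rewrite /enormk; apply: mfun_sqrt.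
apply: (eq_measurable_fun (fun x => \sum_(i < n) (f x ord0 i ^+ 2 * (i < k)%N%:R))); last by mf.
move=> x _; rewrite [RHS]big_mkcond; apply: eq_bigr => i _.
by case: ifP; rewrite ?mulr1 ?mulr0.
Qed.

Lemma mfun_subv d (T : measurableType d) (R : realType) n (f g : T -> 'rV[R]_n) :
  measurable_fun setT f -> measurable_fun setT g ->
  measurable_fun setT (fun x => f x - g x).
Proof. by move=> mf mg; apply: measurable_fun_rV => i /=; under eq_fun do rewrite !mxE; mf. Qed.

Ltac mfv := repeat first
  [ assumption | exact: measurable_cst | apply: mfun_enormk | apply: mfun_enorm | apply: mfun_row_mx | apply: mfun_subv
  | match goal with |- measurable_fun _ (fun x => ?g (@?h x)) => is_var g;
      match goal with H : measurable_fun _ g |- _ => apply: (measurableT_comp H) end end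
  | mf1 ].

Section kernel_split.
Context (R : realType).
Notation leb := (@lebR R).
Notation L := (lebesgue_rV R).

Lemma enormk_row_mx k m (a : 'rV[R]_k) (b : 'rV[R]_m) : enormk k (row_mx a b) = enorm a.
Proof.
congr Num.sqrt; rewrite big_split_ord/= [X in _ + X]big1 ?addr0; last first.
  by move=> i; rewrite ltnNge leq_addr.
by apply: eq_big => [i|i _]; rewrite ?ltn_ord// row_mxEl.
Qed.

Lemma sqr_enorm_row_mx k m (a : 'rV[R]_k) (b : 'rV[R]_m) :
  enorm (row_mx a b) ^+ 2 = enorm a ^+ 2 + enorm b ^+ 2.
Proof.
rewrite !sqr_enorm /dotv big_split_ord/=.
by congr (_ + _); apply: eq_bigr => i _; rewrite ?row_mxEl ?row_mxEr.
Qed.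

Lemma powR_sqr (x q : R) : 0 <= x -> (x ^+ 2) `^ (- (q / 2)) = x `^ (- q).
Proof.
by move=> x0; rewrite -[x ^+ 2]powR_mulrn// -powRrM; congr (_ `^ _); field.
Qed.

(** After a translation by b this is [integral_bessel] with A = |a - a'|^2. *)
Lemma integral_fiber k m (a a' : 'rV[R]_k) (b : 'rV[R]_m) (q : R) :
  0 < q -> a' != a ->
  (\int[L m]_b' (enorm (row_mx a b - row_mx a' b') `^ (- (q + m%:R)))%:E =
   (gconst m q * enorm (a - a') `^ (- q))%:E)%E.
Proof.
move=> q0 aa'.
have A0 : 0 < enorm (a - a') ^+ 2.
  by rewrite exprn_gt0// enorm_gt0 subr_eq0 eq_sym.
rewrite -powR_sqr ?enorm_ge0// -(integral_bessel m A0 q0).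
rewrite -(@integral_shift_rV R m (- b) (fun z => ((enorm (a - a') ^+ 2 + enorm z ^+ 2) `^ (- ((q + m%:R) / 2)))%:E)); last 2 first.
- by mfv.
- by move=> x; rewrite lee_fin powR_ge0.
apply: eq_integral => b' _; rewrite -powR_sqr ?enorm_ge0//.
by rewrite opp_row_mx add_row_mx sqr_enorm_row_mx [enorm (b - b')]enormB.
Qed.

(** Rotate a onto the first axis, then dilate by |a|. *)
Lemma integral_rescale k (a : 'rV[R]_k.+1) (g : R -> R -> R) : a != 0 ->
  measurable_fun setT (fun z : R * R => g z.1 z.2) -> (forall r t, 0 <= g r t) ->
  (\int[L k.+1]_y (g (enorm y / enorm a) (enorm (a - y) / enorm a))%:E =
   (enorm a ^+ k.+1)%:E * \int[L k.+1]_z (g (enorm z) (enorm (e0 R k - z)))%:E)%E.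
Proof.
move=> a0 mg g0.
have na : 0 < enorm a by rewrite enorm_gt0.
have [T [mT iT nT dT]] := rotation a0.
have mg2 d (X : measurableType d) (f h : X -> R) : measurable_fun setT f -> measurable_fun setT h ->
   measurable_fun setT (fun x => (g (f x) (h x))%:E).
  move=> mf mh; apply: mfun_EFin.
  exact: (measurableT_comp mg (measurable_fun_pair mf mh)).
rewrite -[LHS]iT; last 2 first.
- by apply: mg2; apply: measurable_funM => //; apply: mfun_enorm; mf.
- by move=> x; rewrite lee_fin.
transitivity (\int[L k.+1]_y (g (enorm y / enorm a) (enorm (enorm a *: e0 R k - y) / enorm a))%:E)%E.
  by apply: eq_integral => y _; rewrite nT dT.
have cn : enorm a != 0 by rewrite gt_eqF.
pose f (y : 'rV[R]_k.+1) := (g (enorm y / enorm a) (enorm (enorm a *: e0 R k - y) / enorm a))%:E.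
have mf : measurable_fun setT f.
  by apply: mg2; apply: measurable_funM => //; apply: mfun_enorm; mf.
have H := integral_scale_rV cn mf (fun y => g0 _ _).
rewrite -/(f _) (_ : (\int[L k.+1]_z (g (enorm z) (enorm (e0 R k - z)))%:E)%E =
  (\int[L k.+1]_z f (enorm a *: z))%E); last first.
  apply: eq_integral => z _; rewrite /f -scalerBr !enormZ (gtr0_norm na).
  by rewrite ![enorm a * _]mulrC !mulfK.
rewrite H muleA -EFinM (gtr0_norm na) divff ?mul1e//.
by rewrite gt_eqF// exprn_gt0.
Qed.

Lemma integral_kernel k m (a : 'rV[R]_k.+1) (b : 'rV[R]_m) (t : R) (g : R -> R) :
  0 < t -> a != 0 -> measurable_fun setT g -> (forall r, 0 <= g r) ->
  (\int[L (k.+1 + m)]_y (g (enormk k.+1 y / enorm a) *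
      enorm (row_mx a b - y) `^ (- ((k.+1 + m)%:R + t)))%:E =
   (gconst m (k.+1%:R + t) * enorm a `^ (- t))%:E * Jint k ((k.+1%:R + t) / 2) g)%E.
Proof.
move=> t0 a0 mg g0.
have na : 0 < enorm a by rewrite enorm_gt0.
have q0 : 0 < k.+1%:R + t by rewrite addr_gt0.
have -> : (k.+1 + m)%:R + t = (k.+1%:R + t) + m%:R :> R by rewrite natrD; ring.
have c0 : 0 <= gconst m (k.+1%:R + t).
  rewrite /gconst divr_ge0 ?mulr_ge0 ?powR_ge0// ltW// gamma_gt0// divr_gt0//.
  by rewrite ltr_wpDr.
rewrite integral_rV_split; last 2 first.
- by mfv.
- by move=> x; rewrite lee_fin mulr_ge0 ?powR_ge0.
pose h (a' : 'rV[R]_k.+1) : R := g (enorm a' / enorm a) * (gconst m (k.+1%:R + t) * enorm (a - a') `^ (- (k.+1%:R + t))).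
have mh : measurable_fun setT h.
  by rewrite /h; mfv.
have h0 a' : 0 <= h a' by rewrite /h mulr_ge0// mulr_ge0 ?powR_ge0.
transitivity (\int[L k.+1]_a' (h a')%:E)%E.
  (* The fibre a' = a, to which [integral_fiber] does not apply, is removed as a null set. *)
  rewrite (integral_neq a (mfun_EFin mh) (fun x => h0 x)).
  rewrite (@integral_neq R k a); last 2 first.
  - apply: (@mfun_int R _ _ _ _ (L m) (fun a' b' => (g (enormk k.+1 (row_mx a' b') / enorm a) *
      enorm (row_mx a b - row_mx a' b') `^ (- (k.+1%:R + t + m%:R)))%:E)).
      by mfv.
    by move=> a' b'; rewrite lee_fin mulr_ge0 ?powR_ge0.
  - by move=> a'; apply: integral_ge0 => b' _; rewrite lee_fin mulr_ge0 ?powR_ge0.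
  apply: eq_integral => a' _; have [->|aa'] := eqVneq a' a; first by rewrite !mule0.
  rewrite !mule1 /h EFinM -(integral_fiber b q0 aa') -ge0_integralZl//; last 3 first.
  - by mfv.
  - by move=> b' _; rewrite lee_fin powR_ge0.
  - by rewrite lee_fin.
  by apply: eq_integral => b' _; rewrite enormk_row_mx.
pose G (r x : R) := g r * (gconst m (k.+1%:R + t) * enorm a `^ (- (k.+1%:R + t))) * x `^ (- (k.+1%:R + t)).
have mG : measurable_fun setT (fun z : R * R => G z.1 z.2).
  by rewrite /G; mfv.
have G0 r x : 0 <= G r x by rewrite /G mulr_ge0 ?powR_ge0// mulr_ge0// mulr_ge0 ?powR_ge0.
have := integral_rescale a0 mG G0.
rewrite (_ : (\int[L k.+1]_y _)%E = (\int[L k.+1]_a' (h a')%:E)%E); last first.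
  apply: eq_integral => a' _; rewrite /G /h; congr (_%:E).
  rewrite -(mulrA (g _)) -(mulrA (gconst _ _)); congr (_ * (_ * _)).
  rewrite -powRM ?divr_ge0 ?enorm_ge0//; congr (_ `^ _); field.
  by rewrite gt_eqF.
move=> ->; rewrite /Jint.
pose c := gconst m (k.+1%:R + t) * enorm a `^ (- (k.+1%:R + t)).
rewrite (_ : (\int[L k.+1]_z _)%E = (c%:E * \int[L k.+1]_z (g (enorm z) *
   enorm (e0 R k - z) `^ (- (2 * ((k.+1%:R + t) / 2))))%:E)%E); last first.
  rewrite -integralZ; last 3 first.
  - by mfv.
  - by move=> x; rewrite mulr_ge0 ?powR_ge0.
  - by rewrite /c mulr_ge0 ?powR_ge0.
  apply: eq_integral => z _; rewrite /G /c; congr (_%:E).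
  rewrite (_ : - (2 * _) = - (k.+1%:R + t)); last by field.
  by move: (gconst _ _) => x; ring.
rewrite muleA -EFinM; congr (_%:E * _)%E; rewrite /c.
move: (gconst _ _) => x; rewrite mulrCA; congr (_ * _); rewrite -powR_mulrn ?ltW// -powRD; last by rewrite (gt_eqF na) implybT.
by congr (_ `^ _); ring.
Qed.

End kernel_split.

(** * Elementary inequalities for powers and logarithms *)

Section real_inequalities.
Context (R : realType).
Implicit Types x y r e g a b p : R.

Lemma ler_ln_sub1 x : 0 < x -> ln x <= x - 1.
Proof. by move=> x0; have := @le_ln1Dx R (x - 1); rewrite addrCA subrr addr0; apply; lra. Qed.

(** From ln x <= x - 1 at x and at 1/x. *)
Lemma normB1_le_ln x : 0 < x -> `|1 - x| <= (1 + x) * `|ln x|.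
Proof.
move=> x0; have h1 := ler_ln_sub1 x0.
have h2 : - ln x <= x^-1 - 1 by rewrite -lnV ?posrE// ler_ln_sub1// invr_gt0.
have h3 : x * x^-1 = 1 by rewrite divff// gt_eqF.
have [x1|x1] := leP 1 x.
  rewrite (ger0_norm (ln_ge0 x1)) distrC ger0_norm ?subr_ge0//.
  have := ln_ge0 x1; nra.
rewrite (ler0_norm (ln_le0 (ltW x1))) ger0_norm; last by rewrite subr_ge0 ltW.
have := ln_le0 (ltW x1); nra.
Qed.

(** Records first order vanishing near a point without imposing growth away from it. *)
Definition min1 x := Num.min 1 `|x|.

Lemma min1_ge0 x : 0 <= min1 x.
Proof. by rewrite /min1 le_min ler01 normr_ge0. Qed.

Lemma min1_le1 x : min1 x <= 1.
Proof. by rewrite /min1 ge_min lexx. Qed.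

Lemma min1_mono x y : `|x| <= `|y| -> min1 x <= min1 y.
Proof. by move=> xy; rewrite /min1 le_min ge_min lexx/= ge_min xy orbT. Qed.

Lemma norm_ln_le_near r : 2^-1 <= r -> `|ln r| <= 2 * `|1 - r|.
Proof.
move=> r2; have r0 : 0 < r by lra.
have h1 := ler_ln_sub1 r0.
have h2 : - ln r <= r^-1 - 1 by rewrite -lnV ?posrE// ler_ln_sub1// invr_gt0.
have h3 : r^-1 <= 2 by rewrite -[leRHS]invrK lef_pV2 ?posrE.
have h4 : r * r^-1 = 1 by rewrite divff// gt_eqF.
have [x1|x1] := leP 1 r.
  by rewrite (ger0_norm (ln_ge0 x1)) distrC ger0_norm ?subr_ge0//; lra.
rewrite (ler0_norm (ln_le0 (ltW x1))) ger0_norm; last by rewrite subr_ge0 ltW.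
nra.
Qed.

Lemma powR_pair_ge1 r e : 0 < r -> 1 <= r `^ e + r `^ (- e).
Proof.
move=> r0; rewrite powRN; have := powR_gt0 e r0; move: (r `^ e) => x x0.
have : x * x^-1 = 1 by rewrite divff// gt_eqF.
have := invr_gt0 x; rewrite x0 => /idP; nra.
Qed.

Lemma norm_ln_le_powR r e : 0 < e -> 0 < r -> `|ln r| <= e^-1 * (r `^ e + r `^ (- e)).
Proof.
move=> e0 r0; have h x : 0 < x -> ln x <= e^-1 * x `^ e.
  move=> x0; have := ln_sublinear (powR_gt0 e x0); rewrite ln_powR => /ltW.
  by rewrite -ler_pdivlMl.
have p1 := powR_ge0 r e; have p2 := powR_ge0 r (- e).
have e1 : 0 <= e^-1 by rewrite invr_ge0 ltW.
rewrite ler_norml; apply/andP; split.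
  rewrite lerNl -lnV ?posrE//; apply: (le_trans (h _ _)); first by rewrite invr_gt0.
  apply: ler_wpM2l => //; rewrite -[X in X `^ _]powR_inv1 ?(ltW r0)//.
  by rewrite -powRrM mulN1r lerDr.
by apply: (le_trans (h _ _)) => //; rewrite ler_wpM2l// lerDl.
Qed.

(** Near r = 1 the logarithm is linear in 1 - r; elsewhere any small power r^e + r^(-e) dominates
    it. *)
Lemma norm_ln_le_min1 r e : 0 < e -> 0 < r ->
  `|ln r| <= (2 + 2 * e^-1) * (r `^ e + r `^ (- e)) * min1 (1 - r).
Proof.
move=> e0 r0; have h := powR_pair_ge1 e r0; have l := norm_ln_le_powR e0 r0.
have ei : 0 < e^-1 by rewrite invr_gt0.
set S := r `^ e + r `^ (- e) in h l *.
have [r2|r2] := leP 2^-1 r.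
  have n := norm_ln_le_near r2.
  rewrite /min1 minElt; case: ifP => _; rewrite ?mulr1.
    apply: (le_trans l); nra.
  apply: (le_trans n); rewrite ler_wpM2r//; nra.
have m : 2^-1 <= min1 (1 - r).
  by rewrite /min1 le_min ger0_norm; lra.
have P : 0 <= e^-1 * S by rewrite mulr_ge0// ltW//; lra.
apply: (le_trans l); move: (min1 _) m => M m.
apply: (@le_trans _ _ (2 * (e^-1 * S) * M)); first by nra.
rewrite ler_wpM2r; [lra| |lra]; lra.
Qed.

Lemma powR_le1 x p : 0 <= p -> 0 <= x <= 1 -> x `^ p <= 1.
Proof.
move=> p0 /andP[x0 x1]; have := @ge0_ler_powR R p p0 x 1.
by rewrite !nnegrE powR1 => ->.
Qed.

Lemma powRD_le a b p : 0 <= a -> 0 <= b -> 0 <= p ->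
  (a + b) `^ p <= 2 `^ p * (a `^ p + b `^ p).
Proof.
wlog ab : a b / a <= b.
  move=> H a0 b0 p0; have [|/ltW] := leP a b; first by move=> ?; exact: H.
  by move=> ba; rewrite addrC [X in _ * X]addrC; exact: H.
move=> a0 b0 p0; apply: (@le_trans _ _ ((2 * b) `^ p)).
  by apply: ge0_ler_powR => //; rewrite ?nnegrE; lra.
by rewrite powRM// ler_wpM2l ?powR_ge0// lerDr powR_ge0.
Qed.

Lemma norm_powR_le_min1 r g : 0 < r ->
  `|1 - r `^ g| <= (2 + 2 * `|g|) * (1 + r `^ g) * min1 (1 - r).
Proof.
move=> r0; have x0 := powR_gt0 g r0; have l := normB1_le_ln x0.
rewrite ln_powR normrM in l; set x := r `^ g in x0 l *.
have n1 : `|1 - x| <= 1 + x by rewrite ler_norml; apply/andP; split; lra.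
have G0 := normr_ge0 g; pose G : R := `|g|; rewrite -/G in G0 l *.
have [r2|r2] := leP 2^-1 r.
  have n := norm_ln_le_near r2.
  rewrite /min1 minElt; case: ifP => _; rewrite ?mulr1; first by nra.
  apply: (le_trans l); apply: (@le_trans _ _ ((1 + x) * (G * (2 * `|1 - r|)))).
    apply: ler_wpM2l; first by lra.
    exact: ler_wpM2l.
  rewrite [leRHS]mulrAC -subr_ge0.
  rewrite (_ : _ - _ = 2 * `|1 - r| * (1 + x)); last by ring.
  by rewrite !mulr_ge0//; lra.
have m : 2^-1 <= min1 (1 - r).
  by rewrite /min1 le_min ger0_norm; lra.
apply: (le_trans n1); move: (min1 _) m => M m.
apply: (@le_trans _ _ (2 * (1 + x) * M)); first by nra.
rewrite ler_wpM2r; [nra| |nra]; lra.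
Qed.

End real_inequalities.

(** * Finiteness of the kernel integrals *)

Section kernel_finite.
Context (R : realType).
Notation leb := (@lebR R).
Notation L := (lebesgue_rV R).

(** Separate power laws inside and outside the unit ball, used as majorants at the origin and at
    infinity. *)
Definition rad (a b r : R) : R := r `^ a * (r < 1)%R%:R + r `^ b * (1 <= r)%R%:R.

Lemma rad_ge0 a b r : 0 <= rad a b r.
Proof. by rewrite addr_ge0 ?mulr_ge0 ?powR_ge0. Qed.

Lemma rad_lt1 a b r : r < 1 -> rad a b r = r `^ a.
Proof. by move=> r1; rewrite /rad r1 leNgt r1 mulr1 mulr0 addr0. Qed.

Lemma rad_ge1 a b r : 1 <= r -> rad a b r = r `^ b.
Proof. by move=> r1; rewrite /rad r1 ltNge r1 mulr1 mulr0 add0r. Qed.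

Lemma measurable_rad a b : measurable_fun setT (rad a b).
Proof. by rewrite /rad; mf. Qed.

Lemma radial_fin k (a b : R) : - k.+1%:R < a -> b < - k.+1%:R ->
  (\int[L k.+1]_z (rad a b (enorm z))%:E < +oo)%E.
Proof.
move=> ha hb.
have mr := measurable_rad a b.
pose g (r : R) : \bar R := (rad a b r)%:E.
have mg : measurable_fun setT g by apply: mfun_EFin.
have g0 r : (0 <= g r)%E by rewrite lee_fin rad_ge0.
rewrite (integral_radial k mg g0).
rewrite lte_mul_pinfty ?lee_fin ?sphere_area_ge0//.
pose f (r : R) : \bar R := (g r * (`|r| ^+ k)%:E)%E.
have mf : measurable_fun setT f.
  by apply: emeasurable_funM => //; mf.
have f0 r : (0 <= f r)%E by rewrite mule_ge0// lee_fin.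
rewrite (_ : (\int[leb]_(r in _) _)%E = (\int[leb]_(r in `]0%R, +oo[) f r)%E); last first.
  apply: eq_integral => r /set_mem/=; rewrite in_itv/= andbT => r0.
  by rewrite /f gtr0_norm.
rewrite (integral_split1 mf f0).
have ea : 0 < a + k%:R + 1 by move: ha; rewrite -[k.+1%:R]natr1; lra.
have eb : 0 < - b - k%:R - 1 by move: hb; rewrite -[k.+1%:R]natr1; lra.
rewrite (_ : (\int[leb]_(r in _) _)%E = (\int[leb]_(r in `]0%R, 1%R[)
   ((r `^ ((a + k%:R + 1) - 1))%:E + (r `^ ((- b - k%:R - 1) - 1))%:E))%E); last first.
  apply: eq_integral => r /set_mem/=; rewrite in_itv/= => /andP[r0 r1].
  have rn : r != 0 by rewrite gt_eqF.
  have r1' : 1 <= r^-1 by rewrite invf_ge1// ltW.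
  rewrite /f /g /rad r1 r1' [1 <= r]leNgt r1 [r^-1 < 1]ltNge r1'/=.
  rewrite !mulr0 !mulr1 addr0 add0r gtr0_norm// gtr0_norm ?invr_gt0//.
  rewrite -[r ^+ k]powR_mulrn ?(ltW r0)// -[r^-1 ^+ k]powR_mulrn ?invr_ge0 ?(ltW r0)//.
  rewrite -!EFinM -[r^-1]powR_inv1 ?(ltW r0)// -!powRrM -!powRD ?rn ?implybT//.
  by congr (_%:E + _%:E)%E; congr (_ `^ _); ring.
rewrite ge0_integralD//; last 4 first.
- by move=> r _; rewrite lee_fin powR_ge0.
- by apply/measurable_funTS; mf.
- by move=> r _; rewrite lee_fin powR_ge0.
- by apply/measurable_funTS; mf.
rewrite !integral_powR_lt1//.
exact: ltry.
Qed.

Lemma sqr_enorm_e0B k (z : 'rV[R]_k.+1) :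
  enorm (e0 R k - z) ^+ 2 = 1 - 2 * z ord0 ord0 + enorm z ^+ 2.
Proof.
rewrite !sqr_enorm dotvBB dotv_cons/= dotv0 addr0 mulr1; congr (_ - 2 * _ + _).
by rewrite (rV_consE z) dotv_cons/= mul1r dotvC dotv0 addr0 rV_cons0.
Qed.

Lemma enorm_e0B k (z : 'rV[R]_k.+1) :
  `|1 - enorm z| <= enorm (e0 R k - z) <= 1 + enorm z.
Proof.
have h := coord_le_enorm z ord0; have := enorm_ge0 z; move: h.
rewrite ler_norml => /andP[h1 h2] h0.
rewrite -(@ler_pXn2r R 2) ?nnegrE ?enorm_ge0// -(@ler_pXn2r R 2 _ (enorm (e0 R k - z))) ?nnegrE ?enorm_ge0 ?addr_ge0//.
rewrite real_normK ?num_real// sqr_enorm_e0B; apply/andP; split; nra.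
Qed.

(** Three places matter: the origin (th > -(k+1)), the point e (sg > t) and infinity (th < t). The
    ball |z| < 1/2 is controlled by a function of |z|, its complement by a function of |e - z|. *)
Lemma kernel_fin k (th sg t : R) : 0 < t -> - k.+1%:R < th < t -> t < sg ->
  (\int[L k.+1]_z (enorm z `^ th * min1 (enorm (e0 R k - z)) `^ sg *
      enorm (e0 R k - z) `^ (- (k.+1%:R + t)))%:E < +oo)%E.
Proof.
move=> t0 /andP[th1 th2] tsg.
(* For |z| >= 1/2 a negative power of |z| is bounded, so only the positive part of th counts at
   infinity. *)
pose tp := Num.max th 0.
have tp0 : 0 <= tp by rewrite /tp le_max lexx orbT.
have tpt : tp < t by rewrite /tp gt_max th2.
have k0 : 0 < k.+1%:R :> R by rewrite ltr0n.
have fA : (\int[L k.+1]_z (rad th (- k.+1%:R - 1) (enorm z))%:E < +oo)%E.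
  by apply: radial_fin; lra.
have fB : (\int[L k.+1]_z (rad (sg - (k.+1%:R + t)) (tp - (k.+1%:R + t)) (enorm z))%:E < +oo)%E.
  by apply: radial_fin; lra.
have mrA := measurable_rad th (- k.+1%:R - 1).
have mrB := measurable_rad (sg - (k.+1%:R + t)) (tp - (k.+1%:R + t)).
have A0 := rad_ge0 th (- k.+1%:R - 1).
have B0 := rad_ge0 (sg - (k.+1%:R + t)) (tp - (k.+1%:R + t)).
pose CA : R := 2 `^ (k.+1%:R + t).
pose CB : R := 2 `^ `|th|.
have CA0 : 0 <= CA by exact: powR_ge0.
have CB0 : 0 <= CB by exact: powR_ge0.
have bnd z : enorm z `^ th * min1 (enorm (e0 R k - z)) `^ sg * enorm (e0 R k - z) `^ (- (k.+1%:R + t)) <=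
    CA * rad th (- k.+1%:R - 1) (enorm z) +
    CB * rad (sg - (k.+1%:R + t)) (tp - (k.+1%:R + t)) (enorm (e0 R k - z)).
  have /andP[d1 d2] := enorm_e0B z; have z0 := enorm_ge0 z; have v0 := enorm_ge0 (e0 R k - z).
  move: (enorm z) (enorm (e0 R k - z)) d1 d2 z0 v0 => r v d1 d2 r0 v0.
  rewrite ler_norml in d1; move/andP : d1 => [d1 d3].
  have m0 := min1_ge0 v; have m1 := min1_le1 v.
  have msg : min1 v `^ sg <= 1.
    by apply: powR_le1; [lra|apply/andP].
  have [r2|r2] := ltP r 2^-1.
    apply: (@le_trans _ _ (CA * rad th (- k.+1%:R - 1) r)); last first.
      by rewrite lerDl mulr_ge0.
    rewrite rad_lt1; last by lra.
    rewrite mulrC ler_pM ?mulr_ge0 ?powR_ge0//.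
      rewrite /CA powRN -[leRHS]invrK lef_pV2 ?posrE ?invr_gt0 ?powR_gt0//; last by lra.
      rewrite -powRN -[2]invrK -powR_inv1 ?invr_ge0// -powRrM mulN1r opprK.
      by apply: ge0_ler_powR; rewrite ?nnegrE; lra.
    by rewrite -[leRHS]mulr1 ler_pM ?powR_ge0.
  apply: (@le_trans _ _ (CB * rad (sg - (k.+1%:R + t)) (tp - (k.+1%:R + t)) v)); last first.
    by rewrite lerDr mulr_ge0.
  have rth : r `^ th <= CB * Num.max 1 v `^ tp.
    rewrite /CB /tp; have [th0|th0] := leP 0 th.
      rewrite (ger0_norm th0) -powRM//; last by rewrite le_max ler01.
      have := ge0_ler_powR th0; apply; rewrite ?nnegrE//.
        by rewrite mulr_ge0// le_max ler01.
      have : v <= Num.max 1 v by rewrite le_max lexx orbT.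
      have : 1 <= Num.max 1 v by rewrite le_max lexx.
      lra.
    rewrite (ltr0_norm th0) powRr0 mulr1.
    rewrite -[th in leLHS]opprK powRN -[leRHS]invrK lef_pV2 ?posrE ?invr_gt0 ?powR_gt0//; last by lra.
    rewrite -powRN -[2]invrK -powR_inv1 ?invr_ge0// -powRrM mulN1r opprK.
    by apply: ge0_ler_powR; rewrite ?nnegrE; lra.
  rewrite -mulrA; apply: (@le_trans _ _ (CB * Num.max 1 v `^ tp * (min1 v `^ sg * v `^ (- (k.+1%:R + t))))).
    by rewrite ler_wpM2r// mulr_ge0 ?powR_ge0.
  rewrite -mulrA ler_wpM2l//.
  rewrite /min1 (ger0_norm v0) maxElt minElt; have [v1|v1] := ltP v 1.
    rewrite (rad_lt1 _ _ v1) ltNge (ltW v1)/= powR1 mul1r.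
    have [->|vn] := eqVneq v 0; first by rewrite powR0 ?mul0r ?powR_ge0//; lra.
    by rewrite powRD// vn implybT.
  rewrite (rad_ge1 _ _ v1) powRD; last by rewrite (gt_eqF (lt_le_trans ltr01 v1)) implybT.
  case: ifP => v2; first by rewrite powR1 mul1r.
  have -> : v = 1 by apply/eqP; rewrite eq_le v1 leNgt v2.
  by rewrite !powR1 !mul1r.
move: (rad th _) (rad (sg - _) _) mrA mrB A0 B0 fA fB bnd => rA rB mrA mrB A0 B0 fA fB bnd.
apply: (@le_lt_trans _ _ (\int[L k.+1]_z (CA * rA (enorm z) +
    CB * rB (enorm (e0 R k - z)))%:E)%E).
  apply: ge0_le_integral => //.
  - by move=> z _; rewrite lee_fin !mulr_ge0 ?powR_ge0.
  - by rewrite /min1; mfv.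
  - by mfv.
  - by move=> z _; rewrite lee_fin bnd.
under eq_integral do rewrite EFinD.
rewrite ge0_integralD//; last 4 first.
- by move=> z _; rewrite lee_fin mulr_ge0.
- by mfv.
- by move=> z _; rewrite lee_fin mulr_ge0.
- by mfv.
rewrite integralZ//; last by mfv.
rewrite integralZ//; last by mfv.
apply: lte_add_pinfty; apply: lte_mul_pinfty => //.
have mBe : measurable_fun setT (fun z : 'rV[R]_k.+1 => (rB (enorm z))%:E) by mfv.
rewrite -(integral_shift_rV (- e0 R k) mBe) in fB; last by move=> z; rewrite lee_fin.
by under eq_integral => z _ do rewrite -enormN opprB.
Qed.

End kernel_finite.

Section constant_finite.
Context (R : realType).
Notation leb := (@lebR R).
Notation L := (lebesgue_rV R).

Lemma measurable_neq n (a : 'rV[R]_n) :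
  measurable_fun setT (fun x : 'rV[R]_n => (x != a)%:R : R).
Proof.
rewrite (_ : (fun x => _) = fun x : 'rV[R]_n => (0 < enorm (x - a))%R%:R); first by mfv.
by apply/funext => x; rewrite enorm_gt0 subr_eq0.
Qed.

(** Since |1 - |z|| <= |e - z|, vanishing of g at r = 1 becomes vanishing at the point e, and
    [kernel_fin] applies to each of the two powers. *)
Lemma Jint_fin k (t sg C th1 th2 : R) (g : R -> R) :
  0 <= C -> 0 < t -> t < sg -> - k.+1%:R < th1 < t -> - k.+1%:R < th2 < t ->
  measurable_fun setT g -> (forall r, 0 <= g r) ->
  (forall r : R, 0 < r -> g r <= C * (r `^ th1 + r `^ th2) * min1 (1 - r) `^ sg) ->
  (Jint k ((k.+1%:R + t) / 2) g < +oo)%E.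
Proof.
move=> C0 t0 tsg ht1 ht2 mg g0 gb.
pose e (th : R) (z : 'rV[R]_k.+1) : R := enorm z `^ th * min1 (enorm (e0 R k - z)) `^ sg *
      enorm (e0 R k - z) `^ (- (k.+1%:R + t)).
have e0 th z : 0 <= e th z by rewrite /e !mulr_ge0 ?powR_ge0.
have me th : measurable_fun setT (e th) by rewrite /e /min1; mfv.
have f1 : (\int[L k.+1]_z (e th1 z)%:E < +oo)%E by exact: kernel_fin.
have f2 : (\int[L k.+1]_z (e th2 z)%:E < +oo)%E by exact: kernel_fin.
rewrite /Jint (_ : 2 * _ = k.+1%:R + t); last by field.
rewrite (@integral_neq R k 0); last 2 first.
- by mfv.
- by move=> z; rewrite lee_fin mulr_ge0 ?powR_ge0.
apply: (@le_lt_trans _ _ (\int[L k.+1]_z (C * (e th1 z + e th2 z))%:E)%E).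
  apply: ge0_le_integral => //.
  - by move=> z _; rewrite mule_ge0// lee_fin ?ler0n// mulr_ge0 ?powR_ge0.
  - apply: emeasurable_funM; first by mfv.
    by apply: mfun_EFin; exact: measurable_neq.
  - by apply: mfun_EFin; apply: measurable_funM => //; apply: measurable_funD.
  move=> z _; have [->|z0] := eqVneq z 0; first by rewrite mule0 lee_fin mulr_ge0// addr_ge0.
  rewrite mule1 lee_fin /e -!mulrDl mulrA ler_wpM2r ?powR_ge0//.
  have r0 : 0 < enorm z by rewrite enorm_gt0.
  apply: (le_trans (gb _ r0)); rewrite -mulrA ler_wpM2l// ler_wpM2l ?addr_ge0 ?powR_ge0//.
  apply: ge0_ler_powR; rewrite ?nnegrE ?min1_ge0//; first by lra.
  apply: min1_mono; rewrite [leRHS]ger0_norm ?enorm_ge0//.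
  by have /andP[] := enorm_e0B z.
rewrite integralZ//; last 2 first.
- exact: measurable_funD.
- by move=> z; rewrite addr_ge0.
rewrite lte_mul_pinfty//; under eq_integral do rewrite EFinD.
rewrite ge0_integralD//; last 4 first.
- by move=> z _; rewrite lee_fin.
- exact: mfun_EFin.
- by move=> z _; rewrite lee_fin.
- exact: mfun_EFin.
exact: lte_add_pinfty.
Qed.

(** The factor |1 - r^(-g)| vanishes to first order at r = 1, which supplies min(1, |1-r|)^p; the
    two powers come from (1 + r^(-g))^p r^b. *)
Lemma hgt_bound (g p b : R) : 0 <= p -> exists2 C : R, 0 <= C &
  forall r, 0 < r -> hgt g p b r <= C * (r `^ b + r `^ (b - g * p)) * min1 (1 - r) `^ p.
Proof.
move=> p0; exists ((2 + 2 * `|- g|) `^ p * 2 `^ p); first by rewrite mulr_ge0 ?powR_ge0.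
move=> r r0; have x0 := powR_ge0 r (- g).
have m0 := min1_ge0 (1 - r); have c0 : 0 <= 2 + 2 * `|- g| by rewrite addr_ge0// mulr_ge0.
have h := ge0_ler_powR p0 _ _ (norm_powR_le_min1 (- g) r0).
rewrite /hgt; apply: (@le_trans _ _ (((2 + 2 * `|- g|) * (1 + r `^ (- g)) * min1 (1 - r)) `^ p * r `^ b)).
  by rewrite ler_wpM2r ?powR_ge0// h// nnegrE ?mulr_ge0// addr_ge0.
rewrite powRM//; last by rewrite mulr_ge0// addr_ge0.
rewrite powRM//; last by rewrite addr_ge0.
have -> : r `^ b + r `^ (b - g * p) = (1 `^ p + (r `^ (- g)) `^ p) * r `^ b.
  rewrite powR1 -powRrM mulrDl mul1r -powRD; last by rewrite (gt_eqF r0) implybT.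
  by congr (_ + _ `^ _); ring.
have q := powRD_le (@ler01 R) x0 p0.
set A := _ `^ p; set m := min1 _ `^ p.
have -> : A * (1 + r `^ (- g)) `^ p * m * r `^ b = (1 + r `^ (- g)) `^ p * (A * m * r `^ b) by ring.
have -> : A * 2 `^ p * ((1 `^ p + (r `^ (- g)) `^ p) * r `^ b) * m =
  2 `^ p * (1 `^ p + (r `^ (- g)) `^ p) * (A * m * r `^ b) by ring.
by apply: ler_wpM2r => //; rewrite !mulr_ge0 ?powR_ge0.
Qed.

Lemma Psi_gt0 k (q r : R) : 0 < r < 1 -> (0 < Psi k q r)%E.
Proof.
move=> /andP[r0 r1]; case: k => [|k] /=.
  by rewrite lte_fin addr_gt0// powR_gt0// normr_gt0 gt_eqF//; lra.
rewrite mule_gt0 ?lte_fin ?sphere_area_gt0//.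
apply: integral_gt0 => //.
- by apply/measurable_funTS; mf.
- move=> t /=; rewrite in_itv/= => /andP[t1 t2]; rewrite lte_fin.
  rewrite mulr_gt0// powR_gt0//; last by nra.
  by apply: lt_le_trans (cosine_law_ge r0 t2); rewrite exprn_gt0// subr_gt0.
- have h : @lebR R `](-1)%R, 1%R[%classic = 2%:E.
    by rewrite lebR_itv lebesgue_measure_itv/= lte_fin ltrN10 || rewrite lebR_itv lebesgue_measure_itv/= lte_fin (lt_trans (ltrN10 _) ltr01) -EFinB opprK.
  by rewrite (@lt_le_trans _ _ 2%:E) ?lte_fin// -h.
Qed.

(** Finiteness of [Jint] uses p > sp at the point e, and asks that b and b - g p lie in ]-(k+1),
    sp[. As b - g p = sp - (k+1) - a, the second condition is the one imposed on a. *)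
Lemma hardy_C1_Jint k (s p a b g : R) : 1 <= p -> 0 < s < 1 ->
  - k.+1%:R < a < s * p -> - k.+1%:R < b < s * p ->
  g * p = k.+1%:R + a + b - s * p -> g != 0 ->
  0 < hardy_C1 k.+1 s p a b /\
  (hardy_C1 k.+1 s p a b)%:E = Jint k ((k.+1%:R + s * p) / 2) (hgt g p b).
Proof.
move=> p1 /andP[s0 s1] ha hb gp gn0.
have p0 : 0 < p by lra.
have sp0 : 0 < s * p by rewrite mulr_gt0.
have spp : s * p < p by rewrite gtr_pMl.
have gE : g = (k.+1%:R + a + b - s * p) / p by rewrite -gp mulfK// gt_eqF.
have mh : measurable_fun setT (hgt g p b) by rewrite /hgt; mf.
have h0 r : 0 <= hgt g p b r by rewrite mulr_ge0 ?powR_ge0.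
have fin : (Jint k ((k.+1%:R + s * p) / 2) (hgt g p b) < +oo)%E.
  have [C C0 hC] := hgt_bound g b (ltW p0).
  apply: (Jint_fin C0 sp0 spp hb _ mh h0 hC); rewrite gp; lra.
have HJ := hardyw_Jint p0 gp.
rewrite hardy_C1E ?ltW// -gE -HJ.
suff J0 : (0 < Jint k ((k.+1%:R + s * p) / 2) (hgt g p b))%E.
  by split; [rewrite fine_gt0// J0|rewrite fineK// ge0_fin_numE// ltW].
rewrite HJ; apply: integral_gt0 => //.
- apply/measurable_funTS; apply: emeasurable_funM; last exact: measurable_Psi.
  by rewrite /hardyw; mf.
- move=> r /=; rewrite in_itv/= => r01; rewrite mule_gt0 ?Psi_gt0// lte_fin /hardyw.
  move: r01 => /andP[r0 r1].
  rewrite !mulr_gt0 ?addr_gt0 ?powR_gt0// normr_gt0 subr_eq0 eq_sym powR_eq1.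
  by rewrite (lt_eqF r1) (negbTE gn0) ltNge ltW.
- have h : @lebR R `]0, 1[%classic = 1%E.
    by rewrite lebR_itv lebesgue_measure_itv/= lte_fin ltr01 -EFinB subr0.
  by rewrite (lt_le_trans (@lte01 R))// -h.
Qed.

End constant_finite.

(** * Integration against the kernel in both variables *)

Section double_kernel.
Context (R : realType).
Notation L := (lebesgue_rV R).

Lemma Jint_ge0 k (q : R) (g : R -> R) : (forall r, 0 <= g r) -> (0 <= Jint k q g)%E.
Proof. by move=> g0; apply: integral_ge0 => z _; rewrite lee_fin mulr_ge0 ?powR_ge0. Qed.

Lemma gconst_gt0 m (q : R) : 0 < q -> 0 < gconst m q.
Proof.
move=> q0; rewrite /gconst divr_gt0 ?mulr_gt0 ?powR_gt0 ?pi_gt0// gamma_gt0// divr_gt0//.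
by rewrite ltr_wpDr.
Qed.

Lemma enormk_ge0 k n (x : 'rV[R]_n) : 0 <= enormk k x.
Proof. exact: sqrtr_ge0. Qed.

Lemma integral_kernel_point k m (x : 'rV[R]_(k.+1 + m)) (t : R) (h : R -> R) :
  0 < t -> 0 < enormk k.+1 x -> measurable_fun setT h -> (forall r, 0 <= h r) ->
  (\int[L (k.+1 + m)]_y (h (enormk k.+1 y / enormk k.+1 x) *
      enorm (x - y) `^ (- ((k.+1 + m)%:R + t)))%:E =
   (gconst m (k.+1%:R + t) * enormk k.+1 x `^ (- t))%:E * Jint k ((k.+1%:R + t) / 2) h)%E.
Proof.
move=> t0; rewrite -(hsubmxK x) enormk_row_mx enorm_gt0 => a0 mh h0.
exact: integral_kernel.
Qed.

Lemma double_kernel k m (t : R) (v : 'rV[R]_(k.+1 + m) -> R) (h : R -> R) :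
  0 < t -> measurable_fun setT v -> (forall x, 0 <= v x) ->
  (forall x, enormk k.+1 x = 0 -> v x = 0) ->
  measurable_fun setT h -> (forall r, 0 <= h r) ->
  (\int[L (k.+1 + m)]_x \int[L (k.+1 + m)]_y
      (v x * (h (enormk k.+1 y / enormk k.+1 x) *
      enorm (x - y) `^ (- ((k.+1 + m)%:R + t))))%:E =
   (\int[L (k.+1 + m)]_x (v x * enormk k.+1 x `^ (- t))%:E) *
   ((gconst m (k.+1%:R + t))%:E * Jint k ((k.+1%:R + t) / 2) h))%E.
Proof.
move=> t0 mv v0 vK mh h0.
have G0 : 0 < gconst m (k.+1%:R + t) by rewrite gconst_gt0// addr_gt0.
have J0 := Jint_ge0 k ((k.+1%:R + t) / 2) h0.
rewrite -ge0_integralZr//; last 3 first.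
- by mfv.
- by move=> x _; rewrite lee_fin mulr_ge0 ?powR_ge0.
- by rewrite mule_ge0// lee_fin ltW.
apply: eq_integral => x _; rewrite integralZ//; last 2 first.
- by mfv.
- by move=> y; rewrite mulr_ge0 ?powR_ge0.
have := enormk_ge0 k.+1 x; rewrite le_eqVlt => /predU1P[/esym x0|x0].
  by rewrite vK// mul0r !mul0e.
rewrite integral_kernel_point// (EFinM (v x)) (EFinM (gconst _ _)) -!muleA.
by congr (_ * _)%E; rewrite muleCA.
Qed.

(** The symmetry r -> 1/r of the kernel, which reflects the exchange of x and y. It brings the terms
    in |u(y)|^p to the same variable as those in |u(x)|^p. *)
Lemma Jint_inv k (t : R) (h : R -> R) : measurable_fun setT h -> (forall r, 0 <= h r) ->
  Jint k ((k.+1%:R + t) / 2) h =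
  Jint k ((k.+1%:R + t) / 2) (fun r : R => h r^-1 * r `^ (t - k.+1%:R)).
Proof.
move=> mh h0; set q := _ / 2.
have h0' r : 0 <= h r^-1 * r `^ (t - k.+1%:R) by rewrite mulr_ge0 ?powR_ge0.
have mh' : measurable_fun setT (fun r : R => h r^-1 * r `^ (t - k.+1%:R)) by mfv.
rewrite (Jint01 k q mh h0) (Jint01 k q mh' h0').
apply: eq_integral => r /set_mem/=; rewrite in_itv/= => /andP[r0 r1].
have rn : r != 0 by rewrite gt_eqF.
have rE x : r^-1 `^ x = r `^ (- x) by rewrite -powR_inv1 ?(ltW r0)// -powRrM mulN1r.
have -> : 2 * q - k%:R - 2 = t - 1 by rewrite /q -[k.+1%:R]natr1; field.
rewrite invrK rE -[r ^+ k]powR_mulrn ?(ltW r0)// -!mulrA -!powRD ?rn ?implybT//.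
rewrite addrC; congr ((h _ * _ `^ _ + h _ * _ `^ _)%:E * _)%E.
  by rewrite -[k.+1%:R]natr1; ring.
by rewrite -[k.+1%:R]natr1; ring.
Qed.

(** Convexity of t^p at the points a/l and b/(1-l), with weights l and 1 - l. *)
Lemma powR_convex (p l a b : R) : 1 <= p -> 0 < l < 1 -> 0 <= a -> 0 <= b ->
  (a + b) `^ p <= l `^ (1 - p) * a `^ p + (1 - l) `^ (1 - p) * b `^ p.
Proof.
move=> p1 /andP[l0 l1] a0 b0; have p0 : 0 < p by lra.
have l1' : 0 < 1 - l by lra.
have e (c x : R) : 0 < c -> 0 <= x -> c `^ (1 - p) * x `^ p = c * (x / c) `^ p.
  move=> c0 x0; rewrite powRM ?invr_ge0 ?(ltW c0)//.
  rewrite -powR_inv1 ?(ltW c0)// -powRrM mulN1r powRD; last by rewrite (gt_eqF c0) implybT.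
  by rewrite powRr1 ?(ltW c0)//; ring.
have nn (x c : R) : 0 < c -> 0 <= x -> (x / c \in `[0, +oo[%classic)%classic.
  by move=> c0 x0; rewrite inE/= in_itv/= andbT divr_ge0// ltW.
have l01 : 0 <= l by exact: ltW.
have l11 : l <= 1 by exact: ltW.
have H : (l * (a / l) + (1 - l) * (b / (1 - l))) `^ p <=
    l * (a / l) `^ p + (1 - l) * (b / (1 - l)) `^ p.
  exact: (@convex_powR R p p1 (Itv01 l01 l11) (a / l) (b / (1 - l)) (nn a l l0 a0) (nn b (1 - l) l1' b0)).
rewrite !e//; move: H; congr (_ `^ _ <= _).
by rewrite ![_ * (_ / _)]mulrC !divfK ?gt_eqF.
Qed.

End double_kernel.

(** * The pointwise ground state inequality *)

Section ground_state.
Context (R : realType).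
Notation L := (lebesgue_rV R).

(** [php] and [phm] are the positive and negative parts of sgn(1-l) |1-l|^(p-1). The boolean factor
    does the truncation, because [powR] does not vanish at negative numbers; it also makes both
    parts 0 at l = 1 when p = 1. *)
Definition php (p l : R) : R := (1 - l) `^ (p - 1) * (l < 1)%R%:R.
Definition phm (p l : R) : R := (l - 1) `^ (p - 1) * (1 < l)%R%:R.

Lemma php_ge0 p l : 0 <= php p l.
Proof. by rewrite mulr_ge0 ?powR_ge0. Qed.

Lemma phm_ge0 p l : 0 <= phm p l.
Proof. by rewrite mulr_ge0 ?powR_ge0. Qed.

Lemma php_lt1 p l : l < 1 -> php p l = (1 - l) `^ (p - 1).
Proof. by move=> h; rewrite /php h mulr1. Qed.

Lemma php_ge1 p l : 1 <= l -> php p l = 0.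
Proof. by move=> h; rewrite /php ltNge h mulr0. Qed.

Lemma phm_gt1 p l : 1 < l -> phm p l = (l - 1) `^ (p - 1).
Proof. by move=> h; rewrite /phm h mulr1. Qed.

Lemma phm_le1 p l : l <= 1 -> phm p l = 0.
Proof. by move=> h; rewrite /phm ltNge h mulr0. Qed.

(** Apply [powR_convex] to |A| <= |B| + |A - B| with weights l and 1 - l, then multiply by
    (1-l)^(p-1). *)
Lemma ground_state_lt1 (p l A B : R) : 1 <= p -> 0 < l < 1 ->
  (1 - l) `^ (p - 1) * `|A| `^ p <= `|A - B| `^ p + (l^-1 - 1) `^ (p - 1) * `|B| `^ p.
Proof.
move=> p1 /andP[l0 l1]; have l1' : 0 < 1 - l by lra.
have AB : `|A| <= `|B| + `|A - B|.
  by rewrite -[leLHS](_ : `|B + (A - B)| = _) ?ler_normD//; congr `|_|; ring.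
have h1 : `|A| `^ p <= (`|B| + `|A - B|) `^ p.
  by apply: ge0_ler_powR; rewrite ?nnegrE ?addr_ge0//; lra.
have h2 := @powR_convex R p l `|B| `|A - B| p1 _ (normr_ge0 _) (normr_ge0 _).
rewrite l0 l1 in h2; have {h1 h2}h := le_trans h1 (h2 isT).
apply: (le_trans (ler_wpM2l (powR_ge0 (1 - l) (p - 1)) h)).
rewrite mulrDr addrC !mulrA -powRD; last by rewrite (gt_eqF l1') implybT.
rewrite (_ : p - 1 + (1 - p) = 0); last by ring.
rewrite powRr0 mul1r lerD2l ler_wpM2r ?powR_ge0//.
rewrite (_ : l^-1 - 1 = (1 - l) * l^-1); last by field; rewrite gt_eqF.
rewrite powRM ?(ltW l1') ?invr_ge0 ?(ltW l0)//.
by rewrite -powR_inv1 ?(ltW l0)// -powRrM mulN1r opprB.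
Qed.

(** A discrete Picone inequality. The case l > 1 is the case l < 1 after exchanging A with B and l
    with 1/l. Negative parts stand on the right so that no difference of infinite integrals arises
    later. *)
Lemma ground_state_pointwise (p l A B : R) : 1 <= p -> 0 < l ->
  php p l * `|A| `^ p + php p l^-1 * `|B| `^ p <=
  `|A - B| `^ p + (phm p l * `|A| `^ p + phm p l^-1 * `|B| `^ p).
Proof.
move=> p1 l0; case: (ltgtP l 1) => l1.
- have li : 1 < l^-1 by rewrite invf_gt1.
  rewrite (php_lt1 _ l1) (php_ge1 _ (ltW li)) (phm_gt1 _ li) (phm_le1 _ (ltW l1)).
  by rewrite !mul0r addr0 add0r; apply: ground_state_lt1; rewrite ?l0.
- have li : l^-1 < 1 by rewrite invf_lt1.
  rewrite (php_ge1 _ (ltW l1)) (php_lt1 _ li) (phm_le1 _ (ltW li)) (phm_gt1 _ l1).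
  rewrite !mul0r addr0 add0r distrC -{2}(invrK l); apply: ground_state_lt1 => //.
  by rewrite invr_gt0 l0.
- by rewrite l1 invr1 (php_ge1 _ (lexx 1)) (phm_le1 _ (lexx 1)) !mul0r !addr0 powR_ge0.
Qed.

(** Equality in [ground_state_pointwise] at A = 1, B = l: the ground state saturates it. *)
Lemma php_phm (p l : R) : 1 <= p -> 0 < l ->
  `|1 - l| `^ p + phm p l + phm p l^-1 * l `^ p = php p l + php p l^-1 * l `^ p.
Proof.
move=> p1 l0; have p0 : 0 < p by lra.
case: (ltgtP l 1) => l1.
- have li : 1 < l^-1 by rewrite invf_gt1.
  rewrite (php_lt1 _ l1) (php_ge1 _ (ltW li)) (phm_gt1 _ li) (phm_le1 _ (ltW l1)).
  have l1' : 0 < 1 - l by lra.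
  rewrite mul0r !addr0 gtr0_norm// -(mulr_powRB1 (ltW l0) p0) -(mulr_powRB1 (ltW l1') p0).
  rewrite mulrCA -powRM ?(ltW l0)//; last by rewrite subr_ge0 ltW.
  rewrite (_ : (l^-1 - 1) * l = 1 - l); last by field; rewrite gt_eqF.
  by ring.
- have li : l^-1 < 1 by rewrite invf_lt1.
  rewrite (php_ge1 _ (ltW l1)) (php_lt1 _ li) (phm_le1 _ (ltW li)) (phm_gt1 _ l1).
  have l1' : 0 < l - 1 by lra.
  rewrite mul0r addr0 add0r distrC gtr0_norm// -(mulr_powRB1 (ltW l0) p0) -(mulr_powRB1 (ltW l1') p0).
  rewrite [RHS]mulrCA -powRM ?(ltW l0)//; last by rewrite subr_ge0 ltW.
  rewrite (_ : (1 - l^-1) * l = l - 1); last by field; rewrite gt_eqF.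
  by ring.
- rewrite l1 invr1 (php_ge1 _ (lexx 1)) (phm_le1 _ (lexx 1)) subrr normr0 powR0 ?gt_eqF//.
  by rewrite mul0r !addr0.
Qed.

(** At distance at least 1/N from l = 1, raising the exponent from p - 1 to p costs at most a factor
    N. This makes the truncated negative parts integrable. *)
Lemma phm_le (p l N : R) : 0 < p -> 0 < N -> N^-1 <= `|1 - l| -> phm p l <= N * `|1 - l| `^ p.
Proof.
move=> p0 N0 h; have [l1|l1] := ltP 1 l; last first.
  by rewrite phm_le1// mulr_ge0 ?powR_ge0// ltW.
have l1' : 0 < l - 1 by lra.
rewrite (phm_gt1 _ l1) distrC gtr0_norm// -(mulr_powRB1 (ltW l1') p0) mulrA.
rewrite ler_peMl ?powR_ge0//; move: h; rewrite distrC gtr0_norm// => h.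
by have := ler_wpM2l (ltW N0) h; rewrite divff ?gt_eqF.
Qed.

Lemma JintD k (q : R) (f g : R -> R) : measurable_fun setT f -> measurable_fun setT g ->
  (forall r, 0 <= f r) -> (forall r, 0 <= g r) ->
  Jint k q (fun r => f r + g r) = (Jint k q f + Jint k q g)%E.
Proof.
move=> mf mg f0 g0; rewrite /Jint.
under eq_integral do rewrite mulrDl EFinD.
rewrite ge0_integralD//; last 4 first.
- by move=> z _; rewrite lee_fin mulr_ge0 ?powR_ge0.
- by mfv.
- by move=> z _; rewrite lee_fin mulr_ge0 ?powR_ge0.
- by mfv.
Qed.

Lemma Jint_le k (q c : R) (f g : R -> R) : measurable_fun setT f -> measurable_fun setT g ->
  (forall r, 0 <= f r) -> (forall r, 0 <= g r) -> 0 <= c -> (forall r, 0 <= r -> f r <= c * g r) ->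
  (Jint k q f <= c%:E * Jint k q g)%E.
Proof.
move=> mf mg f0 g0 c0 fg; rewrite /Jint -integralZ//; last 2 first.
- by mfv.
- by move=> z; rewrite mulr_ge0 ?powR_ge0.
apply: ge0_le_integral => //.
- by move=> z _; rewrite lee_fin mulr_ge0 ?powR_ge0.
- by mfv.
- by mfv.
- by move=> z _; rewrite lee_fin mulrA ler_wpM2r ?powR_ge0// fg// enorm_ge0.
Qed.

Lemma eq_Jint k (q : R) (f g : R -> R) : (forall r, 0 <= r -> f r = g r) -> Jint k q f = Jint k q g.
Proof. by move=> fg; apply: eq_integral => z _; rewrite fg// enorm_ge0. Qed.

End ground_state.

(** * Comparison of double integrals *)

Lemma mfun_swap d1 d2 d3 (T1 : measurableType d1) (T2 : measurableType d2)
    (T3 : measurableType d3) (f : T1 -> T2 -> T3) :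
  measurable_fun setT (fun z : T1 * T2 => f z.1 z.2) ->
  measurable_fun setT (fun z : T2 * T1 => f z.2 z.1).
Proof.
move=> mf; exact: (measurableT_comp mf (measurable_fun_pair measurable_snd measurable_fst)).
Qed.

Section double_integral.
Context (R : realType) d1 d2 (T1 : measurableType d1) (T2 : measurableType d2).
Variables (m1 : {sigma_finite_measure set T1 -> \bar R}) (m2 : {sigma_finite_measure set T2 -> \bar R}).
Implicit Types f h : T1 -> T2 -> R.

Lemma dintegralD f h :
  measurable_fun setT (fun z => f z.1 z.2) -> measurable_fun setT (fun z => h z.1 z.2) ->
  (forall x y, 0 <= f x y) -> (forall x y, 0 <= h x y) ->
  (\int[m1]_x \int[m2]_y (f x y + h x y)%:E =
   \int[m1]_x \int[m2]_y (f x y)%:E + \int[m1]_x \int[m2]_y (h x y)%:E)%E.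
Proof.
move=> mf mh f0 h0.
rewrite -ge0_integralD//; last 4 first.
- by move=> x _; apply: integral_ge0 => y _; rewrite lee_fin.
- apply: (@mfun_int R _ _ _ _ m2 (fun x y => (f x y)%:E)); first exact: mfun_EFin.
  by move=> x y; rewrite lee_fin.
- by move=> x _; apply: integral_ge0 => y _; rewrite lee_fin.
- apply: (@mfun_int R _ _ _ _ m2 (fun x y => (h x y)%:E)); first exact: mfun_EFin.
  by move=> x y; rewrite lee_fin.
apply: eq_integral => x _; rewrite -ge0_integralD//; last 4 first.
- by move=> y _; rewrite lee_fin.
- by apply: mfun_EFin; exact: (mfun_pair1 x mf).
- by move=> y _; rewrite lee_fin.
- by apply: mfun_EFin; exact: (mfun_pair1 x mh).
Qed.

Lemma le_dintegral f h :
  measurable_fun setT (fun z => f z.1 z.2) -> measurable_fun setT (fun z => h z.1 z.2) ->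
  (forall x y, 0 <= f x y) -> (forall x y, f x y <= h x y) ->
  (\int[m1]_x \int[m2]_y (f x y)%:E <= \int[m1]_x \int[m2]_y (h x y)%:E)%E.
Proof.
move=> mf mh f0 fh; have h0 x y : 0 <= h x y by exact: le_trans (fh x y).
apply: ge0_le_integral => //.
- by move=> x _; apply: integral_ge0 => y _; rewrite lee_fin.
- apply: (@mfun_int R _ _ _ _ m2 (fun x y => (f x y)%:E)); first exact: mfun_EFin.
  by move=> x y; rewrite lee_fin.
- apply: (@mfun_int R _ _ _ _ m2 (fun x y => (h x y)%:E)); first exact: mfun_EFin.
  by move=> x y; rewrite lee_fin.
move=> x _; apply: ge0_le_integral => //.
- by move=> y _; rewrite lee_fin.
- by apply: mfun_EFin; exact: (mfun_pair1 x mf).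
- by apply: mfun_EFin; exact: (mfun_pair1 x mh).
- by move=> y _; rewrite lee_fin.
Qed.

End double_integral.

Section double_integral_swap.
Context (R : realType) d (T : measurableType d) (m : {sigma_finite_measure set T -> \bar R}).
Local Notation dint f := (\int[m]_x \int[m]_y (f x y)%:E)%E.

Lemma dintegral_swap (f : T -> T -> R) :
  measurable_fun setT (fun z => f z.1 z.2) -> (forall x y, 0 <= f x y) ->
  dint f = dint (fun x y => f y x).
Proof.
move=> mf f0; apply: (@tonelli R _ _ _ _ m m (fun x y => (f x y)%:E)).
  exact: mfun_EFin.
by move=> x y; rewrite lee_fin.
Qed.

(** The terms attached to the point y enter with exchanged arguments; Tonelli turns each of them
    into an integral whose outer variable carries the factor |u|^p. *)
Lemma le_dintegral_swap (P P' W M M' : T -> T -> R) :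
  measurable_fun setT (fun z => P z.1 z.2) -> measurable_fun setT (fun z => P' z.1 z.2) ->
  measurable_fun setT (fun z => W z.1 z.2) ->
  measurable_fun setT (fun z => M z.1 z.2) -> measurable_fun setT (fun z => M' z.1 z.2) ->
  (forall x y, 0 <= P x y) -> (forall x y, 0 <= P' x y) -> (forall x y, 0 <= W x y) ->
  (forall x y, 0 <= M x y) -> (forall x y, 0 <= M' x y) ->
  (forall x y, P x y + P' y x <= W x y + (M x y + M' y x)) ->
  (dint P + dint P' <= dint W + (dint M + dint M'))%E.
Proof.
move=> mP mP' mW mM mM' P0 P'0 W0 M0 M'0 H.
have mP's := mfun_swap mP'; have mM's := mfun_swap mM'.
rewrite (dintegral_swap mP' P'0) (dintegral_swap mM' M'0).
rewrite -(dintegralD m m mP mP's P0 (fun x y => P'0 y x)).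
rewrite -(dintegralD m m mM mM's M0 (fun x y => M'0 y x)).
rewrite -(dintegralD m m mW (measurable_funD mM mM's) W0 (fun x y => addr_ge0 (M0 x y) (M'0 y x))).
apply: (@le_dintegral R _ _ _ _ m m (fun x y => P x y + P' y x) (fun x y => W x y + (M x y + M' y x))).
- exact: (measurable_funD mP mP's).
- exact: (measurable_funD mW (measurable_funD mM mM's)).
- by move=> x y; rewrite addr_ge0.
- exact: H.
Qed.

End double_integral_swap.

Lemma powRV (R : realType) (r e : R) : 0 <= r -> r^-1 `^ e = r `^ (- e).
Proof. by move=> r0; rewrite -powR_inv1// -powRrM mulN1r. Qed.

(** * The weighted and truncated pointwise inequality *)

Section weighted_ground_state.
Context (R : realType).
Variables (g : R).

(** Indicator of the ratios for which l and 1/l both keep distance 1/N from 1. Both conditions are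
    imposed to make it invariant under r -> 1/r. *)
Definition chi (N r : R) : R :=
  ((0 < r) && (N^-1 <= `|1 - r `^ (- g)|) && (N^-1 <= `|1 - r `^ g|))%:R.

Lemma chi_ge0 N r : 0 <= chi N r. Proof. exact: ler0n. Qed.

Lemma chi_inv N r : chi N r^-1 = chi N r.
Proof.
rewrite /chi invr_gt0; case: (ltP 0 r) => //= r0.
have rE x : r^-1 `^ x = r `^ (- x) by rewrite -powR_inv1 ?(ltW r0)// -powRrM mulN1r.
by rewrite !rE opprK andbC.
Qed.

Lemma measurable_chi N : measurable_fun setT (chi N).
Proof. by rewrite /chi; mf. Qed.

Definition trunc (ph : R -> R) (N e r : R) : R := ph (r `^ (- g)) * chi N r * r `^ e.

Lemma trunc_ge0 (ph : R -> R) N e r : (forall l, 0 <= ph l) -> 0 <= trunc ph N e r.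
Proof. by move=> ph0; rewrite /trunc !mulr_ge0 ?chi_ge0 ?powR_ge0. Qed.

Lemma trunc0 (ph : R -> R) N e : trunc ph N e 0 = 0.
Proof. by rewrite /trunc /chi ltxx mulr0 mul0r. Qed.

Lemma measurable_trunc (ph : R -> R) N e : measurable_fun setT ph -> measurable_fun setT (trunc ph N e).
Proof. by move=> mph; have mchi := measurable_chi N; rewrite /trunc; mfv. Qed.

Definition wt (a b A X : R) : R := `|A| `^ a * X `^ b * (0 < X)%R%:R.

Lemma wt_ge0 a b A X : 0 <= wt a b A X.
Proof. by rewrite /wt !mulr_ge0 ?powR_ge0. Qed.

(** [ground_state_pointwise] at l = (Y/X)^(-g), multiplied by X^a Y^b c [chi]. The weights are
    regrouped as X^(a+b) (Y/X)^b or as Y^(a+b) (X/Y)^a, a power of one variable times a function of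
    the ratio. *)
Lemma weighted_ground_state (p a b N A B X Y c : R) :
  1 <= p -> 0 <= X -> 0 <= Y -> 0 <= c ->
  wt p (a + b) A X * (trunc (php p) N b (Y / X) * c) +
    wt p (a + b) B Y * (trunc (php p) N a (X / Y) * c) <=
  `|A - B| `^ p * c * X `^ a * Y `^ b +
    (wt p (a + b) A X * (trunc (phm p) N b (Y / X) * c) +
     wt p (a + b) B Y * (trunc (phm p) N a (X / Y) * c)).
Proof.
move=> p1 X0 Y0 c0.
have W0 : 0 <= `|A - B| `^ p * c * X `^ a * Y `^ b by rewrite !mulr_ge0 ?powR_ge0.
have M0 A' X' e y : 0 <= wt p (a + b) A' X' * (trunc (phm p) N e y * c).
  by rewrite mulr_ge0 ?wt_ge0// mulr_ge0// trunc_ge0// => l; exact: phm_ge0.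
have rhs0 : 0 <= `|A - B| `^ p * c * X `^ a * Y `^ b +
    (wt p (a + b) A X * (trunc (phm p) N b (Y / X) * c) +
     wt p (a + b) B Y * (trunc (phm p) N a (X / Y) * c)) by rewrite !addr_ge0.
have wt0 A' : wt p (a + b) A' 0 = 0 by rewrite /wt ltxx mulr0.
have := X0; rewrite le_eqVlt => /predU1P[/esym x0|x0].
  move: rhs0; rewrite x0 mul0r !trunc0 !wt0 !mul0r !mulr0 !add0r => rhs0.
  by apply: rhs0.
have := Y0; rewrite le_eqVlt => /predU1P[/esym y0|y0].
  move: rhs0; rewrite y0 mul0r !trunc0 !wt0 !mul0r !mulr0 !add0r => rhs0.
  by apply: rhs0.
have xn : X != 0 by rewrite gt_eqF.
have yn : Y != 0 by rewrite gt_eqF.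
clear rhs0 M0 W0.
pose l := (Y / X) `^ (- g).
have l0 : 0 < l by rewrite powR_gt0// divr_gt0.
have lV : (X / Y) `^ (- g) = l^-1.
  by rewrite -(invf_div Y) powRV ?divr_ge0// /l powRN.
have chiV : chi N (X / Y) = chi N (Y / X) by rewrite -(chi_inv _ (Y / X)) invf_div.
have wE (x y e f : R) : 0 < x -> 0 < y ->
    x `^ (e + f) * (y / x) `^ f = x `^ e * y `^ f.
  move=> x1 y1; rewrite powRM ?invr_ge0 ?(ltW x1) ?(ltW y1)// powRV ?(ltW x1)//.
  by rewrite powRD ?(gt_eqF x1) ?implybT// powRN; field; rewrite gt_eqF// powR_gt0.
pose w := X `^ a * Y `^ b * c * chi N (Y / X).
have w0 : 0 <= w by rewrite /w !mulr_ge0 ?powR_ge0 ?chi_ge0.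
have e1 (ph : R -> R) : wt p (a + b) A X * (trunc ph N b (Y / X) * c) = ph l * `|A| `^ p * w.
  by rewrite /wt /trunc x0 mulr1 /w -(wE X Y a b)// -/l; ring.
have e2 (ph : R -> R) : wt p (a + b) B Y * (trunc ph N a (X / Y) * c) = ph l^-1 * `|B| `^ p * w.
  by rewrite /wt /trunc y0 mulr1 /w (mulrC (X `^ a)) -(wE Y X b a)// lV chiV (addrC b a); ring.
rewrite !e1 !e2 -!mulrDl.
apply: (le_trans (ler_wpM2r w0 (ground_state_pointwise A B p1 l0))).
rewrite (mulrDl (`|A - B| `^ p)) lerD2r /w -!mulrA ler_wpM2l ?powR_ge0//.
rewrite !mulrA -mulrA [X in _ * X <= _]mulrC mulrA [leRHS](_ : _ = 1 * (X `^ a * Y `^ b) * c); last by ring.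
rewrite [leLHS](_ : _ = chi N (Y / X) * (X `^ a * Y `^ b) * c); last by ring.
rewrite ler_wpM2r// ler_wpM2r ?mulr_ge0 ?powR_ge0// /chi.
by case: (_ && _).
Qed.

End weighted_ground_state.

(** * The integrated truncated inequality *)

Section hardy_lower_bound.
Context (R : realType).
Notation L := (lebesgue_rV R).
Variables (k m : nat) (s p a b g : R).
Hypotheses (p1 : 1 <= p) (t0 : 0 < s * p) (tab : 0 < s * p - a - b).
Variable u : 'rV[R]_(k.+1 + m) -> R.
Hypothesis mu : measurable_fun setT u.

Local Notation t := (s * p).
Local Notation q := ((k.+1%:R + s * p) / 2).
Local Notation nk := (enormk k.+1).
Local Notation K x y := (enorm (x - y) `^ (- ((k.+1 + m)%:R + s * p))).
Local Notation S := (hardy_rhs s p k.+1 a b u).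
Local Notation lhs := (hardy_lhs s p k.+1 a b u).
Local Notation G := (gconst m (k.+1%:R + s * p)).

(** The indicator inside [wt] makes v vanish on K even when a + b = 0, as [double_kernel]
    demands. *)
Let v (x : 'rV[R]_(k.+1 + m)) : R := wt p (a + b) (u x) (nk x).

Let v0 x : 0 <= v x. Proof. exact: wt_ge0. Qed.

Let mv : measurable_fun setT v. Proof. by rewrite /v /wt; mfv. Qed.

Let vK x : nk x = 0 -> v x = 0. Proof. by move=> x0; rewrite /v /wt x0 ltxx mulr0. Qed.

Let intv : (\int[L (k.+1 + m)]_x (v x * nk x `^ (- t))%:E = S)%E.
Proof.
apply: eq_integral => x _; rewrite /v /wt; congr (_%:E).
have := enormk_ge0 k.+1 x; rewrite le_eqVlt => /predU1P[/esym x0|x0].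
  by rewrite x0 ltxx mulr0 mul0r powR0 ?invr0 ?mulr0// gt_eqF.
rewrite x0 mulr1 -mulrA -powRD; last by rewrite (gt_eqF x0) implybT.
by rewrite -powRN; congr (_ * _ `^ _); ring.
Qed.

Let dk (h : R -> R) x y : R := v x * (h (nk y / nk x) * K x y).

Let dk0 h x y : (forall r, 0 <= h r) -> 0 <= dk h x y.
Proof. by move=> h0; rewrite /dk mulr_ge0// mulr_ge0 ?powR_ge0. Qed.

Let int_dk (h : R -> R) : measurable_fun setT h -> (forall r, 0 <= h r) ->
  (\int[L (k.+1 + m)]_x \int[L (k.+1 + m)]_y (dk h x y)%:E = S * (G%:E * Jint k q h))%E.
Proof. by move=> mh h0; rewrite (double_kernel t0 mv v0 vK mh h0) intv. Qed.

Let mdk (h : R -> R) : measurable_fun setT h ->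
  measurable_fun setT (fun z : 'rV[R]_(k.+1 + m) * 'rV[R]_(k.+1 + m) => dk h z.1 z.2).
Proof.
move=> mh; rewrite /dk; apply: measurable_funM.
  exact: (measurableT_comp mv measurable_fst).
by mfv.
Qed.

Let W x y : R := `|u x - u y| `^ p * K x y * nk x `^ a * nk y `^ b.

Let mW : measurable_fun setT (fun z : 'rV[R]_(k.+1 + m) * 'rV[R]_(k.+1 + m) => W z.1 z.2).
Proof. by rewrite /W; mfv. Qed.

Let W0 x y : 0 <= W x y. Proof. by rewrite /W !mulr_ge0 ?powR_ge0. Qed.

Let lhsE : lhs = (\int[L (k.+1 + m)]_x \int[L (k.+1 + m)]_y (W x y)%:E)%E.
Proof.
(* In [hardy_lhs] the inner variable is x; here it is y. *)
rewrite -(@tonelli R _ _ _ _ (L (k.+1 + m)) (L (k.+1 + m)) (fun y x => (W x y)%:E)); last 2 first.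
- by apply: mfun_EFin; exact: mfun_swap mW.
- by move=> x y; rewrite lee_fin.
rewrite /hardy_lhs; apply: eq_integral => y _; apply: eq_integral => x _.
by rewrite /W powRN.
Qed.

Section truncated.
Variable N : R.

Local Notation hP := (trunc g (php p) N b).
Local Notation hP' := (trunc g (php p) N a).
Local Notation hM := (trunc g (phm p) N b).
Local Notation hM' := (trunc g (phm p) N a).

Let mphp : measurable_fun setT (php p). Proof. by rewrite /php; mf. Qed.
Let mphm : measurable_fun setT (phm p). Proof. by rewrite /phm; mf. Qed.
Let mhP := measurable_trunc g N b mphp.
Let mhP' := measurable_trunc g N a mphp.
Let mhM := measurable_trunc g N b mphm.
Let mhM' := measurable_trunc g N a mphm.
Let hP0 r : 0 <= hP r := trunc_ge0 g N b r (php_ge0 p).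
Let hP'0 r : 0 <= hP' r := trunc_ge0 g N a r (php_ge0 p).
Let hM0 r : 0 <= hM r := trunc_ge0 g N b r (phm_ge0 p).
Let hM'0 r : 0 <= hM' r := trunc_ge0 g N a r (phm_ge0 p).

Let pointwise x y : dk hP x y + dk hP' y x <= W x y + (dk hM x y + dk hM' y x).
Proof.
rewrite /dk /W /v (enormB y x).
exact: (weighted_ground_state g a b N (u x) (u y) p1 (enormk_ge0 k.+1 x) (enormk_ge0 k.+1 y) (powR_ge0 _ _)).
Qed.

(** The terms in u(x) come with the exponent b and those in u(y) with the exponent a, because the
    ratio is inverted between the two. *)
Lemma truncated_integrated : (S * (G%:E * Jint k q hP) + S * (G%:E * Jint k q hP') <=
  lhs + (S * (G%:E * Jint k q hM) + S * (G%:E * Jint k q hM')))%E.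
Proof.
rewrite -(int_dk mhP hP0) -(int_dk mhM hM0) -(int_dk mhP' hP'0) -(int_dk mhM' hM'0) lhsE.
apply: (@le_dintegral_swap R _ _ (L (k.+1 + m)) (dk hP) (dk hP') W (dk hM) (dk hM')).
- exact: (mdk mhP).
- exact: (mdk mhP').
- exact: mW.
- exact: (mdk mhM).
- exact: (mdk mhM').
- by move=> x y; exact: dk0.
- by move=> x y; exact: dk0.
- exact: W0.
- by move=> x y; exact: dk0.
- by move=> x y; exact: dk0.
- exact: pointwise.
Qed.

End truncated.
End hardy_lower_bound.

(** * The truncated constant and the cancellation *)

Section truncated_constant.
Context (R : realType).
Variables (k : nat) (t p a b g N : R).
Hypotheses (p1 : 1 <= p) (N0 : 0 < N) (gp : g * p = k.+1%:R + a + b - t).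
Local Notation J := (Jint k ((k.+1%:R + t) / 2)).

Let mphp : measurable_fun setT (@php R p). Proof. by rewrite /php; mf. Qed.
Let mphm : measurable_fun setT (@phm R p). Proof. by rewrite /phm; mf. Qed.

Definition htrunc (r : R) : R := hgt g p b r * chi g N r.

Lemma htrunc_ge0 r : 0 <= htrunc r.
Proof. by rewrite /htrunc mulr_ge0 ?chi_ge0// mulr_ge0 ?powR_ge0. Qed.

Lemma measurable_htrunc : measurable_fun setT htrunc.
Proof. by have mc := measurable_chi g N; rewrite /htrunc /hgt; mfv. Qed.

(** What the inversion of [Jint_inv] makes of [trunc g ph N a]: with l = r^(-g), the powers of r
    combine to l^p r^b. *)
Definition trunc_inv (ph : R -> R) (r : R) : R :=
  ph (r `^ (- g))^-1 * (r `^ (- g)) `^ p * chi g N r * r `^ b.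

Lemma trunc_inv_ge0 (ph : R -> R) r : (forall l, 0 <= ph l) -> 0 <= trunc_inv ph r.
Proof. by move=> ph0; rewrite /trunc_inv !mulr_ge0 ?chi_ge0 ?powR_ge0. Qed.

Lemma measurable_trunc_inv (ph : R -> R) : measurable_fun setT ph ->
  measurable_fun setT (trunc_inv ph).
Proof. by move=> mph; have mc := measurable_chi g N; rewrite /trunc_inv; mfv. Qed.

Lemma htrunc0 : htrunc 0 = 0.
Proof. by rewrite /htrunc /chi ltxx mulr0. Qed.

Lemma trunc_inv0 (ph : R -> R) : trunc_inv ph 0 = 0.
Proof. by rewrite /trunc_inv /chi ltxx mulr0 mul0r. Qed.

Lemma Jint_trunc_inv (ph : R -> R) : measurable_fun setT ph -> (forall l, 0 <= ph l) ->
  J (trunc g ph N a) = J (trunc_inv ph).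
Proof.
move=> mph ph0; rewrite Jint_inv; last 2 first.
- exact: measurable_trunc.
- by move=> r; exact: trunc_ge0.
apply: eq_Jint => r; rewrite le_eqVlt => /predU1P[<-|r0].
  by rewrite invr0 trunc0 trunc_inv0; exact: mul0r.
have xE : (r `^ (- g))^-1 = r `^ g by rewrite powRN invrK.
rewrite /trunc /trunc_inv chi_inv xE !powRV ?(ltW r0)// !opprK -powRrM.
rewrite [RHS](_ : _ = ph (r `^ g) * chi g N r * (r `^ (- g * p) * r `^ b)); last by ring.
rewrite -[LHS]mulrA -!powRD ?(gt_eqF r0) ?implybT//; congr (_ * _ `^ _).
by rewrite mulNr gp; ring.
Qed.

(** [php_phm] at l = r^(-g), integrated after all terms are brought to the same variable r. *)
Lemma Jint_htrunc : (J htrunc + (J (trunc g (phm p) N b) + J (trunc g (phm p) N a)) =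
  J (trunc g (php p) N b) + J (trunc g (php p) N a))%E.
Proof.
have mh := measurable_htrunc.
have m1 := measurable_trunc g N b mphm; have m2 := measurable_trunc_inv mphm.
have m3 := measurable_trunc g N b mphp; have m4 := measurable_trunc_inv mphp.
have h1 r := trunc_ge0 g N b r (phm_ge0 p); have h2 r := trunc_inv_ge0 r (phm_ge0 p).
have h3 r := trunc_ge0 g N b r (php_ge0 p); have h4 r := trunc_inv_ge0 r (php_ge0 p).
rewrite (Jint_trunc_inv mphm (phm_ge0 p)) (Jint_trunc_inv mphp (php_ge0 p)).
rewrite -(JintD _ _ m1 m2 h1 h2) -(JintD _ _ m3 m4 h3 h4).
rewrite -(JintD _ _ mh (measurable_funD m1 m2) htrunc_ge0 (fun r => addr_ge0 (h1 r) (h2 r))).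
apply: eq_Jint => r; rewrite le_eqVlt => /predU1P[<-|r0].
  by rewrite /= !trunc0 htrunc0 !trunc_inv0; exact: add0r.
rewrite /= /htrunc /hgt /trunc /trunc_inv.
have H := php_phm p1 (powR_gt0 (- g) r0).
rewrite [LHS](_ : _ = (`|1 - r `^ (- g)| `^ p + phm p (r `^ (- g)) +
  phm p (r `^ (- g))^-1 * (r `^ (- g)) `^ p) * chi g N r * r `^ b); last by ring.
by rewrite H; ring.
Qed.

Let phm_hgt (r : R) : 0 <= r -> trunc g (phm p) N b r <= N * hgt g p b r.
Proof.
have p0 : 0 < p := lt_le_trans ltr01 p1.
move=> r0; rewrite /trunc /chi /hgt; case h : (_ && _ && _); last first.
  by rewrite mulr0 mul0r !mulr_ge0 ?powR_ge0// ltW.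
move: h => /andP[/andP[_ h] _]; rewrite mulr1 mulrA ler_wpM2r ?powR_ge0//.
exact: phm_le.
Qed.

Let phm_inv_hgt (r : R) : 0 <= r -> trunc_inv (phm p) r <= N * hgt g p b r.
Proof.
have p0 : 0 < p := lt_le_trans ltr01 p1.
move=> r0; rewrite /trunc_inv /chi /hgt; case h : (_ && _ && _); last first.
  by rewrite mulr0 mul0r !mulr_ge0 ?powR_ge0// ltW.
move: h => /andP[/andP[r1 _] h]; rewrite mulr1 mulrA ler_wpM2r ?powR_ge0//.
have x0 := powR_gt0 (- g) r1; have xE : (r `^ (- g))^-1 = r `^ g by rewrite -powRN opprK.
rewrite -xE in h; have := ler_wpM2r (powR_ge0 (r `^ (- g)) p) (phm_le p0 N0 h).
move=> /le_trans; apply; rewrite -mulrA -powRM ?(ltW x0)//.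
rewrite -{2}(ger0_norm (ltW x0)) -normrM mulrBl mul1r mulVf ?gt_eqF//.
by rewrite distrC.
Qed.

(** On the support of [chi] the negative parts are at most N times [hgt], whose integral is
    finite. *)
Lemma Jint_phm : (J (hgt g p b) < +oo)%E ->
  (J (trunc g (phm p) N b) < +oo)%E /\ (J (trunc g (phm p) N a) < +oo)%E.
Proof.
move=> Jf.
have mh : measurable_fun setT (hgt g p b) by rewrite /hgt; mf.
have h0 r : 0 <= hgt g p b r by rewrite mulr_ge0 ?powR_ge0.
have NJ : (N%:E * J (hgt g p b) < +oo)%E by rewrite lte_mul_pinfty// lee_fin ltW.
have m1 := measurable_trunc g N b mphm; have m2 := measurable_trunc_inv mphm.
have h1 r := trunc_ge0 g N b r (phm_ge0 p); have h2 r := trunc_inv_ge0 r (phm_ge0 p).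
rewrite (Jint_trunc_inv mphm (phm_ge0 p)); split; apply: le_lt_trans NJ.
  exact: (Jint_le _ _ m1 mh h1 h0 (ltW N0) phm_hgt).
exact: (Jint_le _ _ m2 mh h2 h0 (ltW N0) phm_inv_hgt).
Qed.

End truncated_constant.

Section hardy_truncated.
Context (R : realType).

(** S, m1 and m2 are finite, which is what it takes to subtract S G (m1 + m2); the energy l may be
    infinite. *)
Lemma ereal_cancel (l S m1 m2 q1 q2 h : \bar R) (G : R) :
  (S * (G%:E * q1) + S * (G%:E * q2) <= l + (S * (G%:E * m1) + S * (G%:E * m2)))%E ->
  (h + (m1 + m2) = q1 + q2)%E -> (0 <= S)%E -> 0 < G ->
  (0 <= m1)%E -> (0 <= m2)%E -> (0 <= q1)%E -> (0 <= q2)%E -> (0 <= h)%E ->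
  (m1 < +oo)%E -> (m2 < +oo)%E -> (S < +oo)%E -> (S * (G%:E * h) <= l)%E.
Proof.
move=> H E S0 G0 m10 m20 q10 q20 h0 f1 f2 Sf.
have g0 : (0 <= G%:E)%E by rewrite lee_fin ltW.
have fin : (S * (G%:E * m1) + S * (G%:E * m2) \is a fin_num)%E.
  have e (x : \bar R) : (0 <= x)%E -> (x < +oo)%E -> (S * (G%:E * x) \is a fin_num)%E.
    move=> x0 xf; rewrite fin_numM// ?ge0_fin_numE//; last by rewrite mule_ge0.
    by rewrite lte_mul_pinfty.
  by rewrite fin_numD !e.
rewrite -(leeD2rE _ _ fin); apply: le_trans H.
have D (x y : \bar R) : (0 <= x -> 0 <= y -> S * (G%:E * x) + S * (G%:E * y) = S * (G%:E * (x + y)))%E.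
  by move=> x0 y0; rewrite ge0_muleDr// ge0_muleDr ?mule_ge0.
by rewrite (D m1 m2)// (D h)// ?adde_ge0// (D q1)// E.
Qed.

Variables (k m : nat) (s p a b g N : R).
Hypotheses (p1 : 1 <= p) (t0 : 0 < s * p) (tab : 0 < s * p - a - b).
Hypothesis gp : g * p = k.+1%:R + a + b - s * p.
Hypothesis N0 : 0 < N.

Lemma hardy_truncated (u : 'rV[R]_(k.+1 + m) -> R) : measurable_fun setT u ->
  (hardy_rhs s p k.+1 a b u < +oo)%E ->
  (Jint k ((k.+1%:R + s * p) / 2) (hgt g p b) < +oo)%E ->
  (hardy_rhs s p k.+1 a b u * ((gconst m (k.+1%:R + s * p))%:E *
     Jint k ((k.+1%:R + s * p) / 2) (htrunc p b g N)) <=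
   hardy_lhs s p k.+1 a b u)%E.
Proof.
move=> mu Sf Jf.
have H := truncated_integrated g p1 t0 tab mu N.
have [f1 f2] := Jint_phm p1 N0 gp Jf.
have E := Jint_htrunc N p1 gp.
have S0 : (0 <= hardy_rhs s p k.+1 a b u)%E.
  by apply: integral_ge0 => x _; rewrite lee_fin mulr_ge0 ?powR_ge0// invr_ge0 powR_ge0.
have G0 : 0 < gconst m (k.+1%:R + s * p) by rewrite gconst_gt0// addr_gt0.
have J1 := Jint_ge0 k ((k.+1%:R + s * p) / 2) (fun r => trunc_ge0 g N b r (phm_ge0 p)).
have J2 := Jint_ge0 k ((k.+1%:R + s * p) / 2) (fun r => trunc_ge0 g N a r (phm_ge0 p)).
have J3 := Jint_ge0 k ((k.+1%:R + s * p) / 2) (fun r => trunc_ge0 g N b r (php_ge0 p)).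
have J4 := Jint_ge0 k ((k.+1%:R + s * p) / 2) (fun r => trunc_ge0 g N a r (php_ge0 p)).
have J5 := Jint_ge0 k ((k.+1%:R + s * p) / 2) (htrunc_ge0 p b g N).
exact: (ereal_cancel H E S0 G0 J1 J2 J3 J4 J5 f1 f2 Sf).
Qed.

End hardy_truncated.

(** * Removal of the truncation *)

Section hardy_lower.
Context (R : realType).
Notation L := (lebesgue_rV R).
Variables (k m : nat) (s p a b g : R).
Hypotheses (p1 : 1 <= p) (t0 : 0 < s * p) (tab : 0 < s * p - a - b).
Hypothesis gp : g * p = k.+1%:R + a + b - s * p.
Hypothesis gn0 : g != 0.

Lemma chi_nondecreasing (M N r : R) : 0 < M -> M <= N -> chi g M r <= chi g N r.
Proof.
move=> M0 MN; have N0 := lt_le_trans M0 MN.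
have NM : N^-1 <= M^-1 by rewrite lef_pV2 ?posrE.
rewrite /chi ler_nat; case h : (_ && _ && _) => //; move: h => /andP[/andP[-> h1] h2].
by rewrite (le_trans NM h1) (le_trans NM h2).
Qed.

Lemma chi_eventually1 (r : R) : 0 < r -> r != 1 -> \forall n \near \oo, chi g n.+1%:R r = 1.
Proof.
move=> r0 r1.
have h (e : R) : e != 0 -> 0 < `|1 - r `^ e|.
  move=> en; rewrite normr_gt0 subr_eq0 eq_sym powR_eq1 (negbTE r1) (negbTE en).
  by rewrite ltNge (ltW r0).
have h1 := h g gn0; have h2 : 0 < `|1 - r `^ (- g)| by apply: h; rewrite oppr_eq0.
near=> n; rewrite /chi r0/=.
rewrite (_ : _ && _ = true)//; apply/andP; split; apply: ltW.
  near: n; exact: (near_infty_natSinv_lt (PosNum h2)).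
near: n; exact: (near_infty_natSinv_lt (PosNum h1)).
Unshelve. all: by end_near. Qed.

(** As N grows, [chi] increases to 1 at every r > 0 other than 1, and [hgt] vanishes at r = 1;
    monotone convergence applies. *)
Lemma Jint_htrunc_cvg :
  (fun n => Jint k ((k.+1%:R + s * p) / 2) (htrunc p b g n.+1%:R)) @ \oo -->
  Jint k ((k.+1%:R + s * p) / 2) (hgt g p b).
Proof.
have mh : measurable_fun setT (hgt g p b) by rewrite /hgt; mf.
have h0 r : 0 <= hgt g p b r by rewrite mulr_ge0 ?powR_ge0.
set q := _ / 2.
pose F n (z : 'rV[R]_k.+1) : \bar R := (htrunc p b g n.+1%:R (enorm z) * enorm (e0 R k - z) `^ (- (2 * q)))%:E.
(* [htrunc] is 0 at 0 while [hgt] need not be, so the limit is taken off the origin, a null set. *)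
pose f (z : 'rV[R]_k.+1) : \bar R := ((hgt g p b (enorm z) * enorm (e0 R k - z) `^ (- (2 * q)))%:E * (z != 0)%R%:R%:E)%E.
have -> : Jint k q (hgt g p b) = (\int[L k.+1]_z f z)%E.
  rewrite /Jint (@integral_neq R k 0)//; first by mfv.
  by move=> z; rewrite lee_fin mulr_ge0 ?powR_ge0.
have mF n : measurable_fun setT (F n).
  by have mt := measurable_htrunc p b g n.+1%:R; rewrite /F; mfv.
have F0 n z : setT z -> (0 <= F n z)%E by rewrite lee_fin mulr_ge0 ?htrunc_ge0 ?powR_ge0.
have ndF z : setT z -> {homo (F^~ z) : n m / (n <= m)%N >-> (n <= m)%E}.
  move=> _ n n' nn; rewrite lee_fin ler_wpM2r ?powR_ge0// /htrunc ler_wpM2l//.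
  by apply: chi_nondecreasing; rewrite ?ltr0n// ler_nat ltnS.
have Ff z : F^~ z @ \oo --> f z.
  have [->|zn] := eqVneq z 0.
    rewrite (_ : F^~ 0 = fun=> 0%E); last first.
      by apply/funext => n; rewrite /F enorm0 htrunc0 mul0r.
    by rewrite /f eqxx mule0; exact: cvg_cst.
  have z0 : 0 < enorm z by rewrite enorm_gt0.
  rewrite /f zn mule1; have [z1|z1] := eqVneq (enorm z) 1.
    have p0 : p != 0 by rewrite gt_eqF// (lt_le_trans ltr01 p1).
    have e : hgt g p b 1 = 0 by rewrite /hgt powR1 subrr normr0 powR0// mul0r.
    rewrite (_ : F^~ z = fun=> 0%E); last first.
      by apply/funext => n; rewrite /F z1 /htrunc e !mul0r.
    by rewrite z1 e mul0r; exact: cvg_cst.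
  apply: cvg_near_cst; near=> n; rewrite /F /htrunc.
  rewrite (_ : chi _ _ _ = 1) ?mulr1//.
  by near: n; exact: chi_eventually1.
have := @cvg_monotone_convergence _ _ R (L k.+1) setT measurableT F mF F0 ndF.
rewrite (_ : (\int[L k.+1]_(z in setT) limn (F^~ z))%E = (\int[L k.+1]_z f z)%E)//.
by apply: eq_integral => z _; apply/cvg_lim => //; exact: Ff.
Unshelve. all: by end_near. Qed.

Lemma hardy_lower (u : 'rV[R]_(k.+1 + m) -> R) : measurable_fun setT u ->
  (hardy_rhs s p k.+1 a b u < +oo)%E ->
  (Jint k ((k.+1%:R + s * p) / 2) (hgt g p b) < +oo)%E ->
  (hardy_rhs s p k.+1 a b u * ((gconst m (k.+1%:R + s * p))%:E *
     Jint k ((k.+1%:R + s * p) / 2) (hgt g p b)) <=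
   hardy_lhs s p k.+1 a b u)%E.
Proof.
move=> mu Sf Jf.
have S0 : (0 <= hardy_rhs s p k.+1 a b u)%E.
  by apply: integral_ge0 => x _; rewrite lee_fin mulr_ge0 ?powR_ge0// invr_ge0 powR_ge0.
have H : (fun n => hardy_rhs s p k.+1 a b u * ((gconst m (k.+1%:R + s * p))%:E *
     Jint k ((k.+1%:R + s * p) / 2) (htrunc p b g n.+1%:R)))%E @ \oo -->
   (hardy_rhs s p k.+1 a b u * ((gconst m (k.+1%:R + s * p))%:E *
     Jint k ((k.+1%:R + s * p) / 2) (hgt g p b)))%E.
  apply: cvgeZl; first by rewrite ge0_fin_numE.
  by apply: cvgeZl => //; exact: Jint_htrunc_cvg.
rewrite -(cvg_lim _ H)//; apply: lime_le; first by apply/cvg_ex; eexists; exact: H.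
by near=> n; apply: hardy_truncated.
Unshelve. all: by end_near. Qed.

End hardy_lower.

(** * Functions of class C^1 *)

Section C1_calculus.
Context (R : realType) (n : nat).
Implicit Types u v : 'rV[R]_n -> R.
Local Notation cd := (@continuously_differentiable R n).

Lemma cd_continuous u : cd u -> continuous u.
Proof. by move=> [du _] x; exact: differentiable_continuous. Qed.

Lemma cd_cst (c : R) : cd (fun=> c).
Proof.
split=> [x|v]; first exact: differentiable_cst.
have -> : 'D_v (fun=> c) = cst 0 :> ('rV[R]_n -> R).
  by apply/funext => x; exact: derive_cst.
exact: cst_continuous.
Qed.

Lemma cd_add u1 u2 : cd u1 -> cd u2 -> cd (fun x => u1 x + u2 x).
Proof.
move=> [d1 c1] [d2 c2]; split=> [x|v]; first by apply: differentiableD.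
rewrite (_ : 'D_v _ = fun x => 'D_v u1 x + 'D_v u2 x); last first.
  by apply/funext => x; rewrite deriveD//; exact: diff_derivable.
by move=> x; apply: (continuousD (c1 v x) (c2 v x)).
Qed.

Lemma cd_mul u1 u2 : cd u1 -> cd u2 -> cd (fun x => u1 x * u2 x).
Proof.
move=> H1 H2; have k1 := cd_continuous H1; have k2 := cd_continuous H2.
move: H1 H2 => [d1 c1] [d2 c2]; split=> [x|v]; first by apply: differentiableM.
rewrite (_ : 'D_v _ = fun x => u1 x * 'D_v u2 x + u2 x * 'D_v u1 x); last first.
  by apply/funext => x; rewrite deriveM//; exact: diff_derivable.
by move=> x; apply: (continuousD (continuousM (k1 x) (c2 v x)) (continuousM (k2 x) (c1 v x))).
Qed.

Lemma cd_coord (i : 'I_n) : cd (fun x => x ord0 i).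
Proof.
split=> [x|v]; first exact: differentiable_coord.
rewrite (_ : 'D_v _ = cst (v ord0 i)); first exact: cst_continuous.
apply/funext => x; rewrite deriveE; last exact: differentiable_coord.
have @f : {linear 'rV[R]_n -> R}.
  by exists (fun N : 'rV[R]_n => N ord0 i); do 2![eexists]; do ?[constructor];
     rewrite ?mxE// => ? *; rewrite ?mxE//; move=> ?; rewrite !mxE.
have cf : continuous f by exact: coord_continuous.
by have := diff_lin x cf; rewrite -[f : _ -> _]/(fun N : 'rV[R]_n => N ord0 i) => ->.
Qed.

Lemma cd_comp (f f' : R -> R) u : (forall x : R, is_derive x 1 f (f' x)) -> continuous f' ->
  cd u -> cd (fun x => f (u x)).
Proof.
move=> df cf H; have ku := cd_continuous H; move: H => [du cu].
have df' (x : R) : differentiable f x by apply/derivable1_diffP; case: (df x).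
split=> [x|v]; first exact: differentiable_comp.
rewrite (_ : 'D_v _ = fun x => 'D_v u x * f' (u x)); last first.
  apply/funext => x; rewrite deriveE; last exact: differentiable_comp.
  rewrite (_ : (fun x => f (u x)) = f \o u)// diff_comp//=.
  have e (w : R) : 'd f (u x) w = w * f' (u x).
    rewrite -{1}(mulr1 w) -[w * 1]/(w *: (1 : R)) linearZ/= -deriveE//.
    by case: (df (u x)) => _ ->.
  by rewrite e -deriveE.
move=> x; apply: (continuousM (cu v x)).
by apply: continuous_comp; [exact: ku|exact: cf].
Qed.

(** Sums of squares of coordinates replace norms wherever differentiability matters, since they are
    polynomial. *)
Definition psum (S : pred 'I_n) (x : 'rV[R]_n) : R := \sum_(i | S i) x ord0 i ^+ 2.

Lemma psum_ge0 S (x : 'rV[R]_n) : 0 <= psum S x.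
Proof. by apply: sumr_ge0 => i _; exact: sqr_ge0. Qed.

Lemma psum_eq0 (S : pred 'I_n) (x : 'rV[R]_n) : psum S x = 0 -> forall i, S i -> x ord0 i = 0.
Proof.
move=> /eqP; rewrite psumr_eq0; last by move=> i _; exact: sqr_ge0.
by move=> /allP h i Si; have := h i (mem_index_enum i); rewrite Si/= sqrf_eq0 => /eqP.
Qed.

Lemma psum_coord (S : pred 'I_n) (x : 'rV[R]_n) i : S i -> x ord0 i ^+ 2 <= psum S x.
Proof.
move=> Si; rewrite /psum (bigD1 i)//= lerDl; apply: sumr_ge0 => j _; exact: sqr_ge0.
Qed.

Lemma cd_psum S : cd (psum S).
Proof.
rewrite /psum; elim: (index_enum _) => [|i s IH].
  rewrite (_ : (fun x => _) = fun=> 0); first exact: cd_cst.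
  by apply/funext => x; rewrite big_nil.
case Si : (S i); last first.
  by rewrite (_ : (fun x => _) = fun x : 'rV[R]_n => \sum_(i <- s | S i) x ord0 i ^+ 2)//; apply/funext => x; rewrite big_cons Si.
rewrite (_ : (fun x => _) = fun x : 'rV[R]_n => x ord0 i * x ord0 i + \sum_(i <- s | S i) x ord0 i ^+ 2).
  by apply: cd_add => //; apply: cd_mul; exact: cd_coord.
by apply/funext => x; rewrite big_cons Si expr2.
Qed.

Lemma psum_continuous S : continuous (psum S).
Proof. exact: cd_continuous (cd_psum S). Qed.

End C1_calculus.

Section C1_functions.
Context (R : realType).

(** The square of the positive part is of class C^1; it is the profile of all the cutoffs. *)
Definition sqpos (t : R) : R := Num.max t 0 ^+ 2.

Lemma sqpos_le0 t : t <= 0 -> sqpos t = 0.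
Proof. by move=> t0; rewrite /sqpos max_r// expr0n. Qed.

Lemma sqpos_ge0 t : 0 <= sqpos t. Proof. exact: sqr_ge0. Qed.

Lemma sqpos_le1 t : t <= 1 -> sqpos t <= 1.
Proof. by move=> t1; rewrite /sqpos expr_le1// ?le_max ?lexx ?orbT// ge_max t1 ler01. Qed.

Lemma is_derive_sqpos (t : R) : is_derive t 1 sqpos (2 * Num.max t 0).
Proof.
case: (ltgtP t 0) => t0.
- rewrite mulr0.
  have H : is_derive t (1 : R) (cst (0 : R) : R -> R) 0 by exact: is_derive_cst.
  apply: (near_eq_is_derive _ H); near=> x; rewrite sqpos_le0//; apply: ltW; near: x; exact: lt_nbhsl.
- have H : is_derive t 1 (fun x : R => x ^+ 2) (2 * t).
    have h := is_deriveX 2 (is_derive_id t (1 : R)).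
    by apply: (is_derive_eq h); rewrite /GRing.scale/= mulr1 expr1.
  apply: (near_eq_is_derive _ H); near=> x; rewrite /sqpos max_l//.
  by apply: ltW; near: x; exact: lt_nbhsr.
- subst t; have H : (h^-1 *: ((sqpos \o shift 0) (h *: 1) - sqpos 0)) @[h --> 0^'] --> (0 : R).
    apply/cvgrPdist_lt => e e0; near=> h.
    rewrite /= addr0 (sqpos_le0 (lexx 0)) subr0 sub0r normrN -[h *: 1]/(h * 1) mulr1.
    apply: (@le_lt_trans _ _ `|h|); last first.
      by near: h; exact: dnbhs0_lt.
    rewrite -[_ *: _]/(_ * _) normrM normfV.
    have [->|hn] := eqVneq h 0; first by rewrite normr0 invr0 mul0r.
    rewrite ler_pdivrMl ?normr_gt0// -expr2 real_normK ?num_real// ger0_norm ?sqpos_ge0//.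
    rewrite /sqpos; have [h0|h0] := leP h 0; first by rewrite expr0n sqr_ge0.
    exact: lexx.
  rewrite mulr0; apply: DeriveDef; first by apply/cvg_ex; exists 0; exact: H.
  by apply/cvg_lim => //; exact: H.
Unshelve. all: by end_near. Qed.

Lemma continuous_maxr0 : continuous (fun t : R => 2 * Num.max t 0).
Proof.
have -> : (fun t : R => 2 * Num.max t 0) = (fun t : R => t + `|t|).
  apply/funext => t; have [t0|t0] := leP t 0.
    by rewrite ler0_norm// subrr mulr0.
  by rewrite gtr0_norm//; ring.
have h1 : continuous (id : R -> R) by move=> t; exact: cvg_id.
by move=> t; exact: (continuousD (h1 t) (@norm_continuous R R t)).
Qed.

(** A point x <= 0 has a neighbourhood below c, where f and f' vanish; this region and the half-line
    x > 0 cover the line. *)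
Lemma is_derive_glue (c : R) (f f' : R -> R) : 0 < c ->
  (forall x, x < c -> f x = 0) -> (forall x, x < c -> f' x = 0) ->
  (forall x : R, 0 < x -> is_derive x 1 f (f' x)) ->
  (forall x : R, 0 < x -> {for x, continuous f'}) ->
  (forall x : R, is_derive x 1 f (f' x)) /\ continuous f'.
Proof.
move=> c0 f0 f'0 df cf; split=> x; have [x0|x0] := ltP 0 x; [exact: df| |exact: cf|].
  rewrite f'0; last exact: le_lt_trans c0.
  have H : is_derive x (1 : R) (cst (0 : R) : R -> R) 0 by exact: is_derive_cst.
  apply: (near_eq_is_derive _ H); near=> y; rewrite f0//; near: y; apply: lt_nbhsl; exact: le_lt_trans c0.
rewrite /continuous_at f'0; last exact: le_lt_trans c0.
apply: cvg_near_cst; near=> y; rewrite f'0//; near: y; apply: lt_nbhsl; exact: le_lt_trans c0.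
Unshelve. all: by end_near. Qed.

End C1_functions.

(** * Compact supports and finiteness of the right-hand side *)

Section compact_support.
Context (R : realType).

Lemma tsupport_sub n (u : 'rV[R]_n -> R) x : u x != 0 -> tsupport u x.
Proof. by move=> ux; apply: subset_closure. Qed.

Lemma compact_image_le n (A : set 'rV[R]_n) (f : 'rV[R]_n -> R) :
  compact A -> continuous f -> exists2 M : R, 0 <= M & forall x, A x -> `|f x| <= M.
Proof.
move=> cA cf; have cfA : compact (f @` A).
  by apply: continuous_compact => //; apply: continuous_subspaceT.
have [M [_ hM]] := compact_bounded cfA.
exists (`|M| + 1); first by rewrite addr_ge0.
move=> x Ax; apply: hM; last by exists x.
by rewrite (le_lt_trans (ler_norm M))// ltrDl.
Qed.

Lemma C1c_bounds n (Om : set 'rV[R]_n) u : C1c Om u ->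
  exists B rho : R, [/\ 0 <= B, 1 <= rho, forall x, `|u x| <= B &
    forall x, u x != 0 -> psum xpredT x <= rho].
Proof.
move=> [Cu cu _]; have ku := cd_continuous Cu.
have [B B0 hB] := compact_image_le cu ku.
have [r r0 hr] := compact_image_le cu (@psum_continuous R n xpredT).
exists B, (r + 1); split=> //; first by rewrite lerDr.
  move=> x; have [->|ux] := eqVneq (u x) 0; first by rewrite normr0.
  exact: hB (tsupport_sub ux).
move=> x ux; apply: (le_trans (ler_norm _)).
by apply: (le_trans (hr _ (tsupport_sub ux))); rewrite lerDl.
Qed.

(** The image of the compact support under |x_k|^2 is closed and omits 0. *)
Lemma C1c_away k n (u : 'rV[R]_n -> R) : C1c (~` @Kset R k n) u ->
  exists2 de : R, 0 < de & forall x, u x != 0 -> de <= psum (fun i : 'I_n => (i < k)%N) x.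
Proof.
move=> [Cu cu sK]; pose f := psum (fun i : 'I_n => (i < k)%N) : 'rV[R]_n -> R.
have cfA : compact (f @` tsupport u).
  by apply: continuous_compact => //; apply: continuous_subspaceT; exact: psum_continuous.
have clA : closed (f @` tsupport u) by apply: compact_closed => //; exact: Rhausdorff.
have n0 : (~` (f @` tsupport u)) 0.
  move=> [x xA fx0]; apply: (sK x xA); exact: (psum_eq0 fx0).
have := open_nbhs_nbhs (conj (closed_openC clA) n0).
move=> /nbhs_ballP[de /= de0 hde]; exists de => // x ux.
rewrite leNgt; apply/negP => h; apply: (hde (f x)); last by exists x => //; exact: tsupport_sub.
by rewrite /ball/= sub0r normrN ger0_norm// psum_ge0.
Qed.

End compact_support.

Section rhs_finite.
Context (R : realType).
Notation L := (lebesgue_rV R).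

Lemma mfun_lsubmx k m : measurable_fun setT (fun x : 'rV[R]_(k + m) => lsubmx x : 'rV[R]_k).
Proof.
apply: measurable_fun_rV => i /=; rewrite (_ : (fun x => _) = fun x : 'rV[R]_(k + m) => x ord0 (lshift m i)).
  exact: measurable_coord.
by apply/funext => x; rewrite mxE.
Qed.

Lemma mfun_rsubmx k m : measurable_fun setT (fun x : 'rV[R]_(k + m) => rsubmx x : 'rV[R]_m).
Proof.
apply: measurable_fun_rV => i /=; rewrite (_ : (fun x => _) = fun x : 'rV[R]_(k + m) => x ord0 (rshift k i)).
  exact: measurable_coord.
by apply/funext => x; rewrite mxE.
Qed.

Lemma integral_split_prod k m (f : 'rV[R]_k -> R) (h : 'rV[R]_m -> R) :
  measurable_fun setT f -> measurable_fun setT h -> (forall a, 0 <= f a) -> (forall b, 0 <= h b) ->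
  (\int[L (k + m)]_x (f (lsubmx x) * h (rsubmx x))%:E =
   (\int[L k]_a (f a)%:E) * (\int[L m]_b (h b)%:E))%E.
Proof.
move=> mf mh f0 h0; rewrite integral_rV_split; last 2 first.
- apply: mfun_EFin; apply: measurable_funM.
    exact: (measurableT_comp mf (@mfun_lsubmx k m)).
  exact: (measurableT_comp mh (@mfun_rsubmx k m)).
- by move=> x; rewrite lee_fin mulr_ge0.
rewrite -ge0_integralZr//; last 3 first.
- exact: mfun_EFin.
- by move=> a _; rewrite lee_fin.
- by apply: integral_ge0 => b _; rewrite lee_fin.
apply: eq_integral => a _; rewrite -integralZ//.
by apply: eq_integral => b _; rewrite row_mxKl row_mxKr.
Qed.

Lemma enormk_lsubmx k m (x : 'rV[R]_(k + m)) : enormk k x = enorm (lsubmx x).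
Proof. by rewrite -{1}(hsubmxK x) enormk_row_mx. Qed.

Lemma sqr_enorm_split k m (x : 'rV[R]_(k + m)) :
  psum xpredT x = enormk k x ^+ 2 + enorm (rsubmx x) ^+ 2.
Proof.
by rewrite enormk_lsubmx -sqr_enorm_row_mx hsubmxK sqr_sqrtr ?psum_ge0.
Qed.

(** Serves both classes of functions. Near K the weight is dominated by D |x_k|^e with e > -(k+1),
    either because it is itself such a power, or with e = 0 because u vanishes close to K. Elsewhere
    u is bounded with bounded support, and [rad] and [hb] are integrable majorants in the two blocks
    of variables. *)
Lemma hardy_rhs_fin k m (s p a b e B rho D : R) (u : 'rV[R]_(k.+1 + m) -> R) :
  0 < p -> 0 < s * p - a - b -> - k.+1%:R < e -> measurable_fun setT u ->
  0 <= B -> 1 <= rho -> 0 <= D ->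
  (forall x, `|u x| <= B) -> (forall x, u x != 0 -> psum xpredT x <= rho) ->
  (forall x, u x != 0 -> 0 < enormk k.+1 x -> enormk k.+1 x < 1 ->
     enormk k.+1 x `^ (- (s * p - a - b)) <= D * enormk k.+1 x `^ e) ->
  (hardy_rhs s p k.+1 a b u < +oo)%E.
Proof.
move=> p0 tab e0 mu B0 r1 D0 hB hr hD.
set t := s * p - a - b in tab hD *.
have rho0 : 0 < rho by lra.
pose E : R := - k.+1%:R - 1.
have fr : (\int[L k.+1]_z (rad e E (enorm z))%:E < +oo)%E by apply: radial_fin; rewrite // /E; lra.
have mr := measurable_rad e E.
pose hb (z : 'rV[R]_m) : R := (1 + enorm z ^+ 2) `^ (- ((1 + m%:R) / 2)).
have fb : (\int[L m]_z (hb z)%:E < +oo)%E by rewrite integral_bessel ?ltry.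
have mhb : measurable_fun setT hb by rewrite /hb; mfv.
have hb0 z : 0 <= hb z by exact: powR_ge0.
pose C : R := B `^ p * (D + rho `^ (- E)) * (1 + rho) `^ ((1 + m%:R) / 2).
have C0 : 0 <= C by rewrite /C !mulr_ge0 ?addr_ge0 ?powR_ge0.
have bnd x : `|u x| `^ p / enormk k.+1 x `^ t <= C * (rad e E (enorm (lsubmx x)) * hb (rsubmx x)).
  have rhs0 : 0 <= C * (rad e E (enorm (lsubmx x)) * hb (rsubmx x)).
    by rewrite mulr_ge0// mulr_ge0 ?rad_ge0.
  have [u0|u0] := eqVneq (u x) 0.
    by rewrite u0 normr0 powR0 ?gt_eqF// mul0r.
  have := enormk_ge0 k.+1 x; rewrite le_eqVlt => /predU1P[/esym x0|x0].
    by rewrite x0 powR0 ?invr0 ?mulr0// gt_eqF.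
  have hx := hr x u0; rewrite sqr_enorm_split in hx.
  have zz := sqr_ge0 (enorm (rsubmx x)).
  have up : `|u x| `^ p <= B `^ p by apply: ge0_ler_powR; rewrite ?nnegrE ?hB// ltW.
  rewrite -powRN -enormk_lsubmx.
  have h1 : enormk k.+1 x `^ (- t) <= (D + rho `^ (- E)) * rad e E (enormk k.+1 x).
    have [x1|x1] := ltP (enormk k.+1 x) 1.
      rewrite rad_lt1//; apply: (le_trans (hD x u0 x0 x1)).
      by rewrite ler_wpM2r ?powR_ge0// lerDl powR_ge0.
    rewrite rad_ge1//; apply: (@le_trans _ _ 1).
      by rewrite powRN invf_le1 ?powR_gt0// -(powRr0 (enormk k.+1 x)) ler_powR// ltW.
    apply: (@le_trans _ _ (rho `^ (- E) * enormk k.+1 x `^ E)); last first.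
      by rewrite ler_wpM2r ?powR_ge0// lerDr.
    rewrite -[E in X in _ <= _ * X]opprK [_ `^ (- - E)]powRN ler_pdivlMr ?powR_gt0// mul1r.
    apply: ge0_ler_powR; rewrite ?nnegrE ?enormk_ge0 ?(ltW rho0)//.
      by rewrite /E opprD !opprK addr_ge0.
    nra.
  have h2 : 1 <= (1 + rho) `^ ((1 + m%:R) / 2) * hb (rsubmx x).
    rewrite /hb powRN ler_pdivlMr; last by rewrite powR_gt0// ltr_wpDr.
    rewrite mul1r.
    have a1 : 0 <= (1 + m%:R) / 2 :> R by rewrite divr_ge0// addr_ge0.
    have a2 : 1 + enorm (rsubmx x) ^+ 2 \is Num.nneg by rewrite nnegrE addr_ge0.
    have a3 : 1 + rho \is Num.nneg by rewrite nnegrE addr_ge0// ltW.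
    apply: (ge0_ler_powR a1 a2 a3); rewrite lerD2l.
    by have := sqr_ge0 (enormk k.+1 x); move: hx; lra.
  apply: (@le_trans _ _ (B `^ p * ((D + rho `^ (- E)) * rad e E (enormk k.+1 x)))).
    by rewrite ler_pM ?powR_ge0.
  rewrite /C [leRHS](_ : _ = B `^ p * ((D + rho `^ (- E)) * rad e E (enormk k.+1 x)) *
    ((1 + rho) `^ ((1 + m%:R) / 2) * hb (rsubmx x))); last by ring.
  by rewrite ler_peMr// !mulr_ge0 ?powR_ge0 ?rad_ge0// addr_ge0// powR_ge0.
apply: (@le_lt_trans _ _ (\int[L (k.+1 + m)]_x (C * (rad e E (enorm (lsubmx x)) * hb (rsubmx x)))%:E)%E).
  apply: ge0_le_integral => //.
  - by move=> x _; rewrite lee_fin mulr_ge0 ?powR_ge0// invr_ge0 powR_ge0.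
  - by mfv.
  - apply: mfun_EFin; apply: measurable_funM => //; apply: measurable_funM.
      by apply: (measurableT_comp mr); apply: mfun_enorm; exact: mfun_lsubmx.
    by apply: (measurableT_comp mhb); exact: mfun_rsubmx.
  - by move=> x _; rewrite lee_fin bnd.
rewrite integralZ//; last 2 first.
- apply: measurable_funM.
    by apply: (measurableT_comp mr); apply: mfun_enorm; exact: mfun_lsubmx.
  by apply: (measurableT_comp mhb); exact: mfun_rsubmx.
- by move=> x; rewrite mulr_ge0 ?rad_ge0.
rewrite (@integral_split_prod _ _ (fun a => rad e E (enorm a)) hb)//; last 2 first.
- by mfv.
- by move=> z; exact: rad_ge0.
rewrite lte_mul_pinfty// lte_mul_pinfty//.
- by apply: integral_ge0 => z _; rewrite lee_fin rad_ge0.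
- by rewrite ge0_fin_numE//; apply: integral_ge0 => z _; rewrite lee_fin rad_ge0.
Qed.

End rhs_finite.

(** * The Hardy inequality *)

Section hardy_case.
Context (R : realType).

Lemma hardy_constE (k m : nat) (s p a b : R) :
  hardy_const (k.+1 + m) s p k.+1 a b = gconst m (k.+1%:R + s * p) * hardy_C1 k.+1 s p a b.
Proof.
have e1 : (k.+1 + m)%:R - k.+1%:R = m%:R :> R by rewrite natrD; ring.
have e2 : (k.+1 + m)%:R + s * p = k.+1%:R + s * p + m%:R by rewrite natrD; ring.
by rewrite /hardy_const /gconst e1 e2.
Qed.

Lemma hardy_inequality_split (k m : nat) (s p a b g : R) (Om : set 'rV[R]_(k.+1 + m)) :
  1 <= p -> 0 < s < 1 -> - k.+1%:R < a < s * p -> - k.+1%:R < b < s * p ->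
  0 < s * p - a - b -> g * p = k.+1%:R + a + b - s * p -> g != 0 ->
  s * p < k.+1%:R + a + b \/ Om = ~` @Kset R k.+1 (k.+1 + m) ->
  0 < hardy_const (k.+1 + m) s p k.+1 a b /\
  hardy_inequality s p k.+1 a b Om (hardy_const (k.+1 + m) s p k.+1 a b).
Proof.
move=> p1 s01 ha hb tab gp gn0 hOm.
have p0 : 0 < p := lt_le_trans ltr01 p1.
have t0 : 0 < s * p by rewrite mulr_gt0//; case/andP: s01.
have [C0 CJ] := hardy_C1_Jint p1 s01 ha hb gp gn0.
have G0 : 0 < gconst m (k.+1%:R + s * p) by rewrite gconst_gt0// addr_gt0.
rewrite hardy_constE; split; first by rewrite mulr_gt0.
move=> u Cu; have mu : measurable_fun setT u.
  by apply: continuous_mfun_rV; apply: cd_continuous; case: Cu.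
have [B [rho [B0 r1 hB hr]]] := C1c_bounds Cu.
have Sf : (hardy_rhs s p k.+1 a b u < +oo)%E.
  case: hOm => [hlt|hK].
    (* In this case the weight is itself locally integrable: -(sp - a - b) > -(k+1). *)
    apply: (hardy_rhs_fin (e := - (s * p - a - b)) (D := 1) p0 tab _ mu B0 r1 ler01 hB hr).
      by lra.
    by move=> x _ _ _; rewrite mul1r.
  have [de de0 hde] : exists2 de : R, 0 < de &
      forall x, u x != 0 -> de <= psum (fun i : 'I_(k.+1 + m) => (i < k.+1)%N) x.
    by apply: C1c_away; rewrite -hK.
  have sde : 0 < Num.sqrt de by rewrite sqrtr_gt0.
  (* On the support of u one has |x_k|^2 >= de, so the weight is bounded there. *)
  apply: (hardy_rhs_fin (e := 0) (D := Num.sqrt de `^ (- (s * p - a - b))) p0 tab _ mu B0 r1 _ hB hr).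
  - by rewrite oppr_lt0 ltr0n.
  - exact: powR_ge0.
  move=> x ux x0 _; rewrite powRr0 mulr1 !powRN lef_pV2 ?posrE ?powR_gt0//.
  apply: ge0_ler_powR; rewrite ?nnegrE ?sqrtr_ge0 ?(ltW tab)//.
  by apply: ler_wsqrtr; exact: hde.
have Jf : (Jint k ((k.+1%:R + s * p) / 2) (hgt g p b) < +oo)%E by rewrite -CJ ltry.
have := hardy_lower p1 t0 tab gp gn0 mu Sf Jf.
by rewrite -CJ -EFinM muleC.
Qed.

End hardy_case.

(** * Test functions *)

Section log_cutoff.
Context (R : realType).
Variables (g N : R).
Hypothesis N0 : 0 < N.

(** A C^1 bump of height 1 supported in [-N, N]. Evaluated at ln |x_k| it varies by O(1/N) per unit
    of the logarithm. *)
Definition logcut (t : R) : R := sqpos (1 - (t / N) ^+ 2).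

Let F (t : R) : R := expR (- g * t) * logcut t.
Let F' (t : R) : R := expR (- g * t) * (2 * Num.max (1 - (t / N) ^+ 2) 0 * (- (2 * t / N ^+ 2))) +
   logcut t * (expR (- g * t) * - g).

Let is_derive_F (t : R) : is_derive t 1 F (F' t).
Proof.
have h1 : is_derive t (1 : R) (fun t : R => - g * t) (- g).
  have h := is_deriveZ (- g) (is_derive_id t (1 : R)).
  by apply: (is_derive_eq h); rewrite /GRing.scale/= mulr1.
have h2 : is_derive t (1 : R) (fun t : R => 1 - (t / N) ^+ 2) (- (2 * t / N ^+ 2)).
  have h := is_deriveB (is_derive_cst (1 : R) t (1 : R)) (is_deriveX 2 (is_deriveZ N^-1 (is_derive_id t (1 : R)))).
  have -> : (fun t : R => 1 - (t / N) ^+ 2) = cst 1 - (N^-1 \*: id) ^+ 2.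
    by apply/funext => x; rewrite !fctE/= mulrC.
  apply: (is_derive_eq h); rewrite /GRing.scale/= mulr1 expr1 sub0r -mulr_natl.
  by rewrite -[_ *: t]/(N^-1 * t); congr (- _); field; rewrite gt_eqF.
have h3 := @is_derive1_comp _ expR (fun t : R => - g * t) t _ _ (is_derive_expR _) h1.
have h4 := @is_derive1_comp _ (@sqpos R) (fun t : R => 1 - (t / N) ^+ 2) t _ _ (is_derive_sqpos _) h2.
have h := is_deriveM h3 h4.
by apply: (is_derive_eq h); rewrite /F' /logcut /GRing.scale/=.
Qed.

Let cont_is_derive (f f' : R -> R) : (forall t : R, is_derive t 1 f (f' t)) -> continuous f.
Proof.
move=> h t; apply: differentiable_continuous; apply/derivable1_diffP.
by case: (h t).
Qed.

Let cF' : continuous F'.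
Proof.
have e1 : continuous (fun t : R => expR (- g * t)).
  move=> t; apply: (@continuous_comp _ _ _ (fun t : R => - g * t) expR); last exact: continuous_expR.
  by apply: (continuousM (@cst_continuous _ _ (- g) t)); exact: cvg_id.
have id_c : continuous (id : R -> R) by move=> t; exact: cvg_id.
have e2 : continuous (fun t : R => t / N).
  by move=> t; exact: (continuousM (id_c t) (@cst_continuous _ _ N^-1 t)).
have e3 : continuous (fun t : R => 1 - (t / N) ^+ 2).
  move=> t; apply: (continuousB (@cst_continuous _ _ (1 : R) t)).
  exact: (continuousM (e2 t) (e2 t)).
have e4 : continuous (fun t : R => 2 * Num.max (1 - (t / N) ^+ 2) 0).
  by move=> t; apply: (@continuous_comp _ _ _ (fun t : R => 1 - (t / N) ^+ 2) (fun t => 2 * Num.max t 0)); [exact: e3|exact: continuous_maxr0].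
have e5 : continuous (fun t : R => - (2 * t / N ^+ 2)).
  rewrite (_ : (fun t : R => _) = (fun t : R => - 2 * t / N ^+ 2)); last by apply/funext => t; rewrite !mulNr.
  move=> t; exact: (continuousM (continuousM (@cst_continuous _ _ (- 2 : R) t) (id_c t)) (@cst_continuous _ _ (N ^+ 2)^-1 t)).
have e7 : continuous (@sqpos R).
  apply: (cont_is_derive (f' := fun t => 2 * Num.max t 0)) => t; exact: is_derive_sqpos.
have e6 : continuous logcut.
  move=> t; apply: (@continuous_comp _ _ _ (fun t : R => 1 - (t / N) ^+ 2) (@sqpos R)); first exact: e3.
  exact: e7.
move=> t; apply: (continuousD (continuousM (e1 t) (continuousM (e4 t) (e5 t)))).
exact: (continuousM (e6 t) (continuousM (e1 t) (@cst_continuous _ _ (- g) t))).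
Qed.

(** The function x^(-g) [logcut] (ln x), extended by 0 to x <= 0; it already vanishes for x <=
    e^(-N), so the extension is C^1. *)
Definition radialcut (x : R) : R := F (ln x) * (0 < x)%R%:R.

Lemma logcut_eq0 t : N <= `|t| -> logcut t = 0.
Proof.
move=> h; rewrite /logcut sqpos_le0// subr_le0 -real_normK ?num_real//.
rewrite exprn_ege1// normrM normfV (gtr0_norm N0) ler_pdivlMr// mul1r//.
Qed.

Lemma C1_radialcut : exists2 f' : R -> R,
  (forall x : R, is_derive x 1 radialcut (f' x)) & continuous f'.
Proof.
pose f' (x : R) : R := F' (ln x) * x^-1 * (0 < x)%R%:R.
suff [h1 h2] : (forall x : R, is_derive x 1 radialcut (f' x)) /\ continuous f' by exists f'.
have smallN (x : R) : 0 < x -> x < expR (- N) -> N <= `|ln x|.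
  move=> x0 h; rewrite ler_normr; apply/orP; right; rewrite lerNr; apply: ltW.
  by rewrite -(expRK (- N)) ltr_ln ?posrE ?expR_gt0.
apply: (@is_derive_glue R (expR (- N))); first exact: expR_gt0.
- move=> x h; rewrite /radialcut; case: ltP => [x0|_]; last by rewrite mulr0.
  by rewrite /F logcut_eq0 ?smallN// mulr0 mul0r.
- move=> x h; rewrite /f'; case: ltP => [x0|_]; last by rewrite mulr0.
  have hN := smallN x x0 h.
  rewrite /F' logcut_eq0// max_r; first by rewrite !(mulr0, mul0r) addr0 !mul0r.
  rewrite subr_le0 -real_normK ?num_real// exprn_ege1// normrM normfV (gtr0_norm N0).
  by rewrite ler_pdivlMr// mul1r.
- move=> x x0; rewrite /f' x0 mulr1.
  have h := @is_derive1_comp _ F (@ln R) x _ _ (is_derive_F _) (is_derive1_ln x0).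
  apply: (near_eq_is_derive _ h); near=> y; rewrite /radialcut /= (_ : 0 < y) ?mulr1//.
  by near: y; exact: lt_nbhsr.
- move=> x x0; have h : {for x, continuous (fun x : R => F' (ln x) * x^-1)}.
    apply: continuousM; last by apply: inv_continuous; rewrite gt_eqF.
    by apply: continuous_comp; [exact: continuous_ln|exact: cF'].
  have e : f' x = F' (ln x) * x^-1 by rewrite /f' x0 mulr1.
  rewrite /prop_for /continuous_at e; apply: cvg_trans h.
  apply: near_eq_cvg; near=> y; rewrite /f' (_ : 0 < y) ?mulr1//.
  by near: y; exact: lt_nbhsr.
Unshelve. all: by end_near. Qed.

End log_cutoff.
Section logcut_estimates.
Context (R : realType).
Variables (N : R).
Hypothesis N0 : 0 < N.

Lemma logcut_ge0 t : 0 <= logcut N t. Proof. exact: sqpos_ge0. Qed.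

Lemma logcut_le1 t : logcut N t <= 1.
Proof. by apply: sqpos_le1; rewrite gerBl sqr_ge0. Qed.

Lemma logcut_half t : `|t| <= N / 2 -> 2^-1 <= logcut N t.
Proof.
move=> h; have x0 : 0 <= (t / N) ^+ 2 by exact: sqr_ge0.
have x1 : (t / N) ^+ 2 <= 4^-1.
  rewrite -real_normK ?num_real// (_ : 4^-1 = 2^-1 ^+ 2 :> R); last by field.
  rewrite ler_sqr ?nnegrE// normrM normfV (gtr0_norm N0) ler_pdivrMr//.
  by rewrite mulrC.
rewrite /logcut /sqpos max_l; last by lra.
nra.
Qed.

(** Shows the cutoff as a polynomial in min(1, |t|/N), from which its Lipschitz constant is read. *)
Lemma logcutE t : logcut N t = (1 - min1 (t / N) ^+ 2) ^+ 2.
Proof.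
rewrite /logcut /sqpos /min1; set y := t / N; rewrite minElt; case: ltP => h.
  rewrite max_r ?expr1n ?subrr// subr_le0 -real_normK ?num_real//.
  by rewrite exprn_ege1// ltW.
by rewrite real_normK ?num_real// max_l// subr_ge0 -real_normK ?num_real// exprn_ile1.
Qed.

Lemma min1_lip (x y : R) : `|min1 x - min1 y| <= `|x - y|.
Proof.
have d := ler_dist_dist x y; apply: le_trans d; rewrite /min1 !minElt.
move: (`|x|) (`|y|) => X Y; rewrite !ler_norml.
have n1 := ler_norm (X - Y); have n2 : - `|X - Y| <= X - Y by rewrite lerNl -normrN ler_norm.
by case: ltP => h1; case: ltP => h2; apply/andP; split; lra.
Qed.

Lemma logcut_lip t t' : `|logcut N t - logcut N t'| <= 4 * (`|t - t'| / N).
Proof.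
rewrite !logcutE; set c := min1 _; set d := min1 _.
have [c0 c1] : 0 <= c /\ c <= 1 by split; [exact: min1_ge0|exact: min1_le1].
have [d0 d1] : 0 <= d /\ d <= 1 by split; [exact: min1_ge0|exact: min1_le1].
have h : `|c - d| <= `|t - t'| / N.
  apply: (le_trans (min1_lip _ _)); rewrite -mulrBl normrM normfV (gtr0_norm N0)//.
apply: (@le_trans _ _ (4 * `|c - d|)); last by rewrite ler_wpM2l.
(* With c and d in [0, 1] both c + d and 2 - c^2 - d^2 lie in [0, 2], whence the constant 4. *)
have -> : (1 - c ^+ 2) ^+ 2 - (1 - d ^+ 2) ^+ 2 = - ((c + d) * (2 - c ^+ 2 - d ^+ 2)) * (c - d) by ring.
rewrite normrM ler_wpM2r// normrN ger0_norm; nra.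
Qed.

End logcut_estimates.

Section test_function.
Context (R : realType).
Variables (k m : nat) (g N M : R).
Hypotheses (N0 : 0 < N) (M0 : 0 < M).
Local Notation n := (k.+1 + m)%N.

Let Pk : 'rV[R]_n -> R := psum (fun i : 'I_n => (i < k.+1)%N).
Let Qk : 'rV[R]_n -> R := psum (fun i : 'I_n => ~~ (i < k.+1)%N).

(** The ground state |x_k|^(-g) times two cutoffs, expressed through squared norms so as to be C^1:
    hence the exponent g/2, and the size 2N because ln |x_k|^2 = 2 ln |x_k|. [testfunE] gives the
    transparent form. *)
Definition testfun (x : 'rV[R]_n) : R :=
  radialcut (g / 2) (2 * N) (Pk x) * sqpos (1 - Qk x / M ^+ 2).

Definition cutoff (x : 'rV[R]_n) : R :=
  logcut N (ln (enormk k.+1 x)) * logcut M (enorm (rsubmx x)).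

Let QkE x : Qk x = enorm (rsubmx x) ^+ 2.
Proof.
have := sqr_enorm_split x; rewrite /psum (bigID (fun i : 'I_n => (i < k.+1)%N))/=.
by rewrite sqr_sqrtr ?psum_ge0// => /addrI.
Qed.

Let PkE x : Pk x = enormk k.+1 x ^+ 2.
Proof. by rewrite sqr_sqrtr ?psum_ge0. Qed.

Lemma testfunE x : 0 < enormk k.+1 x -> testfun x = enormk k.+1 x `^ (- g) * cutoff x.
Proof.
move=> x0; rewrite /testfun /radialcut PkE QkE exprn_gt0// mulr1 /cutoff mulrA.
have -> : ln (enormk k.+1 x ^+ 2) = 2 * ln (enormk k.+1 x) by rewrite lnXn// mulr_natl.
congr (_ * _ * _).
- by rewrite /powR gt_eqF//; congr expR; field.
- rewrite /logcut; congr (sqpos (1 - _ ^+ 2)); field.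
  by rewrite gt_eqF.
- by rewrite /logcut expr_div_n.
Qed.

Lemma testfun0 x : enormk k.+1 x = 0 -> testfun x = 0.
Proof. by move=> x0; rewrite /testfun /radialcut PkE x0 expr0n ltxx mulr0 mul0r. Qed.

Let supp_testfun x : testfun x != 0 ->
  [/\ expR (- (2 * N)) <= Pk x, Pk x <= expR (2 * N) & Qk x <= M ^+ 2].
Proof.
move=> h; have [P0|P0] := ltP 0 (Pk x); last first.
  by move: h; rewrite /testfun /radialcut ltNge P0/= mulr0 mul0r eqxx.
have N2 : 0 < 2 * N by rewrite mulr_gt0.
have hl : `|ln (Pk x)| < 2 * N.
  rewrite ltNge; apply/negP => hN; move: h.
  by rewrite /testfun /radialcut (logcut_eq0 N2 hN) mulr0 !mul0r eqxx.
move: hl; rewrite ltr_norml => /andP[l1 l2].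
split.
- by rewrite -[Pk x]lnK ?posrE// ler_expR ltW.
- by rewrite -[Pk x]lnK ?posrE// ler_expR ltW.
- rewrite leNgt; apply/negP => hQ; move: h; rewrite /testfun sqpos_le0 ?mulr0 ?eqxx//.
  by rewrite subr_le0 ler_pdivlMr ?exprn_gt0// mul1r ltW.
Qed.

Lemma cd_testfun : continuously_differentiable testfun.
Proof.
have N2 : 0 < 2 * N by rewrite mulr_gt0.
have [f' df cf] := C1_radialcut (g / 2) N2.
apply: (@cd_mul R n (fun x => radialcut (g / 2) (2 * N) (Pk x)) (fun x => sqpos (1 - Qk x / M ^+ 2))).
  exact: (cd_comp df cf (@cd_psum R n _)).
have h : continuously_differentiable (fun x => 1 + (- (M ^+ 2)^-1) * Qk x).
  by apply: cd_add; [exact: cd_cst|apply: cd_mul; [exact: cd_cst|exact: cd_psum]].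
have := cd_comp (@is_derive_sqpos R) (@continuous_maxr0 R) h.
rewrite (_ : (fun x => sqpos (1 + _)) = (fun x => sqpos (1 - Qk x / M ^+ 2)))//.
by apply/funext => x; rewrite mulNr mulrC.
Qed.

(** The support lies in the closed bounded set A, on which |x_k|^2 >= e^(-2N); so it is compact and
    avoids K. *)
Lemma C1c_testfun : C1c (~` @Kset R k.+1 n) testfun.
Proof.
pose A : set 'rV[R]_n := [set x | expR (- (2 * N)) <= Pk x] `&` [set x | Pk x <= expR (2 * N)] `&`
  [set x | Qk x <= M ^+ 2].
have clA : closed A.
  have cP : continuous Pk by exact: psum_continuous.
  have cQ : continuous Qk by exact: psum_continuous.
  have clp (f : 'rV[R]_n -> R) (D : set R) : continuous f -> closed D -> closed (f @^-1` D).
    by move=> cf cD; apply: closed_comp => // x _; exact: cf.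
  apply: closedI; first apply: closedI.
  - exact: (clp Pk [set y | expR (- (2 * N)) <= y] cP (@closed_ge R _)).
  - exact: (clp Pk [set y | y <= expR (2 * N)] cP (@closed_le R _)).
  - exact: (clp Qk [set y | y <= M ^+ 2] cQ (@closed_le R _)).
have sA : tsupport testfun `<=` A.
  rewrite /tsupport closureE; apply: smallest_sub => //.
  by move=> x /= /supp_testfun[].
have cA : compact A.
  pose B := expR (2 * N) + M ^+ 2 + 1.
  have cB : compact [set v : 'rV[R]_n | forall i, `[- B, B]%classic (v ord0 i)].
    by apply: (@rV_compact R n (fun=> `[- B, B]%classic)) => i; exact: segment_compact.
  apply: (subclosed_compact clA cB).
  move=> x [[/= _ h1] h2] i; rewrite /= in_itv/= -ler_norml.
  have hi : x ord0 i ^+ 2 <= expR (2 * N) + M ^+ 2.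
    case hk : (i < k.+1)%N.
      apply: (le_trans (@psum_coord R n (fun i => (i < k.+1)%N) x i hk)).
      by apply: (le_trans h1); rewrite lerDl sqr_ge0.
    apply: (le_trans (@psum_coord R n (fun i => ~~ (i < k.+1)%N) x i (negbT hk))).
    by apply: (le_trans h2); rewrite lerDr expR_ge0.
  have B1 : 1 <= B by rewrite /B lerDr addr_ge0 ?expR_ge0 ?sqr_ge0.
  rewrite -ler_sqr ?nnegrE//; last by lra.
  rewrite real_normK ?num_real//; apply: (le_trans hi).
  apply: (@le_trans _ _ B); first by rewrite /B lerDl.
  nra.
split; first exact: cd_testfun.
  apply: (subclosed_compact _ cA sA); exact: closed_closure.
move=> x /sA[[/= h1 _] _] hK; have := expR_gt0 (- (2 * N)).
rewrite ltNge; move/negP; apply; apply: (le_trans h1).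
rewrite /Pk /psum big1// => i ik; by rewrite hK// expr0n.
Qed.

Lemma cutoff_ge0 x : 0 <= cutoff x.
Proof. by rewrite mulr_ge0 ?logcut_ge0. Qed.

Lemma cutoff_le1 x : cutoff x <= 1.
Proof. by rewrite -[leRHS]mulr1 ler_pM ?logcut_ge0 ?logcut_le1. Qed.

Lemma cutoff_out x : ~~ ((`|ln (enormk k.+1 x)| <= N) && (enorm (rsubmx x) <= M)) -> cutoff x = 0.
Proof.
rewrite negb_and -!ltNge => /orP[h|h]; first by rewrite /cutoff (logcut_eq0 N0) ?mul0r// ltW.
by rewrite /cutoff [X in _ * X](logcut_eq0 M0) ?mulr0// ger0_norm ?enorm_ge0// ltW.
Qed.

Lemma cutoffB x y : `|cutoff x - cutoff y| <=
  `|logcut N (ln (enormk k.+1 x)) - logcut N (ln (enormk k.+1 y))| +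
  `|logcut M (enorm (rsubmx x)) - logcut M (enorm (rsubmx y))|.
Proof.
rewrite /cutoff; set c := logcut N _; set c' := logcut N _; set e := logcut M _; set e' := logcut M _.
have -> : c * e - c' * e' = (c - c') * e + c' * (e - e') by ring.
apply: (le_trans (ler_normD _ _)); rewrite (normrM (c - c')) (normrM c') lerD//.
  by rewrite ler_piMr// ger0_norm ?logcut_ge0 ?logcut_le1.
by rewrite ler_piMl// ger0_norm ?logcut_ge0 ?logcut_le1.
Qed.

End test_function.

(** * Oscillation of the cutoff in the last coordinates *)

Section perpendicular.
Context (R : realType).
Notation L := (lebesgue_rV R).

(** K is the fibre over 0 of the first block, hence a null set; integrands need only be compared off
    K. *)
Lemma integral_enormk_gt0 k m (f : 'rV[R]_(k.+1 + m) -> \bar R) :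
  measurable_fun setT f -> (forall x, (0 <= f x)%E) ->
  (\int[L (k.+1 + m)]_x f x = \int[L (k.+1 + m)]_x (f x * (0 < enormk k.+1 x)%R%:R%:E))%E.
Proof.
move=> mf f0.
have mf2 : measurable_fun setT (fun x : 'rV[R]_(k.+1 + m) => f x * (0 < enormk k.+1 x)%R%:R%:E)%E.
  by apply: emeasurable_funM => //; mfv.
have f2 x : (0 <= f x * (0 < enormk k.+1 x)%R%:R%:E)%E by rewrite mule_ge0.
rewrite (integral_rV_split mf f0) (integral_rV_split mf2 f2).
rewrite (@integral_neq R k 0); last 2 first.
- apply: (@mfun_int R _ _ _ _ (L m) (fun a b => f (row_mx a b))); last by move=> a b; exact: f0.
  by apply: (measurableT_comp mf); mfv.
- by move=> a; apply: integral_ge0.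
rewrite [RHS](@integral_neq R k 0); last 2 first.
- apply: (@mfun_int R _ _ _ _ (L m) (fun a b => f (row_mx a b) * (0 < enormk k.+1 (row_mx a b))%R%:R%:E)%E).
    by apply: (measurableT_comp mf2); mfv.
  by move=> a b; exact: f2.
- by move=> a; apply: integral_ge0.
apply: eq_integral => a _; have [->|a0] := eqVneq a 0; first by rewrite !mule0.
rewrite !mule1; apply: eq_integral => b _.
by rewrite enormk_row_mx enorm_gt0 a0 mule1.
Qed.

Lemma enorm_dist m (b b' : 'rV[R]_m) : `|enorm b - enorm b'| <= enorm (b - b').
Proof.
have CS : dotv b b' <= enorm b * enorm b'.
  have [b0|b0] := eqVneq b 0; first by rewrite b0 dotvC dotv0 enorm0 mul0r.
  have [b1|b1] := eqVneq b' 0; first by rewrite b1 dotv0 enorm0 mulr0.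
  have x0 : 0 < enorm b by rewrite enorm_gt0.
  have y0 : 0 < enorm b' by rewrite enorm_gt0.
  have dZl c (x y : 'rV[R]_m) : dotv (c *: x) y = c * dotv x y by rewrite dotvC dotvZ dotvC.
  have := dotvv_ge0 (enorm b' *: b - enorm b *: b').
  rewrite dotvBB !dotvZ !dZl -!sqr_enorm => h.
  have : 0 <= 2 * (enorm b * enorm b') * (enorm b * enorm b' - dotv b b').
    by apply: le_trans h _; rewrite le_eqVlt; apply/orP; left; apply/eqP; ring.
  by rewrite pmulr_rge0 ?subr_ge0// !mulr_gt0.
rewrite -ler_sqr ?nnegrE ?enorm_ge0// real_normK ?num_real//.
rewrite [leRHS]sqr_enorm dotvBB -!sqr_enorm sqrrB; lra.
Qed.

Lemma enorm_rsubmx_le k m (x y : 'rV[R]_(k + m)) : enorm (rsubmx x - rsubmx y) <= enorm (x - y).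
Proof.
rewrite -ler_sqr ?nnegrE ?enorm_ge0//.
rewrite -[in leRHS](hsubmxK x) -[in leRHS](hsubmxK y) opp_row_mx add_row_mx sqr_enorm_row_mx.
by rewrite lerDr sqr_ge0.
Qed.

Definition perp_osc k m (p M : R) (x y : 'rV[R]_(k + m)) : R :=
  `|logcut M (enorm (rsubmx x)) - logcut M (enorm (rsubmx y))| `^ p.

(** The increment D of the cutoff is at most 1 and at most (4/M) |x - y|, so D^p <= D^sg for every
    sg <= p, and the order of vanishing can be chosen freely up to p. *)
Lemma perp_osc_le k m (p M sg : R) (x y : 'rV[R]_(k + m)) : 0 < M -> 0 <= sg <= p ->
  perp_osc p M x y <= (4 / M) `^ sg * enorm (x - y) `^ sg.
Proof.
move=> M0 /andP[s0 sp]; rewrite /perp_osc; pose D : R := `|logcut M (enorm (rsubmx x)) - logcut M (enorm (rsubmx y))|; rewrite -/D.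
have D0 : 0 <= D by exact: normr_ge0.
have D1 : D <= 1.
  have := logcut_ge0 M (enorm (rsubmx x)); have := logcut_ge0 M (enorm (rsubmx y)).
  have := logcut_le1 M (enorm (rsubmx x)); have := logcut_le1 M (enorm (rsubmx y)).
  by rewrite /D ler_norml; move=> *; apply/andP; split; lra.
have D2 : D <= 4 / M * enorm (x - y).
  apply: (le_trans (logcut_lip M0 _ _)).
  have h : `|enorm (rsubmx x) - enorm (rsubmx y)| <= enorm (x - y).
    exact: le_trans (enorm_dist _ _) (enorm_rsubmx_le _ _).
  by rewrite -mulrA ler_wpM2l// mulrC ler_wpM2l// invr_ge0 ltW.
rewrite -powRM ?divr_ge0 ?enorm_ge0 ?(ltW M0)//.
apply: (@le_trans _ _ (D `^ sg)); last first.
  have d0 : 0 <= 4 / M * enorm (x - y) by rewrite mulr_ge0 ?enorm_ge0// divr_ge0// ltW.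
  exact: (ge0_ler_powR s0 D0 d0 D2).
(* Comparing exponents needs a positive base; at D = 0 the exponent 0 is special because 0^0 is
   1. *)
have [->|Dn] := eqVneq D 0.
  have [->|sn] := eqVneq sg 0; first by rewrite powRr0 powR_le1// ?lexx ?ler01//; exact: le_trans sp.
  by rewrite !powR0//; apply/eqP => p0; move: sn sp; rewrite p0 => sn h; move/negP: sn; apply; rewrite eq_le h s0.
by apply: ger_powR => //; rewrite lt_neqAle eq_sym Dn D0.
Qed.

Lemma measurable_perp_osc k m (p M : R) (x : 'rV[R]_(k + m)) :
  measurable_fun setT (fun y => perp_osc p M x y).
Proof.
have mr := @mfun_rsubmx R k m; rewrite /perp_osc /logcut /sqpos.
apply: mfun_powR; apply: mfun_norm; apply: measurable_funB => //.
apply: measurable_funX; apply: measurable_maxr => //; apply: measurable_funB => //.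
by apply: measurable_funX; apply: measurable_funM => //; exact: mfun_enorm.
Qed.

(** The power |x - y|^s gained from [perp_osc_le] lowers the order of the kernel, and
    [integral_fiber] applies with q = k + 1 + t - s. *)
Lemma perp_fiber k m (p t s M c : R) (a a' : 'rV[R]_k.+1) (b : 'rV[R]_m) :
  0 < M -> 0 <= s <= p -> s < k.+1%:R + t -> a != 0 -> a' != a -> 0 <= c ->
  (\int[L m]_b' (c * perp_osc p M (row_mx a b) (row_mx a' b') *
     enorm (row_mx a b - row_mx a' b') `^ (- ((k.+1 + m)%:R + t)))%:E <=
   (c * (gconst m (k.+1%:R + t - s) * (4 * enorm a / M) `^ s * enorm a `^ (- (k.+1%:R + t)) *
      (enorm (a - a') / enorm a) `^ (- (k.+1%:R + t - s))))%:E)%E.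
Proof.
move=> M0 hs sk a0 aa' c0.
have na : 0 < enorm a by rewrite enorm_gt0.
have v0 : 0 < enorm (a - a') by rewrite enorm_gt0 subr_eq0 eq_sym.
have q0 : 0 < k.+1%:R + t - s by rewrite subr_gt0.
have mpo := @measurable_perp_osc k.+1 m p M (row_mx a b).
apply: (@le_trans _ _ (\int[L m]_b' ((c * (4 / M) `^ s) *
    enorm (row_mx a b - row_mx a' b') `^ (- (k.+1%:R + t - s + m%:R)))%:E)%E).
  apply: ge0_le_integral => //.
  - by move=> b' _; rewrite lee_fin !mulr_ge0 ?powR_ge0.
  - apply: mfun_EFin; apply: measurable_funM; last by mfv.
    by apply: measurable_funM => //; apply: (measurableT_comp mpo); mfv.
  - by mfv.
  move=> b' _; rewrite lee_fin -!mulrA ler_wpM2l//.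
  have w0 : enorm (row_mx a b - row_mx a' b') != 0.
    rewrite -sqrf_eq0 opp_row_mx add_row_mx sqr_enorm_row_mx gt_eqF//.
    by rewrite ltr_wpDr ?sqr_ge0// exprn_gt0.
  have h := perp_osc_le (row_mx a b) (row_mx a' b') M0 hs.
  have e : enorm (row_mx a b - row_mx a' b') `^ (- (k.+1%:R + t - s + m%:R)) =
      enorm (row_mx a b - row_mx a' b') `^ s * enorm (row_mx a b - row_mx a' b') `^ (- ((k.+1 + m)%:R + t)).
    by rewrite -powRD ?w0 ?implybT// natrD; congr (_ `^ _); ring.
  by rewrite e mulrA ler_wpM2r ?powR_ge0.
rewrite integralZ; last 3 first.
- by mfv.
- by move=> b'; exact: powR_ge0.
- by rewrite mulr_ge0 ?powR_ge0.
rewrite (integral_fiber b q0 aa') -EFinM lee_fin le_eqVlt; apply/orP; left; apply/eqP.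
have -> : (4 * enorm a / M) `^ s = (4 / M) `^ s * enorm a `^ s.
  by rewrite -powRM ?divr_ge0 ?(ltW na) ?(ltW M0)//; congr (_ `^ _); ring.
have -> : (enorm (a - a') / enorm a) `^ (- (k.+1%:R + t - s)) =
    enorm (a - a') `^ (- (k.+1%:R + t - s)) * enorm a `^ (k.+1%:R + t - s).
  by rewrite powRM ?invr_ge0 ?enorm_ge0// powRV ?enorm_ge0// opprK.
have e1 : enorm a `^ s * enorm a `^ (- (k.+1%:R + t)) * enorm a `^ (k.+1%:R + t - s) = 1.
  rewrite -!powRD ?(gt_eqF na) ?implybT// (_ : s + - (k.+1%:R + t) + (k.+1%:R + t - s) = 0).
    exact: powRr0.
  by ring.
move: (gconst _ _) => y.
rewrite -[LHS]mulr1 -[X in _ * X = _]e1; ring.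
Qed.

(** The bound of exponent s1 is used for V <= 1 and that of exponent s0 for V > 1; the factor min(1,
    V)^(s1-s0) expresses both at once. *)
Lemma kernel_interpolation (J : \bar R) (c H B0 B1 V q s0 s1 : R) : 0 < V -> 0 <= c ->
  B0 <= H -> B1 <= H ->
  (J <= (c * (B0 * V `^ (- (q - s0))))%:E)%E -> (J <= (c * (B1 * V `^ (- (q - s1))))%:E)%E ->
  (J <= (H * (c * min1 V `^ (s1 - s0) * V `^ (- (q - s0))))%:E)%E.
Proof.
move=> V0 c0 h0 h1 f0 f1; have [v1|v1] := leP V 1.
  apply: (le_trans f1); rewrite lee_fin.
  have -> : c * min1 V `^ (s1 - s0) * V `^ (- (q - s0)) = c * V `^ (- (q - s1)).
    rewrite /min1 (gtr0_norm V0) min_r// -mulrA -powRD ?(gt_eqF V0) ?implybT//.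
    by congr (_ * _ `^ _); ring.
  by rewrite mulrCA ler_wpM2r// mulr_ge0 ?powR_ge0.
apply: (le_trans f0); rewrite lee_fin.
rewrite /min1 (gtr0_norm V0) min_l ?(ltW v1)// powR1 mulr1.
by rewrite mulrCA ler_wpM2r// mulr_ge0 ?powR_ge0.
Qed.

(* Near [x] the oscillation is estimated with the exponent [s1 > t], far from
   [x] with [s0 < t]. *)
Lemma perp_kernel k m (p t th s0 s1 : R) : 0 < t ->
  0 < s0 -> s0 < t -> s0 < t - th -> t < s1 -> s1 <= p -> s1 < k.+1%:R + t -> - k.+1%:R < th ->
  exists2 A : R, 0 <= A & forall M (x : 'rV[R]_(k.+1 + m)), 0 < M -> 0 < enormk k.+1 x ->
  (\int[L (k.+1 + m)]_y ((enormk k.+1 y / enormk k.+1 x) `^ th * perp_osc p M x y *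
     enorm (x - y) `^ (- ((k.+1 + m)%:R + t)))%:E <=
   (A * enormk k.+1 x `^ (- t) *
     ((4 * enormk k.+1 x / M) `^ s0 + (4 * enormk k.+1 x / M) `^ s1))%:E)%E.
Proof.
move=> t0 s00 s0t s0th ts1 s1p s1k th0.
(* The interpolated kernel has order t - s0, which is positive and above th, and s1 - s0 exceeds
   this order. *)
have F : (\int[L k.+1]_z (enorm z `^ th * min1 (enorm (e0 R k - z)) `^ (s1 - s0) *
      enorm (e0 R k - z) `^ (- (k.+1%:R + (t - s0))))%:E < +oo)%E.
  by apply: kernel_fin; [lra|apply/andP; split; lra|lra].
have k0 : 0 <= k.+1%:R :> R by [].
have s0k : s0 < k.+1%:R + t by lra.
have s0p : 0 <= s0 <= p by apply/andP; split; lra.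
have s1p' : 0 <= s1 <= p by apply/andP; split; lra.
have eq : k.+1%:R + (t - s0) = k.+1%:R + t - s0 by ring.
rewrite eq in F; clear eq s0t s0th ts1 s1p th0 k0.
set I := (\int[L k.+1]_z _)%E in F.
have I0 : (0 <= I)%E by apply: integral_ge0 => z _; rewrite lee_fin !mulr_ge0 ?powR_ge0.
have Ifin : I \is a fin_num by rewrite ge0_fin_numE.
have I'0 : 0 <= fine I by rewrite fine_ge0.
have G00 : 0 <= gconst m (k.+1%:R + t - s0) by apply/ltW/gconst_gt0; rewrite subr_gt0.
have G10 : 0 <= gconst m (k.+1%:R + t - s1) by apply/ltW/gconst_gt0; rewrite subr_gt0.
exists ((gconst m (k.+1%:R + t - s0) + gconst m (k.+1%:R + t - s1)) * fine I).
  by rewrite (mulr_ge0 (addr_ge0 G00 G10) I'0).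
move=> M x M0; rewrite -(hsubmxK x) enormk_row_mx enorm_gt0 => a0.
move: (lsubmx x) (rsubmx x) a0 => a b a0 {x}.
have na : 0 < enorm a by rewrite enorm_gt0.
have vpos a' : a' != a -> 0 < enorm (a - a') / enorm a.
  by move=> h; apply: divr_gt0 na; rewrite enorm_gt0 subr_eq0 eq_sym.
have fib0 a' := @perp_fiber k m p t s0 M ((enorm a' / enorm a) `^ th) a a' b M0 s0p s0k a0.
have fib1 a' := @perp_fiber k m p t s1 M ((enorm a' / enorm a) `^ th) a a' b M0 s1p' s1k a0.
move: (gconst m (k.+1%:R + t - s0)) (gconst m (k.+1%:R + t - s1)) G00 G10 fib0 fib1 => G0 G1 G00 G10 fib0 fib1.
have c00 : 0 <= (4 * enorm a / M) `^ s0 by exact: powR_ge0.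
have c10 : 0 <= (4 * enorm a / M) `^ s1 by exact: powR_ge0.
move: ((4 * enorm a / M) `^ s0) ((4 * enorm a / M) `^ s1) c00 c10 fib0 fib1 => c0 c1 c00 c10 fib0 fib1.
have z0 : 0 <= enorm a `^ (- (k.+1%:R + t)) by exact: powR_ge0.
pose H : R := (G0 + G1) * (c0 + c1) * enorm a `^ (- (k.+1%:R + t)).
have H0 : G0 * c0 * enorm a `^ (- (k.+1%:R + t)) <= H.
  by rewrite /H ler_wpM2r// ler_pM ?lerDl.
have H1 : G1 * c1 * enorm a `^ (- (k.+1%:R + t)) <= H.
  by rewrite /H ler_wpM2r// ler_pM ?lerDr.
have HH : 0 <= H by rewrite (mulr_ge0 (mulr_ge0 (addr_ge0 G00 G10) (addr_ge0 c00 c10)) z0).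
have HE : H = (G0 + G1) * (c0 + c1) * enorm a `^ (- (k.+1%:R + t)) by [].
move: H H0 H1 HH HE => H H0 H1 HH HE.
pose gg (r v : R) : R := H * (r `^ th * min1 v `^ (s1 - s0) * v `^ (- (k.+1%:R + t - s0))).
have mgg : measurable_fun setT (fun z : R * R => gg z.1 z.2) by rewrite /gg /min1; mfv.
have gg0 r v : 0 <= gg r v by rewrite /gg mulr_ge0// !mulr_ge0 ?powR_ge0.
have mpo := @measurable_perp_osc k.+1 m p M (row_mx a b).
pose W (y : 'rV[R]_(k.+1 + m)) : R := (enormk k.+1 y / enorm a) `^ th * perp_osc p M (row_mx a b) y *
     enorm (row_mx a b - y) `^ (- ((k.+1 + m)%:R + t)).
have mW : measurable_fun setT W.
  rewrite /W; apply: measurable_funM; last by mfv.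
  by apply: measurable_funM => //; mfv.
have W0 y : 0 <= W y by rewrite /W !mulr_ge0 ?powR_ge0.
rewrite -/(W _) (@integral_rV_split R k.+1 m (fun y => (W y)%:E)); [|exact: mfun_EFin|by move=> y; rewrite lee_fin].
have mV : measurable_fun setT (fun a' : 'rV[R]_k.+1 => \int[L m]_b' (W (row_mx a' b'))%:E)%E.
  apply: (@mfun_int R _ _ _ _ (L m) (fun a' b' => (W (row_mx a' b'))%:E)); last by move=> a' b'; rewrite lee_fin.
  by apply: mfun_EFin; apply: (measurableT_comp mW); mfv.
have V0 a' : (0 <= \int[L m]_b' (W (row_mx a' b'))%:E)%E by apply: integral_ge0 => b' _; rewrite lee_fin.
rewrite (integral_neq a mV V0).
apply: (@le_trans _ _ (\int[L k.+1]_a' (gg (enorm a' / enorm a) (enorm (a - a') / enorm a))%:E)%E).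
  apply: ge0_le_integral => //.
  - by move=> a' _; rewrite mule_ge0// lee_fin.
  - by apply: emeasurable_funM => //; apply: mfun_EFin; exact: measurable_neq.
  - by rewrite /gg /min1; mfv.
  move=> a' _; have [->|aa'] := eqVneq a' a; first by rewrite mule0 lee_fin.
  rewrite mule1 /gg.
  have WE : (\int[L m]_b' (W (row_mx a' b'))%:E)%E = (\int[L m]_b' ((enorm a' / enorm a) `^ th * perp_osc p M (row_mx a b) (row_mx a' b') *
     enorm (row_mx a b - row_mx a' b') `^ (- ((k.+1 + m)%:R + t)))%:E)%E.
    by apply: eq_integral => b' _; rewrite /W enormk_row_mx.
  have f0 := fib0 a' aa' (powR_ge0 _ _); have f1 := fib1 a' aa' (powR_ge0 _ _).
  rewrite WE; exact: (kernel_interpolation (vpos a' aa') (powR_ge0 _ _) H0 H1 f0 f1).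
rewrite (integral_rescale a0 mgg gg0) /gg integralZ//; last 2 first.
- by rewrite /min1; mfv.
- by move=> z; rewrite !mulr_ge0 ?powR_ge0.
rewrite -/I -(fineK Ifin) -!EFinM lee_fin le_eqVlt; apply/orP; left; apply/eqP.
have -> : enorm a `^ (- t) = enorm a ^+ k.+1 * enorm a `^ (- (k.+1%:R + t)).
  rewrite -powR_mulrn ?(ltW na)// -powRD ?(gt_eqF na) ?implybT//; congr (_ `^ _); ring.
by rewrite HE/=; move: (fine I) => y3; ring.
Qed.

End perpendicular.

(** * The logarithmic kernel *)

Section log_kernel.
Context (R : realType).

Definition hlog (p th r : R) : R := `|ln r| `^ p * r `^ th.

Lemma hlog_ge0 p th r : 0 <= hlog p th r.
Proof. by rewrite mulr_ge0 ?powR_ge0. Qed.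

Lemma measurable_hlog p th : measurable_fun setT (hlog p th).
Proof. by rewrite /hlog; mf. Qed.

(** The logarithm costs at most powers r^de and r^(-de), with de so small that th + de and th - de
    remain in ]-(k+1), t[; its zero of order p > t at r = 1 compensates the singularity of the
    kernel. *)
Lemma Jint_hlog_fin k (t p th : R) : 0 < t -> t < p -> - k.+1%:R < th < t ->
  (Jint k ((k.+1%:R + t) / 2) (hlog p th) < +oo)%E.
Proof.
move=> t0 tp /andP[th1 th2]; have p0 : 0 < p by lra.
pose de := Num.min (th + k.+1%:R) (t - th) / 2.
have m0 : 0 < Num.min (th + k.+1%:R) (t - th) by rewrite lt_min; apply/andP; split; lra.
have m1 : Num.min (th + k.+1%:R) (t - th) <= th + k.+1%:R by rewrite ge_min lexx.
have m2 : Num.min (th + k.+1%:R) (t - th) <= t - th by rewrite ge_min lexx orbT.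
have d0 : 0 < de by rewrite divr_gt0.
have d1 : de < th + k.+1%:R by rewrite /de; lra.
have d2 : de < t - th by rewrite /de; lra.
have e0 : 0 < de / p by rewrite divr_gt0.
have c0 : 0 <= 2 + 2 * (de / p)^-1 by rewrite addr_ge0// mulr_ge0// invr_ge0 ltW.
apply: (@Jint_fin R k t p ((2 + 2 * (de / p)^-1) `^ p * 2 `^ p) (th + de) (th - de)) => //.
- by rewrite mulr_ge0 ?powR_ge0.
- by apply/andP; split; lra.
- by apply/andP; split; lra.
- exact: measurable_hlog.
- by move=> r; exact: hlog_ge0.
move=> r r0; rewrite /hlog.
have m3 := min1_ge0 (1 - r).
have h := ge0_ler_powR (ltW p0) (normr_ge0 (ln r)) _ (norm_ln_le_min1 e0 r0).
have s0 : 0 <= r `^ (de / p) + r `^ (- (de / p)) by rewrite addr_ge0 ?powR_ge0.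
apply: (@le_trans _ _ (((2 + 2 * (de / p)^-1) * (r `^ (de / p) + r `^ (- (de / p))) * min1 (1 - r)) `^ p * r `^ th)).
  by rewrite ler_wpM2r ?powR_ge0// h// nnegrE mulr_ge0// mulr_ge0.
rewrite powRM//; last by rewrite mulr_ge0.
rewrite powRM//.
have q := powRD_le (powR_ge0 r (de / p)) (powR_ge0 r (- (de / p))) (ltW p0).
rewrite -!powRrM mulNr divfK ?gt_eqF// in q.
have -> : r `^ (th + de) + r `^ (th - de) = (r `^ de + r `^ (- de)) * r `^ th.
  by rewrite mulrDl -!powRD ?(gt_eqF r0) ?implybT//; congr (_ `^ _ + _ `^ _); ring.
set A := _ `^ p in q *; set m := min1 _ `^ p; set c := _ `^ p.
have -> : c * A * m * r `^ th = A * (c * m * r `^ th) by ring.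
have -> : c * 2 `^ p * ((r `^ de + r `^ (- de)) * r `^ th) * m =
  2 `^ p * (r `^ de + r `^ (- de)) * (c * m * r `^ th) by ring.
by apply: ler_wpM2r => //; rewrite !mulr_ge0 ?powR_ge0.
Qed.

End log_kernel.

(** * Mass of the cutoffs *)

Section cutoff_integrals.
Context (R : realType).
Notation leb := (@lebR R).
Notation L := (lebesgue_rV R).

(** Up to the area of the sphere, |z|^(-(k+1)) dz is Lebesgue measure in the variable ln |z|. *)
Lemma integral_radial_log k (f : R -> R) : measurable_fun setT f -> (forall t, 0 <= f t) ->
  (\int[L k.+1]_a (f (ln (enorm a)) * enorm a `^ (- k.+1%:R))%:E =
   (sphere_area R k.+1)%:E * \int[leb]_t (f t)%:E)%E.
Proof.
move=> mf f0.
pose h (r : R) : \bar R := (f (ln r) * r `^ (- k.+1%:R))%:E.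
have mh : measurable_fun setT h by rewrite /h; mfv.
have h0 r : (0 <= h r)%E by rewrite lee_fin mulr_ge0 ?powR_ge0.
rewrite (integral_radial k mh h0); congr (_ * _)%E.
rewrite (_ : (\int[leb]_(r in _) _)%E = (\int[leb]_(r in `]0%R, +oo[) (h r * (`|r| ^+ k)%:E))%E); last first.
  apply: eq_integral => r /set_mem/=; rewrite in_itv/= andbT => r0.
  by rewrite gtr0_norm.
rewrite (@integral_exp R (fun r => h r * (`|r| ^+ k)%:E)%E); last 2 first.
- by apply: emeasurable_funM => //; mf.
- by move=> x; rewrite mule_ge0// lee_fin.
apply: eq_integral => t _; have e0 := expR_gt0 t.
rewrite /h expRK (gtr0_norm e0) -!EFinM -!mulrA; congr (_%:E).
rewrite -[RHS]mulr1; congr (_ * _).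
rewrite -exprSr powRN powR_mulrn ?(ltW e0)// mulVf//.
by rewrite gt_eqF// exprn_gt0.
Qed.

Lemma integral_le_log (N : R) : 0 < N ->
  (\int[leb]_t ((`|t| <= N)%R%:R)%:E = (2 * N)%:E)%E.
Proof.
move=> N0; transitivity (leb `[- N, N]%classic); last first.
  by rewrite lebR_itv lebesgue_measure_itv/= lte_fin gtrN// -EFinB opprK mulr2n mulrDl mul1r.
rewrite -[RHS](_ : (\int[leb]_t (\1_(`[- N, N]%classic) t)%:E)%E = _); last first.
  by rewrite integral_indic// setIT.
by apply: eq_integral => t _; rewrite indicE mem_setE in_itv/= -ler_norml.
Qed.

Lemma le_logcut_powR (p N t : R) : 0 <= p -> 0 < N -> (`|2 * t| <= N)%R%:R <= 2 `^ p * logcut N t `^ p.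
Proof.
move=> p0 N0; case h : (`|2 * t| <= N); last by rewrite mulr_ge0 ?powR_ge0.
have l2 : 2^-1 <= logcut N t.
  by apply: logcut_half => //; rewrite ler_pdivlMr// mulrC -[2 in X in X * _]ger0_norm// -normrM.
rewrite -powRM ?logcut_ge0//; apply: (@le_trans _ _ (1 `^ p)); first by rewrite powR1.
have h2 : 1 <= 2 * logcut N t by rewrite -ler_pdivrMl// mulr1.
by apply: (ge0_ler_powR p0 _ _ h2); rewrite nnegrE// mulr_ge0// logcut_ge0.
Qed.

(** [logcut] is at least 1/2 on the interval of half size, and a dilation by 2 recovers the full
    interval. *)
Lemma integral_le_logcut (p N : R) : 0 <= p -> 0 < N ->
  (\int[leb]_t ((`|t| <= N)%R%:R)%:E <= (2 * 2 `^ p)%:E * \int[leb]_t (logcut N t `^ p)%:E)%E.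
Proof.
move=> p0 N0.
have mi : measurable_fun setT (fun t : R => ((`|t| <= N)%R%:R)%:E : \bar R) by mf.
have i0 (t : R) : (0 <= ((`|t| <= N)%R%:R)%:E :> \bar R)%E by rewrite lee_fin.
have ml : measurable_fun setT (fun t => logcut N t `^ p) by rewrite /logcut /sqpos; mf.
have := @integral_scaleR R 2 _ _ mi i0; rewrite gt_eqF// => /(_ isT) H.
have -> : (\int[leb]_t ((`|t| <= N)%R%:R)%:E = 2%:E * \int[leb]_t ((`|2 * t| <= N)%R%:R)%:E)%E.
  by rewrite H muleA -EFinM ger0_norm// divff// mul1e.
rewrite EFinM -muleA lee_pmul2l// -integralZ ?powR_ge0//; last by move=> t; exact: powR_ge0.
apply: ge0_le_integral => //.
- by mf.
- by mf.
- by move=> t _; rewrite lee_fin le_logcut_powR.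
Qed.

Lemma integral_ball_logcut m (p M : R) : 0 <= p -> 0 < M ->
  (\int[L m]_b ((enorm b <= M)%R%:R)%:E <=
   (2 ^+ m * 2 `^ p)%:E * \int[L m]_b (logcut M (enorm b) `^ p)%:E)%E.
Proof.
move=> p0 M0.
have mi : measurable_fun setT (fun b : 'rV[R]_m => ((enorm b <= M)%R%:R)%:E : \bar R) by mfv.
have i0 (b : 'rV[R]_m) : (0 <= ((enorm b <= M)%R%:R)%:E :> \bar R)%E by rewrite lee_fin.
have ml : measurable_fun setT (fun b : 'rV[R]_m => logcut M (enorm b) `^ p) by rewrite /logcut /sqpos; mfv.
have n20 : 2 != 0 :> R by [].
have H := integral_scale_rV n20 mi i0.
have -> : (\int[L m]_b ((enorm b <= M)%R%:R)%:E = (2 ^+ m)%:E * \int[L m]_b ((enorm (2 *: b) <= M)%R%:R)%:E)%E.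
  by rewrite H muleA -EFinM ger0_norm// divff ?mul1e// expf_neq0.
rewrite EFinM -muleA lee_pmul2l ?lte_fin ?exprn_gt0// -integralZ ?powR_ge0//; last by move=> b; exact: powR_ge0.
apply: ge0_le_integral => //.
- by apply: mfun_EFin; mfv.
- by mfv.
move=> b _; rewrite lee_fin enormZ -(ger0_norm (enorm_ge0 b)) -normrM.
rewrite (ger0_norm (enorm_ge0 b)).
exact: le_logcut_powR.
Qed.

(** Bounded below by the volume of a small cube and above by the integrable function of
    [integral_bessel]. *)
Lemma integral_ball_fin m (M : R) : 0 < M ->
  (0 < \int[L m]_b ((enorm b <= M)%R%:R)%:E < +oo)%E.
Proof.
move=> M0; apply/andP; split.
  (* The cube of half-side c fits in the ball since m <= (m+1)^2; m + 1 is used because m may be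
     0. *)
  pose c := M / m.+1%:R; have c0 : 0 < c by rewrite divr_gt0.
  pose B : set 'rV[R]_m := [set v | forall i, `[- c, c]%classic (v ord0 i)].
  have mB : measurable B by apply: (@measurable_rV_box R m (fun=> `[- c, c]%classic)).
  apply: (@lt_le_trans _ _ (L m B)).
    rewrite (@lebesgue_rV_box R m (fun=> `[- c, c]%classic))//.
    under eq_bigr do rewrite lebesgue_measure_itv/= lte_fin gtrN// -EFinB.
    by rewrite prodEFin lte_fin; apply: prodr_gt0 => i _; rewrite opprK addr_gt0.
  rewrite -[leLHS](_ : (\int[L m]_b (\1_B b)%:E)%E = _); last by rewrite integral_indic// setIT.
  apply: ge0_le_integral => //.
  - by apply: mfun_EFin; exact: measurable_indic.
  - by mfv.
  move=> b _; rewrite lee_fin indicE ler_nat; case: (boolP (b \in B)) => // /set_mem hb.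
  rewrite (_ : (enorm b <= M))//.
  rewrite -ler_sqr ?nnegrE ?enorm_ge0 ?(ltW M0)// sqr_enorm.
  apply: (@le_trans _ _ (\sum_(i < m) c ^+ 2)).
    apply: ler_sum => i _; rewrite -expr2 -real_normK ?num_real// ler_sqr ?nnegrE ?(ltW c0)//.
    by have := hb i; rewrite /= in_itv/= -ler_norml.
  rewrite sumr_const card_ord -mulr_natr /c exprMn mulrAC -mulrA -[leRHS]mulr1 ler_wpM2l ?sqr_ge0//.
  rewrite exprVn ler_pdivrMr ?exprn_gt0// mul1r -natrX ler_nat.
  by rewrite (leq_trans (leqnSn m))// expnS expn1 leq_pmulr.
have fb : (\int[L m]_z ((1 + M ^+ 2) `^ ((1 + m%:R) / 2) * (1 + enorm z ^+ 2) `^ (- ((1 + m%:R) / 2)))%:E < +oo)%E.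
  by rewrite integralZ ?integral_bessel ?powR_ge0//; [rewrite -EFinM ltry|mfv|move=> z; exact: powR_ge0].
apply: le_lt_trans fb; apply: ge0_le_integral => //.
- by mfv.
- by mfv.
move=> b _; rewrite lee_fin; case h : (enorm b <= M); last by rewrite mulr_ge0 ?powR_ge0.
have a1 : 0 <= (1 + m%:R) / 2 :> R by rewrite divr_ge0// addr_ge0.
have b1 : 0 < 1 + enorm b ^+ 2 by rewrite ltr_wpDr ?sqr_ge0.
rewrite powRN ler_pdivlMr ?powR_gt0// mul1r.
apply: ge0_ler_powR; rewrite ?nnegrE ?(ltW b1) ?addr_ge0 ?sqr_ge0//.
by rewrite lerD2l ler_sqr ?nnegrE ?enorm_ge0 ?(ltW M0).
Qed.

End cutoff_integrals.

Section cutoff_error.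
Context (R : realType).
Notation L := (lebesgue_rV R).
Notation leb := (@lebR R).

Definition cutoff_supp k m (N M : R) (x : 'rV[R]_(k + m)) : R :=
  ((0 < enormk k x) && (`|ln (enormk k x)| <= N) && (enorm (rsubmx x) <= M))%:R.

Lemma cutoff_supp_ge0 k m N M (x : 'rV[R]_(k + m)) : 0 <= cutoff_supp N M x.
Proof. exact: ler0n. Qed.

Lemma measurable_cutoff_supp k m N M : measurable_fun setT (@cutoff_supp k m N M).
Proof.
have mr := @mfun_rsubmx R k m; rewrite /cutoff_supp.
apply: mfun_natb; apply: measurable_and; last by mfv.
by mfv.
Qed.

(** Mass of the support of the cutoff for the measure |x_k|^(-(k+1)) dx, the scale on which the
    right-hand side and the errors are measured. It is a product of a multiple of N and the volume
    of a ball of radius M. *)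
Definition supp_mass k m (N M : R) : \bar R :=
  (\int[L (k.+1 + m)]_x (cutoff_supp N M x * enormk k.+1 x `^ (- k.+1%:R))%:E)%E.

Lemma powR0N (k : nat) : 0 `^ (- k.+1%:R) = 0 :> R.
Proof. by rewrite powR0// oppr_eq0 pnatr_eq0. Qed.

Lemma supp_massE k m (N M : R) : 0 < N ->
  supp_mass k m N M = ((sphere_area R k.+1 * (2 * N))%:E *
    \int[L m]_b ((enorm b <= M)%R%:R)%:E)%E.
Proof.
move=> N0; pose f (a : 'rV[R]_k.+1) : R := (`|ln (enorm a)| <= N)%R%:R * enorm a `^ (- k.+1%:R).
have mf : measurable_fun setT f by rewrite /f; mfv.
transitivity (\int[L (k.+1 + m)]_x (f (lsubmx x) * (enorm (rsubmx x) <= M)%R%:R)%:E)%E.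
  apply: eq_integral => x _; rewrite /cutoff_supp /f -enormk_lsubmx; congr (_%:E).
  have := enormk_ge0 k.+1 x; rewrite le_eqVlt => /predU1P[<-|->].
    by rewrite powR0N !mulr0 mul0r.
  by rewrite /= -mulnb natrM mulrAC.
rewrite (@integral_split_prod R k.+1 m f (fun b => (enorm b <= M)%R%:R)) => //; last 2 first.
- by mfv.
- by move=> a; rewrite mulr_ge0 ?powR_ge0.
congr (_ * _)%E; rewrite EFinM -(integral_le_log N0).
by apply: (@integral_radial_log R k (fun t => (`|t| <= N)%R%:R)) => //; mf.
Qed.

Lemma supp_mass_fin k m (N M : R) : 0 < N -> 0 < M ->
  (0 < supp_mass k m N M < +oo)%E.
Proof.
move=> N0 M0; rewrite supp_massE//; have /andP[B0 B1] := integral_ball_fin m M0.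
have A0 : 0 < sphere_area R k.+1 * (2 * N) by rewrite mulr_gt0 ?sphere_area_gt0// mulr_gt0.
by rewrite mule_gt0//= lte_mul_pinfty// lee_fin ltW.
Qed.

Section rhs.
Variables (k m : nat) (s p a b g N M : R).
Hypotheses (p0 : 0 < p) (N0 : 0 < N) (M0 : 0 < M).
Hypothesis gp : g * p = k.+1%:R + a + b - s * p.

(** By the choice of g, the ground state to the power p times the weight is |x_k|^(-(k+1)), the
    borderline of integrability; this logarithmic divergence is what the test functions exploit. *)
Lemma rhs_pointwise (x : 'rV[R]_(k.+1 + m)) :
  `|testfun g N M x| `^ p / enormk k.+1 x `^ (s * p - a - b) =
  (logcut N (ln (enormk k.+1 x)) `^ p * enormk k.+1 x `^ (- k.+1%:R)) * logcut M (enorm (rsubmx x)) `^ p.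
Proof.
have := enormk_ge0 k.+1 x; rewrite le_eqVlt => /predU1P[/esym x0|x0].
  by rewrite testfun0// x0 normr0 powR0 ?gt_eqF// powR0N mulr0 !mul0r.
rewrite testfunE// ger0_norm; last exact: (mulr_ge0 (powR_ge0 _ _) (cutoff_ge0 N M x)).
rewrite (powRM _ (powR_ge0 _ _) (cutoff_ge0 N M x)) /cutoff (powRM _ (logcut_ge0 _ _) (logcut_ge0 _ _)) -powRrM -powRN.
rewrite [LHS](_ : _ = logcut N (ln (enormk k.+1 x)) `^ p * (enormk k.+1 x `^ (- g * p) * enormk k.+1 x `^ (- (s * p - a - b))) * logcut M (enorm (rsubmx x)) `^ p); last by ring.
rewrite -powRD; last by rewrite (gt_eqF x0) implybT.
by congr (_ * _ `^ _ * _); rewrite mulNr gp; ring.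
Qed.

(** The constant depends on neither N nor M, so an error that is small relative to the mass is small
    relative to the right-hand side. *)
Lemma supp_mass_le_rhs :
  (supp_mass k m N M <= (2 * 2 `^ p * (2 ^+ m * 2 `^ p))%:E * hardy_rhs s p k.+1 a b (@testfun R k m g N M))%E.
Proof.
have p0' := ltW p0; have A0 := sphere_area_ge0 R k.+1.
have ml : measurable_fun setT (fun t : R => logcut N t `^ p) by rewrite /logcut /sqpos; mf.
have ml0 t : 0 <= logcut N t `^ p by exact: powR_ge0.
pose f (z : 'rV[R]_k.+1) : R := logcut N (ln (enorm z)) `^ p * enorm z `^ (- k.+1%:R).
pose h (z : 'rV[R]_m) : R := logcut M (enorm z) `^ p.
have mf : measurable_fun setT f by rewrite /f /logcut /sqpos; mfv.
have mh : measurable_fun setT h by rewrite /h /logcut /sqpos; mfv.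
rewrite /hardy_rhs (_ : (\int[L (k.+1 + m)]_x _)%E = (\int[L (k.+1 + m)]_x (f (lsubmx x) * h (rsubmx x))%:E)%E); last first.
  by apply: eq_integral => x _; rewrite rhs_pointwise /f -enormk_lsubmx.
rewrite integral_split_prod//; last 2 first.
- by move=> z; rewrite mulr_ge0 ?powR_ge0.
- by move=> z; exact: powR_ge0.
rewrite /f (integral_radial_log k ml ml0) supp_massE// EFinM -(integral_le_log N0).
have h1 := integral_le_logcut p0' N0; have h2 := integral_ball_logcut m p0' M0.
have i1 : (0 <= \int[leb]_t ((`|t| <= N)%R%:R)%:E)%E by apply: integral_ge0.
have i2 : (0 <= \int[L m]_z ((enorm z <= M)%R%:R)%:E)%E by apply: integral_ge0.
rewrite (EFinM (2 * 2 `^ p)).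
set I1 := (\int[leb]_t ((`|t| <= N)%R%:R)%:E)%E in h1 i1 *.
set I2 := (\int[L m]_z ((enorm z <= M)%R%:R)%:E)%E in h2 i2 *.
set J1 := (\int[leb]_t (logcut N t `^ p)%:E)%E in h1 *; set J2 := (\int[L m]_b (h b)%:E)%E.
have {}h2 : (I2 <= (2 ^+ m * 2 `^ p)%:E * J2)%E := h2.
move: I1 I2 J1 J2 h1 h2 i1 i2 => I1 I2 J1 J2 h1 h2 i1 i2.
have -> : ((2 * 2 `^ p)%:E * (2 ^+ m * 2 `^ p)%:E * ((sphere_area R k.+1)%:E * J1 * J2) =
   (sphere_area R k.+1)%:E * ((2 * 2 `^ p)%:E * J1) * ((2 ^+ m * 2 `^ p)%:E * J2))%E.
  by rewrite [LHS]muleACA; congr (_ * _)%E; exact: muleCA.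
by apply: lee_pmul => //; [rewrite mule_ge0|rewrite lee_wpmul2l].
Qed.

Lemma rhs_le_supp_mass :
  (hardy_rhs s p k.+1 a b (@testfun R k m g N M) <= supp_mass k m N M)%E.
Proof.
apply: ge0_le_integral => //.
- by move=> x _; rewrite lee_fin mulr_ge0 ?powR_ge0// invr_ge0 powR_ge0.
- have mt : measurable_fun setT (@testfun R k m g N M).
    by apply: continuous_mfun_rV; apply: cd_continuous; exact: cd_testfun.
  by mfv.
- apply: mfun_EFin; apply: measurable_funM; first exact: measurable_cutoff_supp.
  by mfv.
move=> x _; rewrite lee_fin rhs_pointwise mulrAC -(powRM _ (logcut_ge0 _ _) (logcut_ge0 _ _)).
have := enormk_ge0 k.+1 x; rewrite le_eqVlt => /predU1P[<-|x0].
  by rewrite powR0N !mulr0.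
apply: ler_wpM2r; first exact: powR_ge0.
rewrite -[X in X `^ p]/(cutoff N M x) /cutoff_supp x0/=; case h : (_ && _).
  by apply: (powR_le1 (ltW p0)); rewrite cutoff_ge0 cutoff_le1.
by rewrite cutoff_out ?h// powR0// gt_eqF.
Qed.

End rhs.
End cutoff_error.

(** * Error terms of the test functions *)

Section upper_bound.
Context (R : realType).
Notation L := (lebesgue_rV R).

(** Majorant of the contribution of the cutoff increments, based at a point x of the support: a
    logarithmic term for the cutoff in ln |x_k|, and an oscillation term for the cutoff in the last
    coordinates. *)
Definition cutoff_err k m (p t th N M : R) (x y : 'rV[R]_(k.+1 + m)) : R :=
  cutoff_supp N M x * enormk k.+1 x `^ (t - k.+1%:R) *
  (((4 / N) `^ p * hlog p th (enormk k.+1 y / enormk k.+1 x) +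
    (enormk k.+1 y / enormk k.+1 x) `^ th * perp_osc p M x y) *
   enorm (x - y) `^ (- ((k.+1 + m)%:R + t))).

Lemma cutoff_err_ge0 k m (p t th N M : R) (x y : 'rV[R]_(k.+1 + m)) : 0 <= cutoff_err p t th N M x y.
Proof.
rewrite /cutoff_err mulr_ge0 ?mulr_ge0 ?cutoff_supp_ge0 ?powR_ge0// addr_ge0//.
  by rewrite mulr_ge0 ?powR_ge0 ?hlog_ge0.
by rewrite mulr_ge0 ?powR_ge0.
Qed.

Lemma measurable_perp_osc2 k m (p M : R) :
  measurable_fun setT (fun z : 'rV[R]_(k + m) * 'rV[R]_(k + m) => perp_osc p M z.1 z.2).
Proof.
have mr := @mfun_rsubmx R k m; rewrite /perp_osc /logcut /sqpos.
have m1 : measurable_fun setT (fun z : 'rV[R]_(k + m) * 'rV[R]_(k + m) => rsubmx z.1 : 'rV[R]_m).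
  exact: (measurableT_comp mr measurable_fst).
have m2 : measurable_fun setT (fun z : 'rV[R]_(k + m) * 'rV[R]_(k + m) => rsubmx z.2 : 'rV[R]_m).
  exact: (measurableT_comp mr measurable_snd).
have h (f : 'rV[R]_(k + m) * 'rV[R]_(k + m) -> 'rV[R]_m) : measurable_fun setT f ->
    measurable_fun setT (fun z => Num.max (1 - (enorm (f z) / M) ^+ 2) 0 ^+ 2).
  move=> mf; apply: measurable_funX; apply: measurable_maxr => //; apply: measurable_funB => //.
  by apply: measurable_funX; apply: measurable_funM => //; exact: mfun_enorm.
by apply: mfun_powR; apply: mfun_norm; apply: measurable_funB; exact: h.
Qed.

Lemma measurable_cutoff_err k m (p t th N M : R) :
  measurable_fun setT (fun z : 'rV[R]_(k.+1 + m) * 'rV[R]_(k.+1 + m) => cutoff_err p t th N M z.1 z.2).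
Proof.
have ms := @measurable_cutoff_supp R k.+1 m N M.
have mh := measurable_hlog p th; have mo := @measurable_perp_osc2 k.+1 m p M.
rewrite /cutoff_err; apply: measurable_funM.
  by apply: measurable_funM; [exact: (measurableT_comp ms measurable_fst)|mfv].
apply: measurable_funM; last by mfv.
apply: measurable_funD; last by apply: measurable_funM => //; mfv.
apply: measurable_funM => //; apply: (measurableT_comp mh); mfv.
Qed.

(** On the support |x_k| <= e^N, so M = N e^N gives 4 |x_k|/M <= 4/N <= 1; every term is then at
    most a constant times (4/N)^s0. *)
Lemma cutoff_err_bound k m (p t th s0 : R) : 0 < t -> t < p -> - k.+1%:R < th < t ->
  0 < s0 -> s0 < t -> s0 < t - th ->
  exists2 A : R, 0 <= A & forall N : R, 4 <= N ->
  (\int[L (k.+1 + m)]_x \int[L (k.+1 + m)]_y (cutoff_err p t th N (N * expR N) x y)%:E <=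
   (A * (4 / N) `^ s0)%:E * supp_mass k m N (N * expR N))%E.
Proof.
move=> t0 tp thk s00 s0t s0th.
(* The exponent t + de serves as s1 in [perp_kernel]: above t, at most p and below k + 1 + t. *)
pose de := Num.min (p - t) 1 / 2.
have m0 : 0 < Num.min (p - t) 1 by rewrite lt_min ltr01 andbT subr_gt0.
have m1 : Num.min (p - t) 1 <= p - t by rewrite ge_min lexx.
have m2 : Num.min (p - t) 1 <= 1 by rewrite ge_min lexx orbT.
have k1 : 1 <= k.+1%:R :> R by rewrite ler1n.
have [A2 A20 hA2] : exists2 A : R, 0 <= A & forall M (x : 'rV[R]_(k.+1 + m)), 0 < M -> 0 < enormk k.+1 x ->
  (\int[L (k.+1 + m)]_y ((enormk k.+1 y / enormk k.+1 x) `^ th * perp_osc p M x y *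
     enorm (x - y) `^ (- ((k.+1 + m)%:R + t)))%:E <=
   (A * enormk k.+1 x `^ (- t) *
     ((4 * enormk k.+1 x / M) `^ s0 + (4 * enormk k.+1 x / M) `^ (t + de)))%:E)%E.
  move/andP: thk => [th1 _]; apply: perp_kernel => //; rewrite /de; lra.
have ts1 : s0 <= t + de by rewrite /de; lra.
have s0p : s0 <= p by lra.
have J0 := Jint_ge0 k ((k.+1%:R + t) / 2) (hlog_ge0 p th).
have Jf := Jint_hlog_fin t0 tp thk.
have G0 : 0 < gconst m (k.+1%:R + t) by rewrite gconst_gt0// addr_gt0.
have KP (x : 'rV[R]_(k.+1 + m)) : 0 < enormk k.+1 x -> _ :=
  fun x0 => @integral_kernel_point R k m x t (hlog p th) t0 x0 (measurable_hlog p th) (hlog_ge0 p th).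
move: (Jint _ _ _) J0 Jf KP => J J0 Jf KP.
have Jfin : J \is a fin_num by rewrite ge0_fin_numE.
have Jr0 : 0 <= fine J by rewrite fine_ge0.
move: (gconst m (k.+1%:R + t)) G0 KP => G G0 KP.
exists (G * fine J + 2 * A2); first by rewrite addr_ge0 ?mulr_ge0// ltW.
clear thk s0th m0 m1 m2 k1 s0t tp Jf J0.
move=> N N4; have N0 : 0 < N by lra.
have e0 : 0 < expR N by exact: expR_gt0.
have M0 : 0 < N * expR N by rewrite mulr_gt0.
have N1 : 0 <= 4 / N by rewrite divr_ge0// ltW.
have N1' : 0 < 4 / N <= 1 by rewrite divr_gt0//= ler_pdivrMr ?mul1r.
rewrite /supp_mass -ge0_integralZl//; last 3 first.
- apply: mfun_EFin; apply: measurable_funM; first exact: measurable_cutoff_supp.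
  by mfv.
- by move=> x _; rewrite lee_fin mulr_ge0 ?powR_ge0 ?cutoff_supp_ge0.
- by rewrite lee_fin mulr_ge0 ?powR_ge0 ?addr_ge0 ?mulr_ge0// ltW.
have mE := @measurable_cutoff_err k m p t th N (N * expR N).
apply: ge0_le_integral => //.
- by move=> x _; apply: integral_ge0 => y _; rewrite lee_fin cutoff_err_ge0.
- apply: (@mfun_int R _ _ _ _ (L (k.+1 + m)) (fun x y => (cutoff_err p t th N (N * expR N) x y)%:E)).
    exact: mfun_EFin.
  by move=> x y; rewrite lee_fin cutoff_err_ge0.
- apply: emeasurable_funM => //; apply: mfun_EFin; apply: measurable_funM; first exact: measurable_cutoff_supp.
  by mfv.
move=> x _; rewrite /cutoff_err /cutoff_supp.
case h : (_ && _ && _); last first.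
  rewrite integral0_eq; last by move=> y _; rewrite (mul0r (enormk k.+1 x `^ _)); congr (_%:E); exact: mul0r.
  by rewrite (mul0r (enormk k.+1 x `^ _)) mule0.
move: h => /andP[/andP[x0 hl] _]; rewrite mul1r.
have XN : enormk k.+1 x <= expR N.
  rewrite -[leLHS]lnK ?posrE// ler_expR; exact: le_trans (ler_norm _) hl.
have ho := hA2 _ x M0 x0; have hk := KP x x0.
have mo := @measurable_perp_osc R k.+1 m p (N * expR N) x.
have mh := measurable_hlog p th.
have mn : measurable_fun setT (fun y : 'rV[R]_(k.+1 + m) => enormk k.+1 y / enormk k.+1 x) by mfv.
pose f1 (y : 'rV[R]_(k.+1 + m)) : R := hlog p th (enormk k.+1 y / enormk k.+1 x) * enorm (x - y) `^ (- ((k.+1 + m)%:R + t)).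
pose f2 (y : 'rV[R]_(k.+1 + m)) : R := (enormk k.+1 y / enormk k.+1 x) `^ th * perp_osc p (N * expR N) x y *
  enorm (x - y) `^ (- ((k.+1 + m)%:R + t)).
have mf1 : measurable_fun setT f1 by rewrite /f1; apply: measurable_funM; [exact: (measurableT_comp mh mn)|mfv].
have mf2 : measurable_fun setT f2.
  by rewrite /f2; apply: measurable_funM; [apply: measurable_funM => //; mfv|mfv].
have f10 y : 0 <= f1 y by rewrite /f1 mulr_ge0 ?hlog_ge0 ?powR_ge0.
have f20 y : 0 <= f2 y by rewrite /f2 mulr_ge0 ?powR_ge0// mulr_ge0 ?powR_ge0.
pose c := enormk k.+1 x `^ (t - k.+1%:R).
have c0 : 0 <= c by exact: powR_ge0.
have p40 : 0 <= (4 / N) `^ p by exact: powR_ge0.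
rewrite (_ : (\int[L (k.+1 + m)]_y _)%E = (c%:E * (((4 / N) `^ p)%:E * \int[L (k.+1 + m)]_y (f1 y)%:E + \int[L (k.+1 + m)]_y (f2 y)%:E))%E); last first.
  rewrite -(integralZ (L (k.+1 + m)) mf1 f10 p40) -ge0_integralD//; last 4 first.
  - by move=> y _; rewrite lee_fin mulr_ge0.
  - by apply: mfun_EFin; exact: measurable_funM.
  - by move=> y _; rewrite lee_fin.
  - exact: mfun_EFin.
  rewrite -ge0_integralZl//; last 2 first.
  - apply: emeasurable_funD; apply: mfun_EFin => //; exact: measurable_funM.
  - by move=> y _; rewrite adde_ge0// lee_fin// mulr_ge0.
  apply: eq_integral => y _; rewrite -EFinD -EFinM; congr (_%:E); rewrite /c /f1 /f2.
  by move: (hlog _ _ _) (perp_osc _ _ _ _) => u1 u2; ring.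
move: hk ho; rewrite -/(f1 _) -/(f2 _) => hk ho.
rewrite hk -(fineK Jfin).
apply: (@le_trans _ _ (c%:E * (((4 / N) `^ p)%:E * ((G * enormk k.+1 x `^ (- t))%:E * (fine J)%:E) +
   (A2 * enormk k.+1 x `^ (- t) * ((4 * enormk k.+1 x / (N * expR N)) `^ s0 + (4 * enormk k.+1 x / (N * expR N)) `^ (t + de)))%:E))%E).
  by apply: lee_wpmul2l => //; exact: leeD2l.
rewrite -!EFinM lee_fin /=.
have w0 : 0 <= 4 * enormk k.+1 x / (N * expR N) by rewrite divr_ge0 ?mulr_ge0 ?enormk_ge0// ltW.
have w1 : 4 * enormk k.+1 x / (N * expR N) <= 4 / N.
  rewrite -mulrA ler_wpM2l// ler_pdivrMr// mulrA mulVf ?mul1r// gt_eqF//.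
have q1 : (4 * enormk k.+1 x / (N * expR N)) `^ s0 <= (4 / N) `^ s0.
  exact: (ge0_ler_powR (ltW s00) w0 N1 w1).
have q2 : (4 * enormk k.+1 x / (N * expR N)) `^ (t + de) <= (4 / N) `^ s0.
  have d0 : 0 <= t + de by apply: le_trans ts1; exact: ltW.
  apply: (le_trans (ge0_ler_powR d0 w0 N1 w1)); exact: ger_powR.
have q3 : (4 / N) `^ p <= (4 / N) `^ s0 by exact: ger_powR.
have -> : enormk k.+1 x `^ (- k.+1%:R) = c * enormk k.+1 x `^ (- t).
  by rewrite /c -powRD ?(gt_eqF x0) ?implybT//; congr (_ `^ _); ring.
have X0 : 0 <= enormk k.+1 x `^ (- t) by exact: powR_ge0.
move: (enormk k.+1 x `^ (- t)) X0 q1 q2 q3 => X X0.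
move: ((4 * enormk k.+1 x / (N * expR N)) `^ s0) ((4 * enormk k.+1 x / (N * expR N)) `^ (t + de)) ((4 / N) `^ p) ((4 / N) `^ s0) => Y1 Y2 Y3 Y4 q1 q2 q3.
rewrite [leRHS](_ : _ = c * (Y4 * (G * X * fine J) + A2 * X * (Y4 + Y4))); last by ring.
apply: ler_wpM2l => //; apply: lerD; first by apply: ler_wpM2r => //; rewrite !mulr_ge0// ltW.
by apply: ler_wpM2l; [rewrite mulr_ge0|exact: lerD].
Qed.

End upper_bound.

(** * Increments of the test functions *)

Section optimality.
Context (R : realType).
Notation L := (lebesgue_rV R).

(** The increment is cx (X^(-g) - Y^(-g)) + Y^(-g) (cx - cy); [powR_convex] with weights 1 - th and
    th separates the two. *)
Lemma split_increment (p th g X Y cx cy : R) : 1 <= p -> 0 < th < 1 -> 0 <= cx ->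
  `|X `^ (- g) * cx - Y `^ (- g) * cy| `^ p <=
  (1 - th) `^ (1 - p) * (cx `^ p * `|X `^ (- g) - Y `^ (- g)| `^ p) +
  th `^ (1 - p) * (Y `^ (- g * p) * `|cx - cy| `^ p).
Proof.
move=> p1 /andP[th0 th1] cx0; have p0 : 0 <= p by lra.
set A := X `^ (- g) - Y `^ (- g).
apply: (@le_trans _ _ ((cx * `|A| + Y `^ (- g) * `|cx - cy|) `^ p)).
  apply: ge0_ler_powR => //; rewrite ?nnegrE ?addr_ge0 ?mulr_ge0 ?powR_ge0//.
  have -> : X `^ (- g) * cx - Y `^ (- g) * cy = cx * A + Y `^ (- g) * (cx - cy) by rewrite /A; ring.
  apply: (le_trans (ler_normD _ _)).
  by rewrite !normrM (ger0_norm cx0) (ger0_norm (powR_ge0 Y (- g))).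
have l01 : 0 < 1 - th < 1 by apply/andP; split; lra.
have := @powR_convex R p (1 - th) (cx * `|A|) (Y `^ (- g) * `|cx - cy|) p1 l01.
rewrite !mulr_ge0 ?powR_ge0// => /(_ isT isT) h; apply: (le_trans h).
rewrite (_ : 1 - (1 - th) = th); last by ring.
by rewrite !powRM ?powR_ge0// -powRrM.
Qed.

Lemma weight_ratio (X Y e f : R) : 0 < X -> 0 < Y ->
  X `^ (e + f) * (Y / X) `^ f = X `^ e * Y `^ f.
Proof.
move=> X0 Y0; rewrite powRM ?invr_ge0 ?(ltW X0) ?(ltW Y0)// powRV ?(ltW X0)//.
by rewrite powRD ?(gt_eqF X0) ?implybT// powRN; field; rewrite gt_eqF// powR_gt0.
Qed.

Definition main_term k m (p t b g N M c : R) (x y : 'rV[R]_(k.+1 + m)) : R :=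
  c * (cutoff N M x `^ p * enormk k.+1 x `^ (t - k.+1%:R) * (0 < enormk k.+1 x)%R%:R) *
  (hgt g p b (enormk k.+1 y / enormk k.+1 x) * enorm (x - y) `^ (- ((k.+1 + m)%:R + t))).

(** When neither point lies in the support the left side is 0, which accounts for the last
    factor. *)
Lemma cutoffB_powR k m (p N M : R) (x y : 'rV[R]_(k.+1 + m)) : 1 <= p -> 0 < N -> 0 < M ->
  0 < enormk k.+1 x -> 0 < enormk k.+1 y ->
  `|cutoff N M x - cutoff N M y| `^ p <= 2 `^ p *
    ((4 / N) `^ p * `|ln (enormk k.+1 y / enormk k.+1 x)| `^ p + perp_osc p M x y) *
    (cutoff_supp N M x + cutoff_supp N M y).
Proof.
move=> p1 N0 M0 x0 y0; have p0 : 0 <= p by lra.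
set D := 2 `^ p * _.
have D0 : 0 <= D by rewrite /D mulr_ge0 ?powR_ge0// addr_ge0 ?powR_ge0// mulr_ge0 ?powR_ge0.
have s0 := cutoff_supp_ge0 N M x; have s1 := cutoff_supp_ge0 N M y.
have hD : `|cutoff N M x - cutoff N M y| `^ p <= D.
  pose d1 : R := `|logcut N (ln (enormk k.+1 x)) - logcut N (ln (enormk k.+1 y))|.
  pose d2 : R := `|logcut M (enorm (rsubmx x)) - logcut M (enorm (rsubmx y))|.
  have d10 : 0 <= d1 by exact: normr_ge0.
  have d20 : 0 <= d2 by exact: normr_ge0.
  have dd : d1 <= 4 / N * `|ln (enormk k.+1 y / enormk k.+1 x)|.
    apply: (le_trans (logcut_lip N0 _ _)).
    by rewrite ln_div ?posrE// distrC -mulrA ler_wpM2l// mulrC.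
  have h12 : `|cutoff N M x - cutoff N M y| `^ p <= (d1 + d2) `^ p.
    have hB := cutoffB N M x y.
    by apply: (ge0_ler_powR p0 _ _ hB); rewrite nnegrE// addr_ge0.
  apply: (le_trans h12); apply: (le_trans (powRD_le d10 d20 p0)).
  rewrite /D ler_wpM2l ?powR_ge0// lerD2r -powRM ?divr_ge0 ?(ltW N0)//.
  by apply: (ge0_ler_powR p0 _ _ dd); rewrite nnegrE// mulr_ge0// divr_ge0// ltW.
have [hx|hx] := boolP ((`|ln (enormk k.+1 x)| <= N) && (enorm (rsubmx x) <= M)).
  have e : cutoff_supp N M x = 1 by rewrite /cutoff_supp x0/= hx.
  by apply: (le_trans hD); rewrite ler_peMr// e lerDl.
have [hy|hy] := boolP ((`|ln (enormk k.+1 y)| <= N) && (enorm (rsubmx y) <= M)).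
  have e : cutoff_supp N M y = 1 by rewrite /cutoff_supp y0/= hy.
  by apply: (le_trans hD); rewrite ler_peMr// e lerDr.
rewrite (cutoff_out N0 M0 hx) (cutoff_out N0 M0 hy) subrr normr0 powR0.
  exact: (mulr_ge0 D0 (addr_ge0 s0 s1)).
by rewrite gt_eqF// (lt_le_trans ltr01).
Qed.

(** The second piece of [split_increment] carries Y^(-gp) X^a Y^b. This is regrouped around x, with
    exponent b - g p of the ratio, in the term supported at x, and around y, with exponent a, in the
    term supported at y. *)
Lemma testfun_increment k m (p t a b g th N M : R) (x y : 'rV[R]_(k.+1 + m)) :
  1 <= p -> 0 < th < 1 -> 0 < N -> 0 < M -> g * p = k.+1%:R + a + b - t ->
  0 < enormk k.+1 x -> 0 < enormk k.+1 y ->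
  `|testfun g N M x - testfun g N M y| `^ p * enorm (x - y) `^ (- ((k.+1 + m)%:R + t)) *
    enormk k.+1 x `^ a * enormk k.+1 y `^ b <=
  main_term p t b g N M ((1 - th) `^ (1 - p)) x y +
  th `^ (1 - p) * 2 `^ p * (cutoff_err p t (b - g * p) N M x y + cutoff_err p t a N M y x).
Proof.
move=> p1 th01 N0 M0 gp x0 y0.
have h1 := split_increment g (enormk k.+1 x) (enormk k.+1 y) (cutoff N M y) p1 th01 (cutoff_ge0 N M x).
have h2 := cutoffB_powR p1 N0 M0 x0 y0.
rewrite !testfunE// /main_term /cutoff_err.
have osc : perp_osc p M y x = perp_osc p M x y by rewrite /perp_osc distrC.
have lnE : `|ln (enormk k.+1 x / enormk k.+1 y)| = `|ln (enormk k.+1 y / enormk k.+1 x)|.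
  by rewrite !ln_div ?posrE// distrC.
rewrite (enormB y x) osc /hlog lnE x0.
have cx0 := cutoff_ge0 N M x; have s1 := cutoff_supp_ge0 N M x; have s2 := cutoff_supp_ge0 N M y.
have k0 := powR_ge0 (enorm (x - y)) (- ((k.+1 + m)%:R + t)).
have o0 : 0 <= perp_osc p M x y by exact: powR_ge0.
move: (cutoff N M x) (cutoff N M y) (cutoff_supp N M x) (cutoff_supp N M y) cx0 s1 s2 h1 h2 => cx cy S1 S2 cx0 s1 s2 h1 h2.
move: (enorm (x - y) `^ _) (perp_osc p M x y) k0 o0 h2 => K O k0 o0 h2.
move: (enormk k.+1 x) (enormk k.+1 y) x0 y0 h1 h2 {osc lnE} => X Y X0 Y0 h1 h2.
set l := `|ln (Y / X)| `^ p in h2 *.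
have ab0 : 0 <= X `^ a * Y `^ b by rewrite mulr_ge0 ?powR_ge0.
have t0 : 0 <= th `^ (1 - p) by exact: powR_ge0.
have e1 : X `^ a * Y `^ b = X `^ (a + b) * (Y / X) `^ b by rewrite weight_ratio.
have e2 : X `^ (- g * p) * X `^ (a + b) = X `^ (t - k.+1%:R).
  by rewrite -powRD ?(gt_eqF X0) ?implybT//; congr (_ `^ _); rewrite mulNr gp; ring.
have e3 : `|X `^ (- g) - Y `^ (- g)| `^ p = X `^ (- g * p) * `|1 - (Y / X) `^ (- g)| `^ p.
  rewrite [X `^ (- g * p)]powRrM -powRM ?powR_ge0//; congr (_ `^ _).
  rewrite -{2}(ger0_norm (powR_ge0 X (- g))) -normrM mulrBr mulr1; congr (`|_ - _|).
  by have := weight_ratio 0 (- g) X0 Y0; rewrite add0r powRr0 mul1r => ->.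
have e4 : Y `^ (- g * p) * (X `^ a * Y `^ b) = X `^ (t - k.+1%:R) * (Y / X) `^ (b - g * p).
  rewrite mulrCA -powRD ?(gt_eqF Y0) ?implybT//.
  rewrite [- g * p + b](_ : _ = b - g * p); last by rewrite mulNr addrC.
  by rewrite -(weight_ratio a (b - g * p) X0 Y0); congr (_ * _); congr (_ `^ _); rewrite gp; ring.
have e5 : Y `^ (- g * p) * (X `^ a * Y `^ b) = Y `^ (t - k.+1%:R) * (X / Y) `^ a.
  rewrite mulrCA -powRD ?(gt_eqF Y0) ?implybT// mulrC.
  by rewrite -(weight_ratio (- g * p + b) a Y0 X0); congr (_ * _); congr (_ `^ _); rewrite mulNr gp; ring.
rewrite [leLHS](_ : _ = `|X `^ (- g) * cx - Y `^ (- g) * cy| `^ p * (K * (X `^ a * Y `^ b))); last by ring.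
have w0 : 0 <= K * (X `^ a * Y `^ b) by rewrite mulr_ge0.
apply: (le_trans (ler_wpM2r w0 h1)); rewrite mulrDl; apply: lerD.
  rewrite e3 e1 /hgt le_eqVlt; apply/orP; left; apply/eqP.
  rewrite -e2 mulr1; ring.
rewrite -!mulrA ler_wpM2l//.
apply: (@le_trans _ _ (Y `^ (- g * p) * ((2 `^ p * ((4 / N) `^ p * l + O) * (S1 + S2)) * (K * (X `^ a * Y `^ b))))).
  by rewrite ler_wpM2l ?powR_ge0// ler_wpM2r.
rewrite le_eqVlt; apply/orP; left; apply/eqP.
transitivity (2 `^ p * (((4 / N) `^ p * l + O) * (S1 * K * (Y `^ (- g * p) * (X `^ a * Y `^ b)) +
   S2 * K * (Y `^ (- g * p) * (X `^ a * Y `^ b))))); first by ring.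
rewrite {1}e4 e5 !gp; ring.
Qed.

Lemma le_dintegral_enormk k m (f h : 'rV[R]_(k.+1 + m) -> 'rV[R]_(k.+1 + m) -> R) :
  measurable_fun setT (fun z : 'rV[R]_(k.+1 + m) * 'rV[R]_(k.+1 + m) => f z.1 z.2) ->
  measurable_fun setT (fun z : 'rV[R]_(k.+1 + m) * 'rV[R]_(k.+1 + m) => h z.1 z.2) ->
  (forall x y, 0 <= f x y) -> (forall x y, 0 <= h x y) ->
  (forall x y, 0 < enormk k.+1 x -> 0 < enormk k.+1 y -> f x y <= h x y) ->
  (\int[L (k.+1 + m)]_x \int[L (k.+1 + m)]_y (f x y)%:E <=
   \int[L (k.+1 + m)]_x \int[L (k.+1 + m)]_y (h x y)%:E)%E.
Proof.
move=> mf mh f0 h0 fh.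
have mi (F : 'rV[R]_(k.+1 + m) -> 'rV[R]_(k.+1 + m) -> R) :
    measurable_fun setT (fun z : 'rV[R]_(k.+1 + m) * 'rV[R]_(k.+1 + m) => F z.1 z.2) -> (forall x y, 0 <= F x y) ->
    measurable_fun setT (fun x => \int[L (k.+1 + m)]_y (F x y)%:E)%E /\ (forall x, 0 <= \int[L (k.+1 + m)]_y (F x y)%:E)%E.
  move=> mF F0; split; last by move=> x; apply: integral_ge0 => y _; rewrite lee_fin.
  apply: (@mfun_int R _ _ _ _ (L (k.+1 + m)) (fun x y => (F x y)%:E)); first exact: mfun_EFin.
  by move=> x y; rewrite lee_fin.
have [mf1 f1] := mi f mf f0; have [mh1 h1] := mi h mh h0.
rewrite (integral_enormk_gt0 mf1 f1) (integral_enormk_gt0 mh1 h1).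
apply: ge0_le_integral => //.
- by move=> x _; rewrite mule_ge0.
- by apply: emeasurable_funM => //; mfv.
- by apply: emeasurable_funM => //; mfv.
move=> x _; case x0 : (0 < enormk k.+1 x); last by rewrite !mule0.
rewrite !mule1.
have mfx : measurable_fun setT (fun y => (f x y)%:E) by apply: mfun_EFin; exact: (mfun_pair1 x mf).
have mhx : measurable_fun setT (fun y => (h x y)%:E) by apply: mfun_EFin; exact: (mfun_pair1 x mh).
rewrite (integral_enormk_gt0 mfx (f0 x)) (integral_enormk_gt0 mhx (h0 x)).
apply: ge0_le_integral => //.
- by move=> y _; rewrite mule_ge0// lee_fin.
- by apply: emeasurable_funM => //; mfv.
- by apply: emeasurable_funM => //; mfv.
move=> y _; case y0 : (0 < enormk k.+1 y); last by rewrite !mule0.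
by rewrite !mule1 lee_fin fh.
Qed.

End optimality.

(** * Upper bound for the energy of the test functions *)

Section sharpness.
Context (R : realType).
Notation L := (lebesgue_rV R).

Lemma dintegralZ d1 d2 (T1 : measurableType d1) (T2 : measurableType d2)
    (m1 : {sigma_finite_measure set T1 -> \bar R}) (m2 : {sigma_finite_measure set T2 -> \bar R})
    (c : R) (f : T1 -> T2 -> R) : 0 <= c ->
  measurable_fun setT (fun z => f z.1 z.2) -> (forall x y, 0 <= f x y) ->
  (\int[m1]_x \int[m2]_y (c * f x y)%:E = c%:E * \int[m1]_x \int[m2]_y (f x y)%:E)%E.
Proof.
move=> c0 mf f0; rewrite -ge0_integralZl//.
- by apply: eq_integral => x _; apply: (integralZ m2 _ (f0 x) c0); exact: (mfun_pair1 x mf).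
- apply: (@mfun_int R _ _ _ _ m2 (fun x y => (f x y)%:E)); first exact: mfun_EFin.
  by move=> x y; rewrite lee_fin.
- by move=> x _; apply: integral_ge0 => y _; rewrite lee_fin.
Qed.

Lemma main_term_ge0 k m (p t b g N M c : R) (x y : 'rV[R]_(k.+1 + m)) : 0 <= c ->
  0 <= main_term p t b g N M c x y.
Proof.
move=> c0; rewrite /main_term; apply: mulr_ge0.
  by apply: mulr_ge0 => //; rewrite mulr_ge0 ?mulr_ge0 ?powR_ge0.
by rewrite mulr_ge0 ?powR_ge0// mulr_ge0 ?powR_ge0.
Qed.

Lemma measurable_cutoff k m N M : measurable_fun setT (@cutoff R k m N M).
Proof.
have mr := @mfun_rsubmx R k.+1 m; rewrite /cutoff /logcut /sqpos.
apply: measurable_funM; first by mfv.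
apply: measurable_funX; apply: measurable_maxr => //; apply: measurable_funB => //.
by apply: measurable_funX; apply: measurable_funM => //; exact: mfun_enorm.
Qed.

Lemma measurable_main_term k m (p t b g N M c : R) :
  measurable_fun setT (fun z : 'rV[R]_(k.+1 + m) * 'rV[R]_(k.+1 + m) => main_term p t b g N M c z.1 z.2).
Proof.
have mc := @measurable_cutoff k m N M; rewrite /main_term /hgt.
apply: measurable_funM; last by mfv.
apply: measurable_funM => //; apply: measurable_funM; last by mfv.
apply: measurable_funM; last by mfv.
by apply: mfun_powR; exact: (measurableT_comp mc measurable_fst).
Qed.

(** The integral factorises exactly by [double_kernel]; this is how the sharp constant appears in
    the upper bound. *)
Lemma integral_main_term k m (s p a b g N M c : R) :
  0 < p -> 0 < s * p -> 0 < N -> 0 < M -> 0 <= c -> g * p = k.+1%:R + a + b - s * p ->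
  (\int[L (k.+1 + m)]_x \int[L (k.+1 + m)]_y (main_term p (s * p) b g N M c x y)%:E =
   c%:E * hardy_rhs s p k.+1 a b (@testfun R k m g N M) *
   ((gconst m (k.+1%:R + s * p))%:E * Jint k ((k.+1%:R + s * p) / 2) (hgt g p b)))%E.
Proof.
move=> p0 t0 N0 M0 c0 gp.
pose v (x : 'rV[R]_(k.+1 + m)) : R := c * (cutoff N M x `^ p * enormk k.+1 x `^ (s * p - k.+1%:R) * (0 < enormk k.+1 x)%R%:R).
have mc := @measurable_cutoff k m N M.
have mv : measurable_fun setT v.
  rewrite /v; apply: measurable_funM => //; apply: measurable_funM; last by mfv.
  by apply: measurable_funM; [exact: mfun_powR|mfv].
have v0 x : 0 <= v x by rewrite /v mulr_ge0 ?mulr_ge0 ?powR_ge0.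
have vK x : enormk k.+1 x = 0 -> v x = 0 by move=> x0; rewrite /v x0 ltxx !mulr0.
have mh : measurable_fun setT (hgt g p b) by rewrite /hgt; mf.
have h0 r : 0 <= hgt g p b r by rewrite mulr_ge0 ?powR_ge0.
have := double_kernel t0 mv v0 vK mh h0.
rewrite -/(main_term _ _ _ _ _ _ _ _ _) => ->; congr (_ * _)%E.
have mt : measurable_fun setT (@testfun R k m g N M).
  by apply: continuous_mfun_rV; apply: cd_continuous; exact: cd_testfun.
rewrite /hardy_rhs -integralZ//; last 2 first.
- by mfv.
- by move=> x; rewrite mulr_ge0 ?powR_ge0// invr_ge0 powR_ge0.
apply: eq_integral => x _; rewrite (rhs_pointwise M p0 N0 gp) /v; congr (_%:E).
have := enormk_ge0 k.+1 x; rewrite le_eqVlt => /predU1P[<-|x0].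
  by rewrite ltxx powR0N !mulr0 !mul0r mulr0.
rewrite x0 mulr1 /cutoff (powRM _ (logcut_ge0 _ _) (logcut_ge0 _ _)).
have -> : enormk k.+1 x `^ (- k.+1%:R) = enormk k.+1 x `^ (s * p - k.+1%:R) * enormk k.+1 x `^ (- (s * p)).
  by rewrite -powRD ?(gt_eqF x0) ?implybT//; congr (_ `^ _); ring.
ring.
Qed.

Definition hardy_density k m (p t a b : R) (u : 'rV[R]_(k.+1 + m) -> R) (x y : 'rV[R]_(k.+1 + m)) : R :=
  `|u x - u y| `^ p * enorm (x - y) `^ (- ((k.+1 + m)%:R + t)) *
   enormk k.+1 x `^ a * enormk k.+1 y `^ b.

Lemma hardy_density_ge0 k m (p t a b : R) (u : 'rV[R]_(k.+1 + m) -> R) x y :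
  0 <= hardy_density p t a b u x y.
Proof. by rewrite /hardy_density !mulr_ge0 ?powR_ge0. Qed.

Lemma measurable_hardy_density k m (p t a b : R) (u : 'rV[R]_(k.+1 + m) -> R) :
  measurable_fun setT u ->
  measurable_fun setT (fun z : 'rV[R]_(k.+1 + m) * 'rV[R]_(k.+1 + m) => hardy_density p t a b u z.1 z.2).
Proof. by move=> mu; rewrite /hardy_density; mfv. Qed.

Lemma hardy_lhsE k m (s p a b : R) (u : 'rV[R]_(k.+1 + m) -> R) : measurable_fun setT u ->
  (hardy_lhs s p k.+1 a b u =
   \int[L (k.+1 + m)]_x \int[L (k.+1 + m)]_y (hardy_density p (s * p) a b u x y)%:E)%E.
Proof.
move=> mu; have mW := measurable_hardy_density p (s * p) a b mu.
rewrite (dintegral_swap _ mW (hardy_density_ge0 p (s * p) a b u)).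
apply: eq_integral => y _; apply: eq_integral => x _.
by rewrite /hardy_density powRN.
Qed.

Lemma dintegral_enormk_bound k m (c : R) (W P E1 E2 : 'rV[R]_(k.+1 + m) -> 'rV[R]_(k.+1 + m) -> R) :
  0 <= c ->
  measurable_fun setT (fun z : 'rV[R]_(k.+1 + m) * 'rV[R]_(k.+1 + m) => W z.1 z.2) ->
  measurable_fun setT (fun z : 'rV[R]_(k.+1 + m) * 'rV[R]_(k.+1 + m) => P z.1 z.2) ->
  measurable_fun setT (fun z : 'rV[R]_(k.+1 + m) * 'rV[R]_(k.+1 + m) => E1 z.1 z.2) ->
  measurable_fun setT (fun z : 'rV[R]_(k.+1 + m) * 'rV[R]_(k.+1 + m) => E2 z.1 z.2) ->
  (forall x y, 0 <= W x y) -> (forall x y, 0 <= P x y) ->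
  (forall x y, 0 <= E1 x y) -> (forall x y, 0 <= E2 x y) ->
  (forall x y, 0 < enormk k.+1 x -> 0 < enormk k.+1 y ->
     W x y <= P x y + c * (E1 x y + E2 y x)) ->
  (\int[L (k.+1 + m)]_x \int[L (k.+1 + m)]_y (W x y)%:E <=
   \int[L (k.+1 + m)]_x \int[L (k.+1 + m)]_y (P x y)%:E +
   c%:E * (\int[L (k.+1 + m)]_x \int[L (k.+1 + m)]_y (E1 x y)%:E +
           \int[L (k.+1 + m)]_x \int[L (k.+1 + m)]_y (E2 x y)%:E))%E.
Proof.
move=> c0 mW mP mE1 mE2 W0 P0 E10 E20 inc; have mE2s := mfun_swap mE2.
have mE := measurable_funD mE1 mE2s.
have E0 x y : 0 <= E1 x y + E2 y x by exact: addr_ge0.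
have mS : measurable_fun setT (fun z : 'rV[R]_(k.+1 + m) * 'rV[R]_(k.+1 + m) => c * (E1 z.1 z.2 + E2 z.2 z.1)).
  exact: measurable_funM.
have S0 x y : 0 <= c * (E1 x y + E2 y x) by exact: mulr_ge0.
apply: (@le_trans _ _ (\int[L (k.+1 + m)]_x \int[L (k.+1 + m)]_y (P x y + c * (E1 x y + E2 y x))%:E)%E).
  apply: (@le_dintegral_enormk R k m W (fun x y => P x y + c * (E1 x y + E2 y x)) mW _ W0 _ inc).
  - exact: (measurable_funD mP mS).
  - by move=> x y; exact: addr_ge0.
rewrite (dintegralD _ _ mP mS P0 S0) (@dintegralZ _ _ _ _ _ _ c (fun x y => E1 x y + E2 y x) c0 mE E0).
by rewrite (dintegralD _ _ mE1 mE2s E10 (fun x y => E20 y x)) -(dintegral_swap _ mE2 E20).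
Qed.

Lemma testfun_lhs_bound k m (s p a b g : R) : 1 <= p -> 0 < s < 1 ->
  - k.+1%:R < a < s * p -> - k.+1%:R < b < s * p ->
  g * p = k.+1%:R + a + b - s * p -> g != 0 ->
  exists A sg : R, [/\ 0 <= A, 0 < sg & forall N th : R, 4 <= N -> 0 < th < 1 ->
  (hardy_lhs s p k.+1 a b (@testfun R k m g N (N * expR N)) <=
   ((1 - th) `^ (1 - p) * hardy_const (k.+1 + m) s p k.+1 a b)%:E *
     hardy_rhs s p k.+1 a b (@testfun R k m g N (N * expR N)) +
   (th `^ (1 - p) * A * (4 / N) `^ sg)%:E * supp_mass k m N (N * expR N))%E].
Proof.
move=> p1 s01 ha hb gp gn0.
have p0 : 0 < p := lt_le_trans ltr01 p1.
have t0 : 0 < s * p by rewrite mulr_gt0//; case/andP: s01.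
have tp : s * p < p by rewrite gtr_pMl//; case/andP: s01.
have [C0 CJ] := hardy_C1_Jint p1 s01 ha hb gp gn0.
have [ha1 ha2] := andP ha.
(* [cutoff_err_bound] is used with th = a and th = b - g p, and wants sg below t and below t - th in
   both cases; the last gap is k + 1 + a > 0. *)
pose sg := Num.min (s * p) (Num.min (s * p - a) (s * p - (b - g * p))) / 2.
have g1 : s * p - (b - g * p) = k.+1%:R + a by rewrite gp; ring.
have m0 : 0 < Num.min (s * p) (Num.min (s * p - a) (s * p - (b - g * p))).
  by rewrite !lt_min t0 g1/=; apply/andP; split; lra.
have sg0 : 0 < sg by rewrite divr_gt0.
have sgm : sg < Num.min (s * p) (Num.min (s * p - a) (s * p - (b - g * p))).
  by rewrite /sg ltr_pdivrMr// ltr_pMr// ltr1n.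
have [q1 [q2 q3]] : sg < s * p /\ sg < s * p - a /\ sg < s * p - (b - g * p).
  by move: sgm; rewrite !lt_min => /andP[-> /andP[-> ->]].
have hb' : - k.+1%:R < b - g * p < s * p.
  by rewrite gp; apply/andP; split; [move: ha2|move: ha1]; lra.
have [A1 A10 hA1] := cutoff_err_bound m t0 tp hb' sg0 q1 q3.
have [A2 A20 hA2] := cutoff_err_bound m t0 tp ha sg0 q1 q2.
clear C0 m0 sgm q1 q2 q3 g1 ha1 ha2 hb'.
exists (2 `^ p * (A1 + A2)), sg; split=> //; first by rewrite mulr_ge0 ?powR_ge0// addr_ge0.
move=> N th N4 th01; have N0 : 0 < N := lt_le_trans (ltr0Sn R 3) N4.
have M0 : 0 < N * expR N by rewrite mulr_gt0 ?expR_gt0.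
have {}hA1 := hA1 N N4; have {}hA2 := hA2 N N4.
have mt : measurable_fun setT (@testfun R k m g N (N * expR N)).
  by apply: continuous_mfun_rV; apply: cd_continuous; exact: cd_testfun.
have inc x y := @testfun_increment R k m p (s * p) a b g th N (N * expR N) x y p1 th01 N0 M0 gp.
have al0 : 0 <= (1 - th) `^ (1 - p) by exact: powR_ge0.
have IM := @integral_main_term k m s p a b g N (N * expR N) _ p0 t0 N0 M0 al0 gp.
move: (N * expR N) M0 hA1 hA2 mt inc IM => M M0 hA1 hA2 mt inc IM.
pose ga : R := th `^ (1 - p) * 2 `^ p.
have ga0 : 0 <= ga by rewrite mulr_ge0 ?powR_ge0.
have E10 x y : 0 <= @cutoff_err R k m p (s * p) (b - g * p) N M x y by exact: cutoff_err_ge0.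
have E20 x y : 0 <= @cutoff_err R k m p (s * p) a N M x y by exact: cutoff_err_ge0.
have P0 x y : 0 <= @main_term R k m p (s * p) b g N M ((1 - th) `^ (1 - p)) x y by exact: main_term_ge0.
have := @dintegral_enormk_bound k m ga _ _ _ _ ga0 (measurable_hardy_density p (s * p) a b mt)
  (@measurable_main_term k m p (s * p) b g N M ((1 - th) `^ (1 - p)))
  (@measurable_cutoff_err R k m p (s * p) (b - g * p) N M)
  (@measurable_cutoff_err R k m p (s * p) a N M)
  (hardy_density_ge0 p (s * p) a b _) P0 E10 E20 inc.
rewrite -(hardy_lhsE s p a b mt) IM -CJ hardy_constE => /le_trans; apply.
apply: leeD.
  rewrite -EFinM muleAC -EFinM//.
have sm0 : (0 <= supp_mass k m N M)%E.
  by apply: integral_ge0 => x _; rewrite lee_fin mulr_ge0 ?cutoff_supp_ge0 ?powR_ge0.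
have z0 : 0 <= (4 / N) `^ sg by exact: powR_ge0.
apply: (@le_trans _ _ (ga%:E * ((A1 * (4 / N) `^ sg)%:E * supp_mass k m N M + (A2 * (4 / N) `^ sg)%:E * supp_mass k m N M))%E).
  by apply: lee_wpmul2l; [rewrite lee_fin|exact: leeD].
rewrite -ge0_muleDl ?lee_fin ?mulr_ge0// muleA -EFinD -EFinM le_eqVlt; apply/orP; left; apply/eqP.
congr (_%:E * _)%E; rewrite /ga; ring.
Qed.

End sharpness.

(** * Optimality of the constant *)

Section optimal_constant.
Context (R : realType).

(** Testing the inequality with C' and dividing by the right-hand side gives C' <= (1-th)^(1-p) C +
    B (4/N)^sg with B independent of N. The test functions are supported off K, so the argument
    covers every domain that contains the complement of K. *)
Lemma hardy_const_optimal k m (s p a b g C' : R) (Om : set 'rV[R]_(k.+1 + m)) :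
  1 <= p -> 0 < s < 1 -> - k.+1%:R < a < s * p -> - k.+1%:R < b < s * p ->
  g * p = k.+1%:R + a + b - s * p -> g != 0 ->
  ~` @Kset R k.+1 (k.+1 + m) `<=` Om ->
  0 < hardy_const (k.+1 + m) s p k.+1 a b ->
  hardy_const (k.+1 + m) s p k.+1 a b < C' ->
  ~ hardy_inequality s p k.+1 a b Om C'.
Proof.
move=> p1 s01 ha hb gp gn0 sOm C0 CC' H.
have p0 : 0 < p := lt_le_trans ltr01 p1.
have [A [sg [A0 sg0 hA]]] := @testfun_lhs_bound R k m s p a b g p1 s01 ha hb gp gn0.
move: (hardy_const _ _ _ _ _ _) C0 CC' hA => C C0 CC' hA.
(* A level strictly between C and C' absorbs the factor (1-th)^(1-p). *)
pose C2 := (C + C') / 2.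
have C20 : 0 < C2 by rewrite /C2; lra.
have CC2 : C < C2 by rewrite /C2; lra.
have C2C' : C2 < C' by rewrite /C2; lra.
have q01 : 0 < C / C2 < 1 by rewrite divr_gt0//= ltr_pdivrMr// mul1r.
have [q0 q1] := andP q01.
(* With l = 1 - th this gives l^(1-p) C = (C/C2)^(1/p - 1) C <= C2, as 1/p - 1 >= -1 and C/C2 <
   1. *)
pose l := (C / C2) `^ p^-1.
have l0 : 0 < l by exact: powR_gt0.
have l1 : l < 1.
  have h := @gt0_ltr_powR R p^-1; rewrite invr_gt0 in h.
  have := h p0 (C / C2) 1; rewrite !nnegrE (ltW q0) ler01 powR1 => h'.
  exact: h'.
have alC : l `^ (1 - p) * C <= C2.
  rewrite /l -powRrM -ler_pdivlMr//.
  have -> : C2 / C = (C / C2) `^ (-1) by rewrite powR_inv1 ?(ltW q0)// invf_div.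
  apply: ger_powR; first by rewrite q0 ltW.
  by rewrite mulrBr mulr1 mulVf ?gt_eqF// -subr_ge0 opprK subrK invr_ge0 ltW.
pose th := 1 - l.
have th01 : 0 < th < 1 by rewrite /th; apply/andP; split; lra.
pose c : R := 2 * 2 `^ p * (2 ^+ m * 2 `^ p).
have c0 : 0 <= c by rewrite /c !mulr_ge0 ?powR_ge0// exprn_ge0.
pose B := th `^ (1 - p) * A * c.
have B0 : 0 <= B by rewrite /B !mulr_ge0 ?powR_ge0.
have key N : 4 <= N -> C' - C2 <= B * (4 / N) `^ sg.
  move=> N4; have N0 : 0 < N by lra.
  have M0 : 0 < N * expR N by rewrite mulr_gt0 ?expR_gt0.
  have [Cu1 Cu2 Cu3] := C1c_testfun k m g N0 M0.
  have Cu : C1c Om (@testfun R k m g N (N * expR N)).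
    by split=> // x /Cu3; exact: sOm.
  have h1 := le_trans (H _ Cu) (hA N th N4 th01).
  have h2 := rhs_le_supp_mass m p0 N0 M0 gp.
  have h3 := supp_mass_le_rhs m p0 N0 M0 gp.
  have /andP[h4 h5] := supp_mass_fin k m N0 M0.
  have r0 : (0 <= hardy_rhs s p k.+1 a b (@testfun R k m g N (N * expR N)))%E.
    by apply: integral_ge0 => x _; rewrite lee_fin mulr_ge0 ?powR_ge0// invr_ge0 powR_ge0.
  move: (hardy_rhs _ _ _ _ _ _) (supp_mass _ _ _ _) h1 h2 h3 h4 h5 r0 => r S h1 h2 h3 h4 h5 r0.
  have rf : (r < +oo)%E by exact: le_lt_trans h2 h5.
  have rE : r = (fine r)%:E by rewrite fineK// ge0_fin_numE.
  have SE : S = (fine S)%:E by rewrite fineK// ge0_fin_numE// ltW.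
  rewrite rE SE in h1 h3 h4 r0; move: (fine r) (fine S) h1 h3 h4 r0 => x y.
  rewrite -!EFinM -EFinD !lee_fin lte_fin -/c => h1 h3 h4 r0.
  have x0 : 0 < x.
    rewrite lt_neqAle r0 andbT; apply/eqP => x0; move: h3; rewrite -x0 mulr0; lra.
  have T0 : 0 <= th `^ (1 - p) * A * (4 / N) `^ sg by rewrite !mulr_ge0 ?powR_ge0.
  have h6 := ler_wpM2l T0 h3.
  rewrite -(ler_pM2r x0) /B.
  have tl : 1 - th = l by rewrite /th; ring.
  rewrite tl in h1.
  have h7 := ler_wpM2r r0 alC.
  set Z := th `^ (1 - p) * A in h1 h6 T0 *; set z := (4 / N) `^ sg in h1 h6 T0 *.
  have -> : Z * c * z * x = Z * z * (c * x) by ring.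
  lra.
(* The value that (4/N)^sg will take: at most 1 so that N >= 4, and small enough for B eta < C' -
   C2. Adding 1 to B keeps the denominator positive when B = 0. *)
pose eta := Num.min 1 ((C' - C2) / (2 * (B + 1))).
have B2 : 0 < 2 * (B + 1) by lra.
have e0 : 0 < eta by rewrite lt_min ltr01 divr_gt0// subr_gt0.
have e1 : eta <= 1 by rewrite ge_min lexx.
have e2 : eta <= (C' - C2) / (2 * (B + 1)) by rewrite ge_min lexx orbT.
have ep : 0 < eta `^ sg^-1 by exact: powR_gt0.
have ep1 : eta `^ sg^-1 <= 1 by apply: powR_le1; rewrite ?invr_ge0 ?(ltW sg0)// (ltW e0).
have N4 : 4 <= 4 / eta `^ sg^-1 by rewrite ler_pdivlMr// ler_piMr.
have := key _ N4.
have -> : 4 / (4 / eta `^ sg^-1) = eta `^ sg^-1 by rewrite invf_div mulrCA divff ?mulr1.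
rewrite -powRrM mulVf ?gt_eqF// powRr1 ?(ltW e0)// => h.
rewrite ler_pdivlMr// in e2.
nra.
Qed.

End optimal_constant.
Theorem theorem1p1 (R : realType) (d k : nat) (s p alpha beta : R)
    (hd : (1 <= d)%N) (hk : (1 <= k <= d)%N) (hp : 1 <= p) (hs : 0 < s < 1)
    (halpha : - k%:R < alpha < s * p) (hbeta : - k%:R < beta < s * p)
    (hab : - k%:R < alpha + beta < s * p) :
  let C := hardy_const d s p k alpha beta in
  (s * p < k%:R + alpha + beta ->
    [/\ 0 < C,
        hardy_inequality s p k alpha beta [set: 'rV[R]_d] C
      & forall C', C < C' -> ~ hardy_inequality s p k alpha beta [set: 'rV[R]_d] C'])
  /\
  (k%:R + alpha + beta < s * p ->
    [/\ 0 < C,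
        hardy_inequality s p k alpha beta (~` @Kset R k d) C
      & forall C', C < C' ->
        ~ hardy_inequality s p k alpha beta (~` @Kset R k d) C']).
Proof.
move=> C; rewrite {}/C.
(* As k >= 1 it is rewritten k.+1, and d becomes k.+1 + m. *)
case: k hk halpha hbeta hab => [//|k] /andP[_ kd] halpha hbeta /andP[_ hab].
have [m dE] : exists m, d = (k.+1 + m)%N by exists (d - k.+1)%N; rewrite subnKC.
subst d; have p0 : 0 < p := lt_le_trans ltr01 hp.
pose g := (k.+1%:R + alpha + beta - s * p) / p.
have gp : g * p = k.+1%:R + alpha + beta - s * p by rewrite /g divfK// gt_eqF.
have tab : 0 < s * p - alpha - beta by rewrite -addrA -opprD subr_gt0.
have pi0 : p^-1 != 0 by rewrite invr_eq0 gt_eqF.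
split=> h.
  (* The strict inequality between sp and k + alpha + beta says that the ground state is not
     constant. *)
  have gn0 : g != 0 by rewrite /g mulf_neq0// subr_eq0 gt_eqF.
  have [C0 CH] := @hardy_inequality_split R k m s p alpha beta g setT hp hs halpha hbeta tab gp gn0 (or_introl h).
  split=> // C' CC'.
  exact: (@hardy_const_optimal R k m s p alpha beta g C' setT hp hs halpha hbeta gp gn0 (@subsetT _ _) C0 CC').
have gn0 : g != 0 by rewrite /g mulf_neq0// subr_eq0 lt_eqF.
have [C0 CH] := @hardy_inequality_split R k m s p alpha beta g (~` @Kset R k.+1 (k.+1 + m)) hp hs halpha hbeta tab gp gn0 (or_intror erefl).
split=> // C' CC'.
exact: (@hardy_const_optimal R k m s p alpha beta g C' (~` @Kset R k.+1 (k.+1 + m)) hp hs halpha hbeta gp gn0 (@subset_refl _ _) C0 CC').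
Qed.
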